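(* Let $E$ and $F$ be quasi-Banach function lattices on $\sigma$-finite measure spaces $(\Omega_1,\Sigma_1,\mu_1)$ and $(\Omega_2,\Sigma_2,\mu_2)$, respectively. The mixed quasi-normed space $E[F]$ is normable if and only if both $E$ and $F$ are normable. In particular, for weights $u,v$ on $\mathbb{R}_+$: if $p>1$, then $\Lambda^p(u)[\Lambda^p(v)]$ is a Banach space if and only if $u\in B_p$ and $v\in B_p$; and if $p=1$, then $\Lambda^1(u)[\Lambda^1(v)]$ is a Banach space if and only if $u\in B_{1,\infty}$ and $v\in B_{1,\infty}$.
   Context: Let $(\Omega,\Sigma,\mu)$ be a $\sigma$-finite measure space and $L^0(\mu)$ the space of real-valued $\Sigma$-measurable functions on $\Omega$. A space $E\subset L^0(\mu)$ with a quasi-norm $\|\cdot\|_E$ is a quasi-normed function lattice if $f\in L^0(\mu)$, $g\in E$ and $|f|\le|g|$ a.e. imply $f\in E$ and $\|f\|_E\le\|g\|_E$; it is a quasi-Banach function lattice if in addition it is complete. The mixed space $E[F]$ consists of all $\Sigma_1\times\Sigma_2$-measurable $f:\Omega_1\times\Omega_2\to\mathbb{R}$ with $\|f\|_{E[F]}:=\big\|x\mapsto\|f(x,\cdot)\|_F\big\|_E<\infty$. A quasi-normed space is normable if there is a norm on it equivalent to the quasi-norm (each bounded by a constant multiple of the other). For the Lorentz spaces below, ''is a Banach space'' means normable in this sense (completeness always holding). A weight is a non-negative locally integrable function. For measurable $f:\mathbb{R}\to\mathbb{R}$, $f^*(t)=\inf\{\sigma:|\{x:|f(x)|>\sigma\}|\le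 t\}$, $t>0$. For a weight $v$ on $\mathbb{R}_+=(0,\infty)$ and $0<p<\infty$, $\Lambda^p(v)$ is the set of measurable $f:\mathbb{R}\to\mathbb{R}$ with $\|f\|_{\Lambda^p(v)}=\left(\int_0^\infty (f^*(t))^pv(t)\,dt\right)^{1/p}<\infty$. $\Lambda^p(u)[\Lambda^p(v)]$ is the corresponding mixed space of measurable functions $f(x,y)$ on $\mathbb{R}^2$, with $\Lambda^p(v)$ taken in $y$ and then $\Lambda^p(u)$ taken in $x$. $v\in B_p$ means: there is $C>0$ such that $r^p\int_r^\infty \frac{v(x)}{x^p}\,dx\le C\int_0^rv(x)\,dx$ for all $r>0$. $v\in B_{1,\infty}$ means: there is $C>0$ such that $\frac1r\int_0^rv(x)\,dx\le\frac Cs\int_0^sv(x)\,dx$ for all $0<s\le r<\infty$.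
   Formalization: The formal statement assumes E and F are not {0}, that the weights u and v are not a.e. zero, and that weights are integrable up to the origin (finite integral over (0,r)); without these the equivalences fail in degenerate cases, e.g. E={0}, F=L^{1/2}. *)

(* Defs.v *)
From HB Require Import structures.
From mathcomp Require Import all_boot all_order all_algebra.
From mathcomp Require Import all_classical all_reals all_analysis.

Set Implicit Arguments.
Unset Strict Implicit.
Unset Printing Implicit Defensive.
Import Order.TTheory GRing.Theory Num.Theory.
Import numFieldNormedType.Exports.

Local Open Scope classical_set_scope.
Local Open Scope ring_scope.

(* A set of real functions with a size functional, not yet subject to any axiom.
   The functional is only meaningful on the carrier. Functions are not
   quotiented by a.e. equality: definiteness below is up to null sets. *)
Record fspace (R : realType) (T : Type) := FSpace {
  carrier : set (T -> R) ;
  qnorm : (T -> R) -> R }.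

Section function_spaces.
Context {R : realType} {d : measure_display} {T : measurableType d}.
Variable mu : {measure set T -> \bar R}.
Implicit Types (X : fspace R T) (A : set (T -> R)) (q N : (T -> R) -> R).

Definition ae_zero (f : T -> R) : Prop := {ae mu, forall x, f x = 0}.

Definition linear_subspace A : Prop :=
  [/\ A (fun=> 0),
      (forall f g : T -> R, A f -> A g -> A (fun x => f x + g x)) &
      (forall (c : R) (f : T -> R), A f -> A (fun x => c * f x))].

Definition quasi_norm_with (K : R) A q : Prop :=
  [/\ (forall f : T -> R, A f -> 0 <= q f),
      (forall f : T -> R, A f -> (q f = 0 <-> ae_zero f)),
      (forall (c : R) (f : T -> R), A f -> q (fun x => c * f x) = `|c| * q f) &
      (forall f g : T -> R, A f -> A g -> q (fun x => f x + g x) <= K * (q f + q g))].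

Definition quasi_norm A q : Prop := exists K, quasi_norm_with K A q.

Definition norm_on A N : Prop := quasi_norm_with 1 A N.

Definition quasi_normed_function_lattice X : Prop :=
  [/\ linear_subspace (carrier X),
      (forall f : T -> R, carrier X f -> measurable_fun setT f),
      quasi_norm (carrier X) (qnorm X) &
      (forall f g : T -> R, measurable_fun setT f -> carrier X g ->
         {ae mu, forall x, `|f x| <= `|g x|} ->
         carrier X f /\ qnorm X f <= qnorm X g)].

Definition complete_fspace X : Prop :=
  forall f_ : nat -> T -> R,
    (forall n, carrier X (f_ n)) ->
    (forall e, 0 < e -> exists n0, forall m n, (n0 <= m)%N -> (n0 <= n)%N ->
       qnorm X (fun x => f_ m x - f_ n x) < e) ->
    exists2 f, carrier X f &
      (fun n => qnorm X (fun x => f_ n x - f x)) @ \oo --> (0 : R).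

Definition quasi_banach_function_lattice X : Prop :=
  quasi_normed_function_lattice X /\ complete_fspace X.

Definition nontrivial_fspace X : Prop :=
  exists2 f, carrier X f & ~ ae_zero f.

Definition normable X : Prop :=
  linear_subspace (carrier X) /\
  exists N, norm_on (carrier X) N /\
    exists C : R, forall f, carrier X f ->
      N f <= C * qnorm X f /\ qnorm X f <= C * N f.

Definition ext_qnorm X (f : T -> R) : \bar R :=
  if `[< carrier X f >] then (qnorm X f)%:E else +oo%E.

(* Norm in X of an arbitrary extended-real function h, needed because
   x |-> ||f(x, .)||_F may take the value +oo, and is not known to be
   measurable for a general F. When h is a.e. equal to a nonnegative measurable
   real function, this is the original quasi-norm: see outer_qnormE. *)
Definition outer_qnorm X (h : T -> \bar R) : \bar R :=
  ereal_inf [set (qnorm X g)%:E | g in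
    [set g | carrier X g /\ {ae mu, forall x, (h x <= (g x)%:E)%E}]].

Lemma outer_qnormE X (h : T -> \bar R) (k : T -> R) :
  quasi_normed_function_lattice X ->
  measurable_fun setT k -> (forall x, 0 <= k x) ->
  {ae mu, forall x, h x = (k x)%:E} ->
  outer_qnorm X h = ext_qnorm X k.
Proof.
move=> [_ _ _ lattX] mk k0 hk.
have maj g : carrier X g -> {ae mu, forall x, (h x <= (g x)%:E)%E} ->
    carrier X k /\ qnorm X k <= qnorm X g.
  move=> Xg hg; apply: lattX => //.
  apply: filterS2 hk hg => x -> kg.
  by rewrite ger0_norm// (le_trans _ (ler_norm _))// -lee_fin.
rewrite /ext_qnorm; case: asboolP => [Xk|nXk].
  apply/eqP; rewrite eq_le; apply/andP; split.
    apply: ereal_inf_lbound; exists k => //; split => //.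
    by apply: filterS hk => x ->.
  by apply: le_ereal_inf_tmp => _ [g [Xg hg] <-]; rewrite lee_fin; case: (maj g).
rewrite /outer_qnorm (_ : [set g | _] = set0) ?image_set0 ?ereal_inf0//.
by apply/seteqP; split => // g /= [Xg /(maj _ Xg)[]].
Qed.

End function_spaces.

Definition mixed (R : realType) (d1 d2 : measure_display)
    (T1 : measurableType d1) (T2 : measurableType d2)
    (mu1 : {measure set T1 -> \bar R})
    (E : fspace R T1) (F : fspace R T2) : fspace R (T1 * T2)%type :=
  let nrm (f : T1 * T2 -> R) :=
    outer_qnorm mu1 E (fun x => ext_qnorm F (fun y => f (x, y))) in
  FSpace [set f | measurable_fun setT f /\ (nrm f < +oo)%E]
         (fun f => fine (nrm f)).

Section lorentz.
Context {R : realType}.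
Notation leb := (@lebesgue_measure R).
Implicit Types (p t : R) (v : R -> R) (f : R -> R).

(* Local integrability is understood up to the origin, i.e. the primitive
   r |-> \int_0^r v is finite; otherwise Lambda^p(v) = {0}. *)
Definition weight v : Prop :=
  (forall x, 0 < x -> 0 <= v x) /\
  (forall r, 0 < r -> leb.-integrable `]0, r[ (EFin \o v)).

(* Negative s never contribute, as the measure of the level set is then +oo. *)
Definition rearrangement f t : \bar R :=
  ereal_inf [set s%:E | s in
    [set s : R | (leb [set x | s < `|f x|]%R <= t%:E)%E]].

Definition lorentz_norm p v f : \bar R :=
  ((\int[leb]_(t in `]0%R, +oo[) (rearrangement f t `^ p * (v t)%:E)) `^ p^-1)%E.

Definition Lambda p v : fspace R R :=
  FSpace [set f : R -> R | measurable_fun setT f /\ (lorentz_norm p v f < +oo)%E]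
         (fun f => fine (lorentz_norm p v f)).

Definition Bp p v : Prop :=
  exists2 C : R, 0 < C & forall r : R, 0 < r ->
    ((r `^ p)%:E * \int[leb]_(x in `]r, +oo[) (v x / x `^ p)%:E
       <= C%:E * \int[leb]_(x in `]0%R, r[) (v x)%:E)%E.

Definition B1oo v : Prop :=
  exists2 C : R, 0 < C & forall s r : R, 0 < s -> s <= r ->
    ((r^-1)%:E * \int[leb]_(x in `]0%R, r[) (v x)%:E
       <= (C / s)%:E * \int[leb]_(x in `]0%R, s[) (v x)%:E)%E.

End lorentz.

(* Main.v *)
Require Import Defs.
From mathcomp Require Import all_boot all_order all_algebra.
From mathcomp Require Import all_classical all_reals all_analysis.
From mathcomp Require Import measurable_realfun ring lra.

(** The argument rests on one reformulation. A quasi-normed space is normable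
    if and only if its quasi-norm q satisfies q(f_1 + ... + f_n) <= C (q(f_1) +
    ... + q(f_n)) with C independent of n: a norm equivalent to q gives such a C,
    and conversely the infimum of the sums of q(f_i) over all finite
    decompositions f = f_1 + ... + f_n is then a norm equivalent to q
    ([normable_finitely_subadditive], [finitely_subadditive_normable]).

    Mixed spaces. The quasi-norm of f(x) g(y) in E[F] is the product of those of
    f and g, so fixing one factor transfers finite subadditivity from E[F] to E
    and to F ([mixed_factors]). Conversely, the inequality in F bounds the fibre
    norms of a sum by C times the sum of majorants of the fibre norms, and the
    inequality in E then applies to these majorants
    ([mixed_finitely_subadditive]). That the quasi-norm of E[F] vanishes only at
    null functions is Tonelli's theorem, applied to the set where f does not
    vanish ([mixed_qnorm_eq0]).

    Lorentz spaces, necessity. Let V be the primitive of v and phi = V^(1/p), so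
    that phi(r) is the quasi-norm of the indicator of a set of measure r. The
    cyclic shifts of a step function on N consecutive cells of length r add up to
    a constant on [0, N r), while each of them has about the same quasi-norm
    ([cyclic_shifts_bound]). One nonzero cell gives phi(N r) <= 2 C N phi(r); for
    p = 1 this is B_{1,oo} ([Lambda_B1oo]). The heights 1, 1/2, ..., 1/N add up
    to about log N while the quasi-norm only gains (log N)^(1/p); for p > 1 and N
    large this yields V(N r) <= e N^p V(r) with e < 1, which iterates to B_p
    ([fundamental_function_dyadic], [growth_Bp], [Lambda_Bp]).

    Lorentz spaces, sufficiency. The integral over (0, t) of the rearrangement is
    subadditive in the function, because it is the minimum over s >= 0 of t s +
    \int (|f| - s)^+ ([rearrangement_integralD]). Integrals of a power of the
    rearrangement against two weights compare as soon as the primitives of the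
    weights do, by the layer cake formula, since the superlevel sets of the
    rearrangement are initial segments ([le_dilated_lorentz_integral]).
    For p > 1, the condition B_p makes V(r) / r^p plus the tail integral decay
    geometrically along r, 2 r, 4 r, ...
    ([Bp_doubling_growth]); this implies that passing from the rearrangement to
    its average over (0, t) multiplies the L^p(v) norm by at most a constant
    ([hardy_inequality]). The average is subadditive, and Minkowski's inequality
    concludes.
    For p = 1, the condition B_{1,oo} makes V equivalent to the concave function
    W(t) = inf_s (1 + t / s) V(s). A decreasing step weight whose primitive
    interpolates W at dyadic points is a positive combination of indicators of
    intervals (0, tau), so its Lorentz functional is subadditive
    ([step_lorentz_integral_sum]); comparing it with v restricted to [2^-n, 2^n)
    and letting n tend to infinity concludes ([B1oo_lattice]).
    In both cases the triangle inequality holds up to a constant for all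
    measurable functions, which makes the Lorentz space a lattice with a definite
    quasi-norm ([Lambda_lattice]). *)

Set Implicit Arguments.
Unset Strict Implicit.
Unset Printing Implicit Defensive.
Import Order.TTheory GRing.Theory Num.Theory.
Import numFieldNormedType.Exports.
Local Open Scope classical_set_scope.
Local Open Scope ring_scope.

(** * Norms and finite subadditivity *)

Section finite_families.
Context {R : realType} {d : measure_display} {T : measurableType d}.
Variable mu : {measure set T -> \bar R}.
Implicit Types (X : fspace R T) (A : set (T -> R)).

(** Quasi-triangle inequality for finite sums with a constant independent of
    the number of terms. Families are indexed by [nat]; only the first [n]
    members enter the sum. *)
Definition finitely_subadditive X : Prop := exists2 C : R, 0 < C &
  forall n (f_ : nat -> T -> R), (forall i, carrier X (f_ i)) ->
    qnorm X (fun x => \sum_(i < n) f_ i x) <= C * \sum_(i < n) qnorm X (f_ i).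

Lemma linear_subspace_sum A n (f_ : nat -> T -> R) :
  linear_subspace A -> (forall i, A (f_ i)) ->
  A (fun x => \sum_(i < n) f_ i x).
Proof.
move=> [A0 AD _] Af; elim: n => [|n IHn].
  by rewrite (_ : (fun _ => _) = fun=> 0)//; apply/funext => x; rewrite big_ord0.
rewrite (_ : (fun _ => _) = fun x => (\sum_(i < n) f_ i x) + f_ n x).
  exact: AD.
by apply/funext => x; rewrite big_ord_recr.
Qed.

Lemma normable_finitely_subadditive X :
  (forall f, carrier X f -> 0 <= qnorm X f) ->
  normable mu X -> finitely_subadditive X.
Proof.
move=> q0 [linX [N [[N0 Neq0 NZ ND] [C CN]]]].
have Nsum n (f_ : nat -> T -> R) : (forall i, carrier X (f_ i)) ->
    N (fun x => \sum_(i < n) f_ i x) <= \sum_(i < n) N (f_ i).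
  move=> Xf; elim: n => [|n IHn].
    rewrite big_ord0 (_ : (fun _ => _) = fun x => 0 * f_ 0%N x).
      by rewrite NZ// normr0 mul0r.
    by apply/funext => x; rewrite big_ord0 mul0r.
  rewrite (_ : (fun _ => _) = fun x => (\sum_(i < n) f_ i x) + f_ n x); last first.
    by apply/funext => x; rewrite big_ord_recr.
  rewrite big_ord_recr/= (le_trans (ND _ _ _ _))//; first exact: linear_subspace_sum.
  by rewrite mul1r lerD2r.
exists (`|C| * `|C| + 1); first by rewrite ltr_pwDr// mulr_ge0.
move=> n f_ Xf; have Xs := linear_subspace_sum n linX Xf.
have s0 : 0 <= \sum_(i < n) qnorm X (f_ i) by apply: sumr_ge0 => i _; exact: q0.
rewrite mulrDl mul1r ler_wpDr// -mulrA (le_trans (CN _ Xs).2)//.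
rewrite (le_trans (ler_wpM2r (N0 _ Xs) (ler_norm C)))// ler_wpM2l//.
rewrite (le_trans (Nsum _ _ Xf))// mulr_sumr ler_sum// => i _.
by rewrite (le_trans (CN _ (Xf i)).1)// ler_wpM2r ?ler_norm ?q0.
Qed.

Section convex_hull_norm.
Variable X : fspace R T.

(** The values of the sum of the [qnorm X (g i)] over all finite
    decompositions of [f] into members [g i] of [X]. *)
Definition decomposition_sums (f : T -> R) : set R :=
  [set r | exists n (g : nat -> T -> R), [/\ forall i, carrier X (g i),
     f = (fun x => \sum_(i < n) g i x) & r = \sum_(i < n) qnorm X (g i)]].

(** The largest seminorm below the quasi-norm of [X], that is, the gauge of
    the convex hull of its unit ball. *)
Definition hull_norm (f : T -> R) : R := inf (decomposition_sums f).

Hypotheses (linX : linear_subspace (carrier X))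
  (qX : quasi_norm mu (carrier X) (qnorm X)).

Let q0 f : carrier X f -> 0 <= qnorm X f.
Proof. by case: qX => K [+ _ _ _]; apply. Qed.

Let qZ (c : R) f : carrier X f -> qnorm X (fun x => c * f x) = `|c| * qnorm X f.
Proof. by case: qX => K [_ _ + _]; apply. Qed.

Let X0 : carrier X (fun=> 0). Proof. by case: linX. Qed.

Let XZ (c : R) f : carrier X f -> carrier X (fun x => c * f x).
Proof. by case: linX => _ _; apply. Qed.

Lemma decomposition_sums_ge0 f : lbound (decomposition_sums f) 0.
Proof. by move=> _ [n [g [Xg _ ->]]]; apply: sumr_ge0 => i _; exact: q0. Qed.

Lemma decomposition_sums1 f : carrier X f -> decomposition_sums f (qnorm X f).
Proof.
move=> Xf; exists 1%N, (fun=> f); split => //; last by rewrite big_ord1.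
by apply/funext => x; rewrite big_ord1.
Qed.

Lemma decomposition_sumsD f g r s :
  decomposition_sums f r -> decomposition_sums g s ->
  decomposition_sums (fun x => f x + g x) (r + s).
Proof.
move=> [m [u [Xu -> ->]]] [n [v [Xv -> ->]]].
exists (m + n)%N, (fun i => if (i < m)%N then u i else v (i - m)%N); split.
- by move=> i; case: ifP.
- apply/funext => x; rewrite big_split_ord/=; congr (_ + _); apply: eq_bigr => i _.
    by rewrite /= ltn_ord.
  by rewrite /= ltnNge leq_addr/= addKn.
- rewrite big_split_ord/=; congr (_ + _); apply: eq_bigr => i _.
    by rewrite /= ltn_ord.
  by rewrite /= ltnNge leq_addr/= addKn.
Qed.

Lemma decomposition_sumsZ (c : R) f r : decomposition_sums f r ->
  decomposition_sums (fun x => c * f x) (`|c| * r).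
Proof.
move=> [n [g [Xg -> ->]]]; exists n, (fun i x => c * g i x); split.
- by move=> i; exact: XZ.
- by apply/funext => x; rewrite mulr_sumr.
- by rewrite mulr_sumr; apply: eq_bigr => i _; rewrite qZ.
Qed.

Lemma hull_norm_le f r : decomposition_sums f r -> hull_norm f <= r.
Proof. by apply: ge_inf; exists 0; exact: decomposition_sums_ge0. Qed.

Lemma hull_norm_ge f r : carrier X f ->
  lbound (decomposition_sums f) r -> r <= hull_norm f.
Proof.
by move=> Xf fr; apply: lb_le_inf => //; exists (qnorm X f); exact: decomposition_sums1.
Qed.

(** Only one inequality is needed: applied to [c^-1] it gives the other. *)
Lemma hull_normZ_le (c : R) f : carrier X f -> c != 0 ->
  hull_norm (fun x => c * f x) <= `|c| * hull_norm f.
Proof.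
move=> Xf c0; rewrite -ler_pdivrMl ?normr_gt0//; apply: hull_norm_ge => // r fr.
by rewrite ler_pdivrMl ?normr_gt0//; exact/hull_norm_le/decomposition_sumsZ.
Qed.

Lemma finitely_subadditive_normable : finitely_subadditive X -> normable mu X.
Proof.
move=> [C C0 CX]; split => //; exists hull_norm.
have N0 f : carrier X f -> 0 <= hull_norm f.
  by move=> Xf; apply: hull_norm_ge => //; exact: decomposition_sums_ge0.
have Nq f : carrier X f -> hull_norm f <= qnorm X f.
  by move=> Xf; apply: hull_norm_le; exact: decomposition_sums1.
have qN f : carrier X f -> qnorm X f <= C * hull_norm f.
  move=> Xf; rewrite -ler_pdivrMl//; apply: hull_norm_ge => // _ [n [g [Xg fE ->]]].
  by rewrite ler_pdivrMl// fE CX.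
split; last first.
  exists (C + 1) => f Xf; split.
    by rewrite (le_trans (Nq _ Xf))// mulrDl mul1r lerDr mulr_ge0 ?q0// ltW.
  by rewrite (le_trans (qN _ Xf))// mulrDl mul1r lerDl N0.
have [K [_ qeq0 _ _]] := qX.
split => //.
- move=> f Xf; rewrite -qeq0//; split => [Nf0|qf0].
    by apply/eqP; rewrite eq_le q0// andbT (le_trans (qN _ Xf))// Nf0 mulr0.
  by apply/eqP; rewrite eq_le N0// andbT -qf0 Nq.
- move=> c f Xf; have [->|c0] := eqVneq c 0.
    rewrite normr0 mul0r; apply/eqP; rewrite eq_le N0 ?andbT; last exact: XZ.
    by rewrite (le_trans (Nq _ (XZ 0 Xf)))// qZ// normr0 mul0r.
  apply/eqP; rewrite eq_le hull_normZ_le//=.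
  have cV0 : c^-1 != 0 by rewrite invr_eq0.
  rewrite -ler_pdivlMl ?normr_gt0// -normfV.
  apply: le_trans (hull_normZ_le (XZ c Xf) cV0).
  by under eq_fun do rewrite mulrA mulVf// mul1r.
- move=> f g Xf Xg; rewrite mul1r -lerBlDr; apply: hull_norm_ge => // r fr.
  rewrite lerBlDl -lerBlDr; apply: hull_norm_ge => // s gs.
  by rewrite lerBlDr addrC [leRHS]addrC; apply: hull_norm_le; rewrite addrC; exact: decomposition_sumsD.
Qed.

End convex_hull_norm.

(** What remains of a quasi-normed function lattice without any addition and
    without definiteness. The Lorentz space of an arbitrary weight has this
    structure even when it is not a linear space. *)
Definition homogeneous_lattice X : Prop :=
  [/\ (forall f, carrier X f -> measurable_fun setT f),
      (forall f, carrier X f -> 0 <= qnorm X f),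
      (forall (c : R) f, carrier X f -> carrier X (fun x => c * f x) /\
         qnorm X (fun x => c * f x) = `|c| * qnorm X f) &
      (forall f g : T -> R, measurable_fun setT f -> carrier X g ->
         {ae mu, forall x, `|f x| <= `|g x|} ->
         carrier X f /\ qnorm X f <= qnorm X g)].

Lemma quasi_normed_homogeneous X :
  quasi_normed_function_lattice mu X -> homogeneous_lattice X.
Proof.
move=> [[X0 XD XZ] mX [K [q0 _ qZ _]] lX]; split => // c f Xf.
by split; [exact: XZ|exact: qZ].
Qed.

Lemma homogeneous_abs X f : homogeneous_lattice X -> carrier X f ->
  carrier X (fun x => `|f x|) /\ qnorm X (fun x => `|f x|) = qnorm X f.
Proof.
move=> [mX q0 qZ lX] Xf.
have mf := mX _ Xf.
have maf : measurable_fun setT (fun x => `|f x|) by exact: measurableT_comp.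
have [Xaf af] : carrier X (fun x => `|f x|) /\ qnorm X (fun x => `|f x|) <= qnorm X f.
  by apply: lX => //; apply: aeW => x; rewrite normr_id.
split => //; apply/eqP; rewrite eq_le af/=.
suff [] : carrier X f /\ qnorm X f <= qnorm X (fun x => `|f x|) by [].
by apply: lX => //; apply: aeW => x; rewrite normr_id.
Qed.

Lemma homogeneous_ae_zero X f : homogeneous_lattice X -> carrier X f ->
  ae_zero mu f -> qnorm X f = 0.
Proof.
move=> [mX q0 qZ lX] Xf f0; have [Xf0 qf0] := qZ 0 f Xf.
have [|_] := lX f _ (mX _ Xf) Xf0.
  by apply: filterS f0 => x ->; rewrite mulr0.
by rewrite qf0 normr0 mul0r => qle; apply/eqP; rewrite eq_le qle q0.
Qed.

Lemma ext_qnorm_le X f (r : R) :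
  (ext_qnorm X f <= r%:E)%E <-> carrier X f /\ qnorm X f <= r.
Proof.
by rewrite /ext_qnorm; case: asboolP => Xf; rewrite ?lee_fin; split => // -[].
Qed.

End finite_families.

(** * The mixed space and elementary tensors *)

Section mixed_space.
Context {R : realType} {d1 d2 : measure_display}
  {T1 : measurableType d1} {T2 : measurableType d2}.
Variables (mu1 : {measure set T1 -> \bar R}) (E : fspace R T1) (F : fspace R T2).
Implicit Types (f : T1 * T2 -> R) (g : T1 -> R).

Local Notation EF := (mixed mu1 E F).

(** The members of [E] that dominate, almost everywhere, the norms in [F] of
    the fibres of [f]. The quasi-norm of [f] in the mixed space is the infimum of
    their quasi-norms, whether or not the function of fibre norms is
    measurable. *)
Definition fiber_majorant f : set (T1 -> R) :=
  [set g | carrier E g /\ {ae mu1, forall x,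
     carrier F (fun y => f (x, y)) /\ qnorm F (fun y => f (x, y)) <= g x}].

Hypothesis E0 : forall g, carrier E g -> 0 <= qnorm E g.

Lemma outer_qnorm_fiber f :
  outer_qnorm mu1 E (fun x => ext_qnorm F (fun y => f (x, y))) =
  ereal_inf [set (qnorm E g)%:E | g in fiber_majorant f].
Proof.
rewrite /outer_qnorm; congr ereal_inf; congr (_ @` _).
by apply/seteqP; split => g [Eg fg]; split => //; apply: filterS fg => x /ext_qnorm_le.
Qed.

Lemma mixed_carrierP f : carrier EF f <->
  measurable_fun setT f /\ fiber_majorant f !=set0.
Proof.
rewrite /= outer_qnorm_fiber; split => [[mf]|[mf [g fg]]]; last first.
  split => //; apply: le_lt_trans (ltry (qnorm E g)).
  by apply: ereal_inf_lbound; exists g.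
by move=> /ereal_inf_lt[_ [g fg _] _]; split => //; exists g.
Qed.

Lemma mixed_outer f : carrier EF f ->
  (qnorm EF f)%:E = ereal_inf [set (qnorm E g)%:E | g in fiber_majorant f].
Proof.
rewrite /= outer_qnorm_fiber => -[_ foo]; rewrite fineK// ge0_fin_numE//.
by apply: le_ereal_inf_tmp => _ [g [Eg _] <-]; rewrite lee_fin E0.
Qed.

Lemma mixed_qnorm_le f g : carrier EF f -> fiber_majorant f g ->
  qnorm EF f <= qnorm E g.
Proof.
move=> /mixed_outer + fg; rewrite -lee_fin => ->.
by apply: ereal_inf_lbound; exists g.
Qed.

Lemma mixed_qnorm_ge f r : carrier EF f ->
  (forall g, fiber_majorant f g -> r <= qnorm E g) -> r <= qnorm EF f.
Proof.
move=> /mixed_outer + fr; rewrite -lee_fin => ->.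
by apply: le_ereal_inf_tmp => _ [g fg <-]; rewrite lee_fin fr.
Qed.

Lemma mixed_qnorm_adherent f e : carrier EF f -> 0 < e ->
  exists2 g, fiber_majorant f g & qnorm E g < qnorm EF f + e.
Proof.
move=> EFf e0; have fE := mixed_outer EFf.
have : (ereal_inf [set (qnorm E g)%:E | g in fiber_majorant f] <
        (qnorm EF f + e)%:E)%E by rewrite -fE lte_fin ltrDl.
by move=> /ereal_inf_lt[_ [g fg <-]]; rewrite lte_fin; exists g.
Qed.

Lemma mixed_qnorm_ge0 f : carrier EF f -> 0 <= qnorm EF f.
Proof. by move=> EFf; apply: mixed_qnorm_ge => // g [Eg _]; exact: E0. Qed.

End mixed_space.

Section tensor.
Context {R : realType} {d1 d2 : measure_display}
  {T1 : measurableType d1} {T2 : measurableType d2}.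
Variables (mu1 : {measure set T1 -> \bar R}) (mu2 : {measure set T2 -> \bar R}).
Variables (E : fspace R T1) (F : fspace R T2).
Hypotheses (hE : homogeneous_lattice mu1 E) (hF : homogeneous_lattice mu2 F).

Local Notation EF := (mixed mu1 E F).

(** The elementary tensor f(x) g(y). *)
Definition tensor (f : T1 -> R) (g : T2 -> R) (z : T1 * T2) : R := f z.1 * g z.2.

Lemma measurable_tensor f g : measurable_fun setT f -> measurable_fun setT g ->
  measurable_fun setT (tensor f g).
Proof.
by move=> mf mg; apply: measurable_funM; exact: measurableT_comp.
Qed.

Lemma tensor_majorant f g : carrier E f -> carrier F g ->
  fiber_majorant mu1 E F (tensor f g) (fun x => qnorm F g * `|f x|).
Proof.
move=> Ef Fg; have [Eaf _] := homogeneous_abs hE Ef.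
split; first by case: hE => _ _ + _ => /(_ (qnorm F g) _ Eaf)[].
apply: aeW => x; have [_ _ /(_ (f x) g Fg)[Fxg qxg] _] := hF.
by split => //; rewrite [leLHS]qxg mulrC.
Qed.

Lemma tensor_carrier f g : carrier E f -> carrier F g -> carrier EF (tensor f g).
Proof.
move=> Ef Fg; apply/mixed_carrierP; split.
  by apply: measurable_tensor; [case: hE => + _ _ _; exact|case: hF => + _ _ _; exact].
by exists (fun x => qnorm F g * `|f x|); exact: tensor_majorant.
Qed.

Let E0 f : carrier E f -> 0 <= qnorm E f. Proof. by case: hE => _ + _ _; exact. Qed.
Let F0 f : carrier F f -> 0 <= qnorm F f. Proof. by case: hF => _ + _ _; exact. Qed.

Lemma tensor_qnorm f g : carrier E f -> carrier F g ->
  qnorm EF (tensor f g) = qnorm E f * qnorm F g.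
Proof.
move=> Ef Fg; have EFfg := tensor_carrier Ef Fg.
have [Eaf qaf] := homogeneous_abs hE Ef.
have [mE _ EZ lE] := hE.
apply/eqP; rewrite eq_le; apply/andP; split.
  rewrite (le_trans (mixed_qnorm_le E0 EFfg (tensor_majorant Ef Fg)))//.
  by have [_ ->] := EZ (qnorm F g) _ Eaf; rewrite qaf mulrC ger0_norm// F0.
apply: mixed_qnorm_ge => // k [Ek fk].
have [Egf qgf] := EZ (qnorm F g) _ Ef.
have [] := lE _ _ (mE _ Egf) Ek.
  apply: filterS fk => x [_]; have [_ _ /(_ (f x) g Fg)[_ +] _] := hF.
  rewrite /tensor/= => -> fgk; rewrite normrM (ger0_norm (F0 Fg)) mulrC.
  by rewrite (le_trans fgk)// ler_norm.
by rewrite qgf (ger0_norm (F0 Fg)) mulrC.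
Qed.

(** The first factor of a tensor of the mixed space lies in [E]: a majorant of
    the fibre norms dominates a multiple of it. *)
Lemma tensor_carrierl f g : measurable_fun setT f -> carrier F g ->
  0 < qnorm F g -> carrier EF (tensor f g) -> carrier E f.
Proof.
move=> mf Fg g0 /mixed_carrierP[_ [k [Ek fk]]]; have [_ _ EZ lE] := hE.
have [] := lE (fun x => qnorm F g * f x) k _ Ek.
- exact: measurable_funM.
- apply: filterS fk => x [_]; have [_ _ /(_ (f x) g Fg)[_ +] _] := hF.
  rewrite /tensor/= => -> fgk; rewrite normrM (ger0_norm (F0 Fg)) mulrC.
  by rewrite (le_trans fgk)// ler_norm.
move=> /(EZ (qnorm F g)^-1)[+ _] _; rewrite (_ : (fun _ => _) = f)//.
by apply/funext => x; rewrite mulrA mulVf ?mul1r// gt_eqF.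
Qed.

(** The second factor of a tensor of the mixed space lies in [F]: otherwise no
    fibre over a point where [f] is nonzero would be in [F], so [f] would vanish
    almost everywhere. *)
Lemma tensor_carrierr f g : carrier E f -> 0 < qnorm E f ->
  carrier EF (tensor f g) -> carrier F g.
Proof.
move=> Ef f0 /mixed_carrierP[_ [k [Ek fk]]]; have [_ _ FZ _] := hF.
have [//|nFg] := pselect (carrier F g); exfalso.
suff : ae_zero mu1 f by move=> /(homogeneous_ae_zero hE Ef) fE; rewrite fE ltxx in f0.
apply: filterS fk => x [Fxg _]; apply/eqP; apply: contra_notT nFg => fx0.
have [+ _] := FZ (f x)^-1 _ Fxg; rewrite /tensor/= (_ : (fun _ => _) = g)//.
by apply/funext => y; rewrite mulrA mulVf ?mul1r.
Qed.

Lemma mixed_factorl g : carrier F g -> 0 < qnorm F g ->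
  linear_subspace (carrier EF) -> finitely_subadditive EF ->
  (exists f, carrier E f) ->
  linear_subspace (carrier E) /\ finitely_subadditive E.
Proof.
move=> Fg g0 [EF0 EFD EFZ] [C C0 EFC] [h Eh].
have [mE qE0 EZ lE] := hE.
have linE : linear_subspace (carrier E).
  split=> [|f1 f2 E1 E2|c f Ef]; last by have [] := EZ c f Ef.
    have [+ _] := EZ 0 h Eh; rewrite (_ : (fun _ => _) = fun=> 0)//.
    by apply/funext => x; rewrite mul0r.
  apply: (tensor_carrierl _ Fg g0).
    by apply: measurable_funD; exact: mE.
  rewrite (_ : tensor _ _ = fun z => tensor f1 g z + tensor f2 g z).
    by apply: EFD; exact: tensor_carrier.
  by apply/funext => z; rewrite /tensor mulrDl.
split => //; exists C => // n f_ Ef; have Es := linear_subspace_sum n linE Ef.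
rewrite -(ler_pM2r g0) -tensor_qnorm// -mulrA mulr_suml.
rewrite (_ : tensor _ _ = fun z => \sum_(i < n) tensor (f_ i) g z); last first.
  by apply/funext => z; rewrite /tensor mulr_suml.
rewrite (le_trans (EFC _ (fun i => tensor (f_ i) g) _))//.
  by move=> i; exact: tensor_carrier.
by rewrite ler_pM2l// ler_sum// => i _; rewrite tensor_qnorm.
Qed.

Lemma mixed_factorr f : carrier E f -> 0 < qnorm E f ->
  linear_subspace (carrier EF) -> finitely_subadditive EF ->
  (exists g, carrier F g) ->
  linear_subspace (carrier F) /\ finitely_subadditive F.
Proof.
move=> Ef f0 [EF0 EFD EFZ] [C C0 EFC] [h Fh].
have [mF qF0 FZ lF] := hF.
have linF : linear_subspace (carrier F).
  split=> [|g1 g2 F1 F2|c g Fg]; last by have [] := FZ c g Fg.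
    have [+ _] := FZ 0 h Fh; rewrite (_ : (fun _ => _) = fun=> 0)//.
    by apply/funext => x; rewrite mul0r.
  apply: (tensor_carrierr Ef f0).
  rewrite (_ : tensor _ _ = fun z => tensor f g1 z + tensor f g2 z).
    by apply: EFD; exact: tensor_carrier.
  by apply/funext => z; rewrite /tensor mulrDr.
split => //; exists C => // n g_ Fg; have Fs := linear_subspace_sum n linF Fg.
rewrite -(ler_pM2l f0) -tensor_qnorm// mulrCA mulr_sumr.
rewrite (_ : tensor _ _ = fun z => \sum_(i < n) tensor f (g_ i) z); last first.
  by apply/funext => z; rewrite /tensor mulr_sumr.
rewrite (le_trans (EFC _ (fun i => tensor f (g_ i)) _))//.
  by move=> i; exact: tensor_carrier.
by rewrite ler_pM2l// ler_sum// => i _; rewrite tensor_qnorm.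
Qed.

End tensor.

(** * Normability of the mixed space *)

Section null_fibers.
Context {R : realType} {d1 d2 : measure_display}
  {T1 : measurableType d1} {T2 : measurableType d2}.
Variables (mu1 : {sigma_finite_measure set T1 -> \bar R})
  (mu2 : {sigma_finite_measure set T2 -> \bar R}).

(** Tonelli's theorem for the indicator of the set where [f] is nonzero. *)
Lemma ae_zero_fibers (f : T1 * T2 -> R) : measurable_fun setT f ->
  ae_zero (mu1 \x mu2)%E f <->
  {ae mu1, forall x, ae_zero mu2 (fun y => f (x, y))}.
Proof.
move=> mf; pose S := [set z | f z != 0].
have mS : measurable S.
  rewrite (_ : S = ~` (f @^-1` [set 0])).
    by apply: measurableC; rewrite -[X in measurable X]setTI; exact: mf.
  by apply/seteqP; split => z /= /eqP.
have mxS := measurable_fun_xsection mu2 mS.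
have SE : ae_zero (mu1 \x mu2)%E f <-> (mu1 \x mu2)%E S = 0%E.
  split=> [[N [mN N0 fN]]|S0].
    by apply: (subset_measure0 mS mN) => // z /= /eqP fz; exact: fN.
  by exists S; split => // z /= /eqP fz.
have fiberE x : ae_zero mu2 (fun y => f (x, y)) <-> mu2 (xsection S x) = 0%E.
  have mSx : measurable (xsection S x) by exact: measurable_xsection.
  split=> [[N [mN N0 fN]]|S0].
    apply: (subset_measure0 mSx mN) => // y; rewrite /xsection/= inE/= => /eqP fz.
    exact: fN.
  by exists (xsection S x); split => // y /= /eqP fz; rewrite /xsection/= inE.
have S0E : (mu1 \x mu2)%E S = (\int[mu1]_x `|(mu2 \o xsection S) x|)%E.
  by rewrite /= /product_measure1; apply: eq_integral => x _; rewrite gee0_abs.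
rewrite SE S0E; split.
  move=> /(ae_eq_integral_abs _ measurableT mxS); apply: filterS => x Sx.
  by apply/fiberE; exact: Sx.
move=> f0; apply/(ae_eq_integral_abs _ measurableT mxS).
by apply: filterS f0 => x /fiberE + _.
Qed.

End null_fibers.

Section mixed_normable.
Context {R : realType} {d1 d2 : measure_display}
  {T1 : measurableType d1} {T2 : measurableType d2}.
Variables (mu1 : {sigma_finite_measure set T1 -> \bar R})
  (mu2 : {sigma_finite_measure set T2 -> \bar R}).
Variables (E : fspace R T1) (F : fspace R T2).
Hypotheses (lE : quasi_normed_function_lattice mu1 E)
  (lF : quasi_normed_function_lattice mu2 F).

Local Notation EF := (mixed mu1 E F).

Let hE := quasi_normed_homogeneous lE.
Let hF := quasi_normed_homogeneous lF.
Let E0 f : carrier E f -> 0 <= qnorm E f. Proof. by case: hE => _ + _ _; exact. Qed.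
Let F0 f : carrier F f -> 0 <= qnorm F f. Proof. by case: hF => _ + _ _; exact. Qed.
Let linE : linear_subspace (carrier E). Proof. by case: lE. Qed.
Let linF : linear_subspace (carrier F). Proof. by case: lF. Qed.

Lemma fiber_majorant_sum (C : R) n (f_ : nat -> T1 * T2 -> R) (g_ : nat -> T1 -> R) :
  (forall h_ : nat -> T2 -> R, (forall i, carrier F (h_ i)) ->
    qnorm F (fun x => \sum_(i < n) h_ i x) <= C * \sum_(i < n) qnorm F (h_ i)) ->
  0 < C -> (forall i, fiber_majorant mu1 E F (f_ i) (g_ i)) ->
  fiber_majorant mu1 E F (fun z => \sum_(i < n) f_ i z)
    (fun x => C * \sum_(i < n) g_ i x).
Proof.
move=> FC C0 fg; split.
  have [_ _] := linE; apply.
  by apply: linear_subspace_sum => // i; have [] := fg i.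
have : {ae mu1, forall x, forall i, carrier F (fun y => f_ i (x, y)) /\
    qnorm F (fun y => f_ i (x, y)) <= g_ i x}.
  by apply: ae_foralln => i; have [] := fg i.
apply: filterS => x fgx.
have Fx i : carrier F (fun y => f_ i (x, y)) by have [] := fgx i.
split; first exact: (@linear_subspace_sum _ _ _ _ n (fun i y => f_ i (x, y))).
rewrite (le_trans (FC (fun i y => f_ i (x, y)) Fx))// ler_pM2l//.
by apply: ler_sum => i _; have [] := fgx i.
Qed.

Lemma mixed_linear : linear_subspace (carrier EF).
Proof.
have [E00 ED EZ] := linE; have [F00 FD FZ] := linF.
have [_ _ [K [_ _ qFZ KF]] _] := lF.
split.
- apply/mixed_carrierP; split => //; exists (fun=> 0); split => //.
  apply: aeW => x; split => //.
  by rewrite (homogeneous_ae_zero hF F00)//; exact: aeW.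
- move=> f g /mixed_carrierP[mf [h [Eh fh]]] /mixed_carrierP[mg [k [Ek gk]]].
  apply/mixed_carrierP; split; first exact: measurable_funD.
  exists (fun x => `|K| * (h x + k x)); split; first by apply: EZ; exact: ED.
  apply: filterS2 fh gk => x [Ff fh] [Fg gk]; split; first exact: FD.
  rewrite (le_trans (KF _ _ Ff Fg))//.
  rewrite (@le_trans _ _ (`|K| * (qnorm F (fun y => f (x, y)) + qnorm F (fun y => g (x, y)))))//.
    by rewrite ler_wpM2r ?ler_norm// addr_ge0// F0.
  by rewrite ler_wpM2l// lerD.
- move=> c f /mixed_carrierP[mf [h [Eh fh]]]; apply/mixed_carrierP.
  split; first exact: measurable_funM.
  exists (fun x => `|c| * h x); split; first exact: EZ.
  apply: filterS fh => x [Ff fh]; split; first exact: FZ.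
  by rewrite qFZ// ler_wpM2l.
Qed.

(** Definiteness. If the quasi-norm of [f] vanishes, there are majorants of
    the fibre norms of arbitrarily small quasi-norm; the infimum of a sequence of
    them is still in [E], still a majorant, and of quasi-norm zero. *)
Lemma mixed_qnorm_eq0 f : carrier EF f ->
  qnorm EF f = 0 <-> ae_zero (mu1 \x mu2)%E f.
Proof.
move=> EFf; have /mixed_carrierP[mf _] := EFf.
have [_ mE [KE [_ Eeq0 _ _]] latE] := lE.
have [_ _ [KF [_ Feq0 _ _]] _] := lF.
rewrite ae_zero_fibers//; split => [f0|f0]; last first.
  have [E00 _ _] := linE; apply/eqP; rewrite eq_le mixed_qnorm_ge0// andbT.
  rewrite -(homogeneous_ae_zero hE E00); last exact: aeW.
  have EFf' := EFf; have /mixed_carrierP[_ [h [_ fh]]] := EFf'.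
  apply: mixed_qnorm_le => //; split => //.
  apply: filterS2 f0 fh => x f0 [Ff _]; split => //.
  by rewrite (homogeneous_ae_zero hF).
have gP n : {g | fiber_majorant mu1 E F f g /\ qnorm E g < n.+1%:R^-1}.
  apply: cid; have [|g fg] := @mixed_qnorm_adherent _ _ _ _ _ mu1 E F E0 f n.+1%:R^-1 EFf.
    by rewrite invr_gt0.
  by rewrite f0 add0r => gn; exists g.
pose g_ n := sval (gP n).
have fg n : fiber_majorant mu1 E F f (g_ n) by exact: (svalP (gP n)).1.
have gn n : qnorm E (g_ n) < n.+1%:R^-1 by exact: (svalP (gP n)).2.
have Eg n : carrier E (g_ n) by have [] := fg n.
(* the absolute values make the infimum bounded below; almost everywhere they
   agree with the majorants *)
pose g x := infs (fun n => `|g_ n x|) 0.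
have lbg x : lbound [set `|g_ k x| | k in [set k | (0 <= k)%N]] 0.
  by move=> _ [k _ <-]; exact: normr_ge0.
have ggn n x : g x <= `|g_ n x|.
  by apply: ge_inf; [exists 0; exact: lbg|exists n].
have g0 x : 0 <= g x.
  by apply: lb_le_inf; [exists `|g_ 0%N x|; exists 0%N|exact: lbg].
have mg : measurable_fun setT g.
  apply: (@measurable_fun_infs _ _ _ _ (fun n x => `|g_ n x|)).
    by move=> x _; exists 0 => _ [k _ <-]; exact: normr_ge0.
  by move=> n; apply: measurableT_comp; [exact: normr_measurable|exact/mE/Eg].
have gE n : carrier E g /\ qnorm E g <= qnorm E (g_ n).
  by apply: latE => //; apply: aeW => x; rewrite ger0_norm.
have Eg' : carrier E g by have [] := gE 0%N.
have : qnorm E g = 0.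
  apply/eqP; rewrite eq_le E0 ?andbT//.
  rewrite leNgt; apply/negP => qg0.
  have [k] := ltr_add_invr qg0; rewrite add0r => kg.
  have [_ gk] := gE k.
  by have := lt_trans (lt_le_trans kg gk) (gn k); rewrite ltxx.
have fgn : {ae mu1, forall x, forall n, carrier F (fun y => f (x, y)) /\
    qnorm F (fun y => f (x, y)) <= g_ n x}.
  by apply: ae_foralln => n; have [] := fg n.
move=> /(Eeq0 _ Eg') gx0; apply: filterS2 gx0 fgn => x gx0 fgx.
have Fx : carrier F (fun y => f (x, y)) by have [] := fgx 0%N.
apply/Feq0 => //; apply/eqP; rewrite eq_le F0// andbT -gx0.
apply: lb_le_inf; first by exists `|g_ 0%N x|; exists 0%N.
move=> _ [k _ <-]; have [_ fk] := fgx k.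
by rewrite (le_trans fk)// ler_norm.
Qed.

Lemma mixed_quasi_norm : finitely_subadditive EF ->
  quasi_norm (mu1 \x mu2)%E (carrier EF) (qnorm EF).
Proof.
move=> [C C0 EFC]; exists C; split.
- by move=> f EFf; exact: mixed_qnorm_ge0.
- by move=> f EFf; exact: mixed_qnorm_eq0.
- have [_ _ EFZ] := mixed_linear.
  have [_ _ [_ [_ _ qEZ _]] _] := lE; have [_ _ EZ] := linE.
  have [_ _ [_ [_ _ qFZ _]] _] := lF; have [_ _ FZ] := linF.
  have qZ_le (c : R) f : carrier EF f -> c != 0 ->
      qnorm EF (fun z => c * f z) <= `|c| * qnorm EF f.
    move=> EFf c0; rewrite -ler_pdivrMl ?normr_gt0//.
    apply: mixed_qnorm_ge => // g [Eg fg]; rewrite ler_pdivrMl ?normr_gt0//.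
    rewrite -[X in _ <= X * _](@normr_id _ _ c) -qEZ//; apply: mixed_qnorm_le => //.
      exact: EFZ.
    split; first exact: EZ.
    apply: filterS fg => x [Ff fg]; split; first exact: FZ.
    by rewrite qFZ// ler_wpM2l.
  move=> c f EFf; have [->|c0] := eqVneq c 0.
    rewrite normr0 mul0r; apply/mixed_qnorm_eq0; first exact: EFZ.
    by apply: aeW => z; rewrite mul0r.
  apply/eqP; rewrite eq_le qZ_le//=.
  rewrite -ler_pdivlMl ?normr_gt0// -normfV.
  have cV0 : c^-1 != 0 by rewrite invr_eq0.
  apply: le_trans (qZ_le _ _ (EFZ c f EFf) cV0).
  rewrite (_ : (fun z => c^-1 * (c * f z)) = f)//.
  by apply/funext => z; rewrite mulrA mulVf// mul1r.
- move=> f g EFf EFg.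
  have := EFC 2%N (fun i => if i is 0%N then f else g).
  rewrite !big_ord_recl big_ord0 addr0.
  rewrite (_ : (fun x => \sum_(i < 2) _) = fun z => f z + g z).
    by apply; case.
  by apply/funext => z; rewrite !big_ord_recl big_ord0 addr0.
Qed.

Lemma mixed_finitely_subadditive :
  finitely_subadditive E -> finitely_subadditive F -> finitely_subadditive EF.
Proof.
move=> [CE CE0 ECE] [CF CF0 FCF]; exists (CF * CE); first exact: mulr_gt0.
move=> n f_ EFf; apply/ler_addgt0Pr => e e0.
(* the slack of the n majorants, after multiplication by CF CE, stays below e;
   n + 1 avoids a division by zero *)
pose e' := e / (CF * CE * n.+1%:R).
have e'0 : 0 < e' by rewrite divr_gt0// !mulr_gt0.
have gP i : {g | fiber_majorant mu1 E F (f_ i) g /\ qnorm E g < qnorm EF (f_ i) + e'}.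
  apply: cid.
  have [//|//|g fg gi] := @mixed_qnorm_adherent _ _ _ _ _ mu1 E F E0 (f_ i) e'.
  by exists g.
pose g_ n := sval (gP n).
have fg i : fiber_majorant mu1 E F (f_ i) (g_ i) by exact: (svalP (gP i)).1.
have gi i : qnorm E (g_ i) <= qnorm EF (f_ i) + e' by exact/ltW/(svalP (gP i)).2.
have Eg i : carrier E (g_ i) by have [] := fg i.
have Es : carrier E (fun x => \sum_(i < n) g_ i x) by exact: linear_subspace_sum.
have [_ _ [_ [_ _ qEZ _]] _] := lE.
rewrite (@le_trans _ _ (qnorm E (fun x => CF * \sum_(i < n) g_ i x)))//.
  apply: mixed_qnorm_le => //.
    by apply: linear_subspace_sum => //; exact: mixed_linear.
  by apply: fiber_majorant_sum => // h_; exact: FCF.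
rewrite qEZ// gtr0_norm// -mulrA.
rewrite (@le_trans _ _ (CF * (CE * \sum_(i < n) (qnorm EF (f_ i) + e'))))//.
  rewrite ler_pM2l// (le_trans (ECE _ _ Eg))// ler_pM2l//.
  by apply: ler_sum => i _; exact: gi.
rewrite big_split/= sumr_const card_ord 2!mulrA mulrDr lerD2l -(mulr_natr e').
have -> : CF * CE * (e' * n%:R) = e * (n%:R / n.+1%:R).
  by rewrite /e'; field; rewrite !gt_eqF ?mulr_gt0.
by rewrite ler_piMr ?(ltW e0)// ler_pdivrMr// mul1r ler_nat.
Qed.

Lemma mixed_normable : normable mu1 E -> normable mu2 F ->
  normable (mu1 \x mu2)%E EF.
Proof.
move=> /(normable_finitely_subadditive E0) sE /(normable_finitely_subadditive F0) sF.
have sEF := mixed_finitely_subadditive sE sF.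
apply: finitely_subadditive_normable => //; first exact: mixed_linear.
exact: mixed_quasi_norm.
Qed.

End mixed_normable.

Section factors.
Context {R : realType} {d1 d2 : measure_display}
  {T1 : measurableType d1} {T2 : measurableType d2}.
Variables (mu1 : {measure set T1 -> \bar R}) (mu2 : {measure set T2 -> \bar R}).
Variables (E : fspace R T1) (F : fspace R T2).

(** The measure [mu] on the product is arbitrary: it only enters the
    definiteness of a norm, which finite subadditivity does not use. *)
Lemma mixed_factors (mu : {measure set (T1 * T2) -> \bar R}) f0 g0 :
  homogeneous_lattice mu1 E -> homogeneous_lattice mu2 F ->
  carrier E f0 -> 0 < qnorm E f0 -> carrier F g0 -> 0 < qnorm F g0 ->
  normable mu (mixed mu1 E F) ->
  (linear_subspace (carrier E) /\ finitely_subadditive E) /\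
  (linear_subspace (carrier F) /\ finitely_subadditive F).
Proof.
move=> hE hF Ef f_gt0 Fg g_gt0 nEF.
have E0 f : carrier E f -> 0 <= qnorm E f by case: hE => _ + _ _; exact.
have sEF := normable_finitely_subadditive (mixed_qnorm_ge0 E0) nEF.
have [lEF _] := nEF.
by split; [apply: (mixed_factorl hE hF Fg)|apply: (mixed_factorr hE hF Ef)] => //;
  [exists f0|exists g0].
Qed.

Lemma mixed_normable_factors (mu : {measure set (T1 * T2) -> \bar R}) :
  quasi_normed_function_lattice mu1 E -> quasi_normed_function_lattice mu2 F ->
  nontrivial_fspace mu1 E -> nontrivial_fspace mu2 F ->
  normable mu (mixed mu1 E F) -> normable mu1 E /\ normable mu2 F.
Proof.
move=> lE lF [f Ef fn0] [g Fg gn0] nEF.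
have [linE _ qE _] := lE; have [linF _ qF _] := lF.
have f0 : 0 < qnorm E f.
  have [K [q0 qeq0 _ _]] := qE.
  by rewrite lt_def q0// andbT; apply/eqP => /qeq0; tauto.
have g0 : 0 < qnorm F g.
  have [K [q0 qeq0 _ _]] := qF.
  by rewrite lt_def q0// andbT; apply/eqP => /qeq0; tauto.
have [[_ sE] [_ sF]] := mixed_factors (quasi_normed_homogeneous lE)
  (quasi_normed_homogeneous lF) Ef f0 Fg g0 nEF.
by split; exact: finitely_subadditive_normable.
Qed.

End factors.

(** * The layer cake formula *)

Section monotone_measurable.
Context {R : realType}.
Local Open Scope ereal_scope.
Implicit Types (D : set R) (f : R -> \bar R).

Lemma nonincreasing_emeasurable D f : is_interval D ->
  {in D &, {homo f : x y / (x <= y)%R >-> y <= x}} -> measurable_fun D f.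
Proof.
move=> iD f_ni mD; apply: (measurability _ (ErealGenOInfty.measurableE R)) => //.
move=> _ [_ [a ->] <-]; rewrite preimage_itvoy.
apply: is_interval_measurable => x y [Dx /= fx] [Dy /= fy] u xuy.
have Du := iD _ _ Dx Dy _ xuy; case/andP: xuy => xu uy; split => //=.
by rewrite (lt_le_trans fy)// f_ni// inE.
Qed.

Lemma nondecreasing_emeasurable D f : is_interval D ->
  {in D &, {homo f : x y / (x <= y)%R >-> x <= y}} -> measurable_fun D f.
Proof.
move=> iD f_nd mD; apply: (measurability _ (ErealGenOInfty.measurableE R)) => //.
move=> _ [_ [a ->] <-]; rewrite preimage_itvoy.
apply: is_interval_measurable => x y [Dx /= fx] [Dy /= fy] u xuy.
have Du := iD _ _ Dx Dy _ xuy; case/andP: xuy => xu uy; split => //=.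
by rewrite (lt_le_trans fx)// f_nd// inE.
Qed.

End monotone_measurable.

Section initial_segment.
Context {R : realType}.
Local Notation leb := (@lebesgue_measure R).
Local Open Scope ereal_scope.

Lemma measurable_lt_ereal (y : \bar R) : measurable [set s : R | s%:E < y].
Proof.
apply: is_interval_measurable => a b /= ay b_y u /andP[au ub].
by rewrite (le_lt_trans _ b_y)// lee_fin.
Qed.

(** The positive reals below an extended real form an initial segment of the
    half-line; superlevel sets of rearrangements have this form. *)
Lemma initial_segmentE (y : \bar R) : `]0%R, +oo[%classic `&` [set s : R | s%:E < y] =
  match y with r%:E => `]0%R, r[%classic | +oo => `]0%R, +oo[%classic | -oo => set0 end.
Proof.
case: y => [r| |]; apply/seteqP; split => s /=; rewrite ?in_itv/= ?andbT ?lte_fin.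
- by move=> [-> ->].
- by move=> /andP[-> ->].
- by case.
- by move=> ->; rewrite ltry.
- by case.
- by [].
Qed.

Lemma lebesgue_initial_segment (y : \bar R) : 0 <= y ->
  leb (`]0%R, +oo[%classic `&` [set s : R | s%:E < y]) = y.
Proof.
rewrite initial_segmentE; case: y => [r| |]//; rewrite ?lee_fin => r0.
  apply: (etrans (lebesgue_measure_itv _)) => /=.
  by rewrite lte_fin; case: ltgtP r0 => // [_ _|<- _]; rewrite ?sube0.
by apply: (etrans (lebesgue_measure_itv _)) => /=; rewrite ltry.
Qed.

Lemma integral_cst_initial (c : \bar R) (t : R) : (0 < t)%R ->
  \int[leb]_(s in `]0%R, t[) (cst c s) = c * t%:E.
Proof.
move=> t0; rewrite integral_cst//; congr (_ * _).
by apply: (etrans (lebesgue_measure_itv _)) => /=; rewrite lte_fin t0 sube0.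
Qed.

End initial_segment.

Section layer_cake.
Context {R : realType} {d : measure_display} {T : measurableType d}.
Variable mu : {sigma_finite_measure set T -> \bar R}.
Local Notation leb := (@lebesgue_measure R).
Local Open Scope ereal_scope.
Variables (D : set T) (h v : T -> \bar R).
Hypotheses (mD : measurable D) (mh : measurable_fun D h) (mv : measurable_fun D v).
Hypotheses (h0 : forall t, D t -> 0 <= h t) (v0 : forall t, D t -> 0 <= v t).

(** The part of [D] where [h] exceeds [s]. *)
Definition level_set (s : R) : set T := D `&` [set t | s%:E < h t].

Lemma measurable_level_set s : measurable (level_set s).
Proof. exact: emeasurable_fun_o_infty. Qed.

Lemma ereal_integral_levels (y : \bar R) : 0 <= y ->
  \int[leb]_(s in `]0%R, +oo[) (\1_[set s : R | (s%:E < y)%E] s)%:E = y.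
Proof.
move=> y0; rewrite integral_indic//; last exact: measurable_lt_ereal.
by rewrite setIC; exact: lebesgue_initial_segment.
Qed.

(** Integration of [h] against the density [v], level by level in the values
    of [h]. *)
Lemma layer_cake : \int[mu]_(t in D) (h t * v t) =
  \int[leb]_(s in `]0%R, +oo[) \int[mu]_(t in level_set s) v t.
Proof.
(* the region under the graph, whose indicator is integrated in both orders *)
pose A := [set z : T * R | (z.2)%:E < (h \_ D) z.1].
have mhD : measurable_fun setT (h \_ D) by exact/(measurable_restrictT _ mD).
have mvD : measurable_fun setT (v \_ D) by exact/(measurable_restrictT _ mD).
have vD0 t : 0 <= (v \_ D) t by rewrite /patch; case: ifPn => // /[1!inE] /v0.
have hD0 t : 0 <= (h \_ D) t by rewrite /patch; case: ifPn => // /[1!inE] /h0.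
have mA : measurable A.
  rewrite (_ : A = setT `&` [set z : T * R | 0 < (h \_ D) z.1 - (z.2)%:E]); last first.
    by rewrite setTI; apply/seteqP; split => z; rewrite /A /mkset sube_gt0.
  apply: emeasurable_fun_o_infty => //; apply: emeasurable_funB.
    exact: measurableT_comp.
  by apply/measurable_EFinP; exact: measurable_snd.
pose k (z : T * R) := (v \_ D) z.1 * ((\1_A z)%:E * (\1_`]0%R, +oo[%classic z.2)%:E).
have k0 z : 0 <= k z by rewrite mule_ge0// mule_ge0// lee_fin.
have mk : measurable_fun setT k.
  apply: emeasurable_funM; first exact: measurableT_comp.
  apply: emeasurable_funM; apply/measurable_EFinP.
    exact: measurable_indic.
  by apply: measurableT_comp => //; exact: measurable_indic.
have := @fubini_tonelli _ _ _ _ _ mu leb k mk k0.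
have -> : \int[mu]_x \int[leb]_y k (x, y) = \int[mu]_(t in D) (h t * v t).
  rewrite [RHS]integral_mkcond; apply: eq_integral => t _.
  rewrite /k /=; under eq_integral do rewrite muleC.
  rewrite ge0_integralZr//; last first.
  - apply: emeasurable_funM; apply/measurable_EFinP; last exact: measurable_indic.
    exact: (measurableT_comp (measurable_indic mA) (pair1_measurable t)).
  have -> : \int[leb]_x ((\1_A (t, x))%:E * (\1_`]0%R, +oo[%classic x)%:E) = (h \_ D) t.
    rewrite -[RHS]ereal_integral_levels// [RHS]integral_mkcond; apply: eq_integral => s _.
    rewrite patchE /indic; case: ifPn => [s0|/negbTE s0].
      by rewrite ?s0 mule1 !mem_setE.
    by rewrite ?s0 mule0.
  by rewrite /patch; case: ifPn => // _; rewrite mul0e.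
move=> ->; rewrite [RHS]integral_mkcond; apply: eq_integral => s _.
rewrite /k/= /patch; case: ifPn => [s0|/negbTE s0]; last first.
  by apply: integral0_eq => t _; rewrite /indic s0 !mule0.
rewrite [RHS]integral_mkcond; apply: eq_integral => t _.
rewrite /indic s0 mule1 /level_set patchE in_setI.
case: (boolP (t \in D)) => tD /=; last by rewrite mul0e.
have -> : ((t, s) \in A) = (t \in [set t | s%:E < h t]).
  by apply/idP/idP; rewrite !inE /A /mkset patchE tD.
by case: ifPn; rewrite ?mule1 ?mule0.
Qed.

Lemma measurable_level_integral :
  measurable_fun (`]0%R, +oo[%classic : set R) (fun s => \int[mu]_(t in level_set s) v t).
Proof.
apply: nonincreasing_emeasurable; first exact: interval_is_interval.
move=> s r _ _ sr; apply: ge0_subset_integral; try exact: measurable_level_set.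
- by apply: measurable_funS mv => // t [].
- by move=> t [/v0].
- by move=> t [Dt /= rh]; split => //=; rewrite (le_lt_trans _ rh)// lee_fin.
Qed.

End layer_cake.

Section layer_cake_comparison.
Context {R : realType} {d1 d2 : measure_display}
  {T1 : measurableType d1} {T2 : measurableType d2}.
Variables (mu1 : {sigma_finite_measure set T1 -> \bar R})
  (mu2 : {sigma_finite_measure set T2 -> \bar R}).
Local Open Scope ereal_scope.
Variables (D1 : set T1) (h1 v1 : T1 -> \bar R) (D2 : set T2) (h2 v2 : T2 -> \bar R).
Hypotheses (mD1 : measurable D1) (mh1 : measurable_fun D1 h1)
  (mv1 : measurable_fun D1 v1).
Hypotheses (h10 : forall t, D1 t -> 0 <= h1 t) (v10 : forall t, D1 t -> 0 <= v1 t).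
Hypotheses (mD2 : measurable D2) (mh2 : measurable_fun D2 h2)
  (mv2 : measurable_fun D2 v2).
Hypotheses (h20 : forall t, D2 t -> 0 <= h2 t) (v20 : forall t, D2 t -> 0 <= v2 t).

(** Two weighted integrals compare as soon as the weights of all superlevel
    sets do, possibly over different spaces. *)
Lemma le_integral_level_sets (K : R) : (0 <= K)%R ->
  (forall s : R, (0 < s)%R -> \int[mu1]_(t in level_set D1 h1 s) v1 t <=
     K%:E * \int[mu2]_(t in level_set D2 h2 s) v2 t) ->
  \int[mu1]_(t in D1) (h1 t * v1 t) <= K%:E * \int[mu2]_(t in D2) (h2 t * v2 t).
Proof.
move=> K0 le12; rewrite !layer_cake// -ge0_integralZl//; last 2 first.
- exact: measurable_level_integral.
- by move=> s _; apply: integral_ge0 => t [/v20].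
apply: ge0_le_integral => //.
- by move=> s _; apply: integral_ge0 => t [/v10].
- exact: measurable_level_integral.
- by apply: measurable_funeM; exact: measurable_level_integral.
- by move=> s /=; rewrite in_itv/= andbT; exact: le12.
Qed.

End layer_cake_comparison.

Lemma eq_integral_level_sets {R : realType} {d1 d2 : measure_display}
    {T1 : measurableType d1} {T2 : measurableType d2}
    (mu1 : {sigma_finite_measure set T1 -> \bar R})
    (mu2 : {sigma_finite_measure set T2 -> \bar R})
    (D1 : set T1) (h1 : T1 -> \bar R) (D2 : set T2) (h2 : T2 -> \bar R) :
  measurable D1 -> measurable_fun D1 h1 -> (forall t, D1 t -> 0 <= h1 t)%E ->
  measurable D2 -> measurable_fun D2 h2 -> (forall t, D2 t -> 0 <= h2 t)%E ->
  (forall s : R, 0 < s -> mu1 (level_set D1 h1 s) = mu2 (level_set D2 h2 s)) ->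
  (\int[mu1]_(t in D1) h1 t = \int[mu2]_(t in D2) h2 t)%E.
Proof.
move=> mD1 mh1 h10 mD2 mh2 h20 h12.
under eq_integral do rewrite -[h1 _]mule1.
under [RHS]eq_integral do rewrite -[h2 _]mule1.
rewrite (layer_cake _ (v := cst 1%E))// (layer_cake _ (v := cst 1%E))//.
apply: eq_integral => s; rewrite inE/= in_itv/= andbT => s0.
rewrite !integral_cst; try exact: measurable_level_set.
by rewrite !mul1e; exact: h12.
Qed.

(** * The decreasing rearrangement *)

Section decreasing_rearrangement.
Context {R : realType}.
Local Notation leb := (@lebesgue_measure R).
Local Open Scope ereal_scope.
Implicit Types (f g : R -> R) (s t : R).

(** The rearrangement is best handled through the reals below it, see
    [rearrangement_gt]; this and the next lemma turn such information into
    inequalities and equalities. *)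
Lemma lee_real_minorants (x y : \bar R) :
  (forall s : R, s%:E < x -> s%:E < y) -> x <= y.
Proof.
move=> xy; rewrite leNgt; apply/negP; case: y xy => [y| |] xy yx.
- by have := xy _ yx; rewrite ltxx.
- by rewrite ltNge leey in yx.
- case: x xy yx => [x| |] xy yx.
  + by have /xy : (x - 1)%:E < x%:E by rewrite lte_fin gtrBl.
  + by have /xy : 0%:E < +oo :> \bar R by rewrite ltry.
  + by rewrite ltxx in yx.
Qed.

Lemma eq_real_minorants (x y : \bar R) :
  (forall s : R, s%:E < x <-> s%:E < y) -> x = y.
Proof.
by move=> xy; apply/eqP; rewrite eq_le !lee_real_minorants// => s /xy.
Qed.

(** The distribution function of the absolute value of [f]. *)
Definition superlevel_measure f s : \bar R := leb [set x | (s < `|f x|)%R].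

Lemma measurable_superlevel f s : measurable_fun setT f ->
  measurable [set x | (s < `|f x|)%R].
Proof.
move=> mf; rewrite (_ : mkset _ = (fun x => `|f x|%R) @^-1` `]s, +oo[).
  rewrite -[X in measurable X]setTI.
  by apply: (measurableT_comp _ mf) => //; exact: normr_measurable.
by apply/seteqP; split => x /=; rewrite in_itv/= andbT.
Qed.

Lemma superlevel_measure_ge0 f s : 0 <= superlevel_measure f s.
Proof. exact: measure_ge0. Qed.

Lemma superlevel_measure_nonincreasing f s t : measurable_fun setT f ->
  (s <= t)%R -> superlevel_measure f t <= superlevel_measure f s.
Proof.
move=> mf st; apply: le_measure; rewrite ?inE; try exact: measurable_superlevel.
by move=> x /=; exact: le_lt_trans.
Qed.

Lemma le_superlevel_measure f g s : measurable_fun setT f -> measurable_fun setT g ->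
  {ae leb, forall x, (`|f x| <= `|g x|)%R} -> superlevel_measure f s <= superlevel_measure g s.
Proof.
move=> mf mg [N [mN N0 fgN]]; have mfs := measurable_superlevel s mf.
have mgs := measurable_superlevel s mg.
rewrite -[leRHS]adde0 -[X in _ + X]N0.
rewrite (le_trans _ (measureU2 _ _ _))//.
apply: le_measure; rewrite ?inE//; first exact: measurableU.
move=> x /= sf; have [fg|nfg] := pselect (`|f x| <= `|g x|)%R.
  by left; exact: lt_le_trans fg.
by right; exact: fgN.
Qed.

Lemma superlevel_measure_right_continuous f s t : measurable_fun setT f ->
  t%:E < superlevel_measure f s -> exists2 e : R, (0 < e)%R & t%:E < superlevel_measure f (s + e).
Proof.
move=> mf tfs; apply: contrapT => nfs.
have nfn n : superlevel_measure f (s + n.+1%:R^-1) <= t%:E.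
  by rewrite leNgt; apply: contra_notN nfs => tfn; exists (n.+1%:R^-1)%R; rewrite ?invr_gt0.
(* continuity from below of the measure along these sets *)
pose A n := [set x | (s + n.+1%:R^-1 < `|f x|)%R].
have AE : \bigcup_n A n = [set x | (s < `|f x|)%R].
  apply/seteqP; split => [x [n _]|x /= sf].
    by rewrite /A/=; apply: lt_trans; rewrite ltrDl invr_gt0.
  by have [k] := ltr_add_invr sf; exists k.
have mA n : measurable (A n) by exact: measurable_superlevel.
have : leb \o A @ \oo --> leb (\bigcup_n A n).
  apply: nondecreasing_cvg_mu => //; first exact: bigcupT_measurable.
  apply/nondecreasing_seqP => n; apply/subsetPset => x; rewrite /A/=.
  by apply: le_lt_trans; rewrite lerD2l lef_pV2 ?posrE// ler_nat.
move=> /[dup] /cvg_lim cA /cvgP cvA.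
have : leb (\bigcup_n A n) <= t%:E.
  by rewrite -cA//; apply: lime_le => //; apply: nearW.
by rewrite AE leNgt tfs.
Qed.

(** The rearrangement and the distribution function are generalized inverses
    of each other. Right continuity of the latter makes this an equivalence of
    strict inequalities. *)
Lemma rearrangement_gt f s t : measurable_fun setT f ->
  s%:E < rearrangement f t <-> t%:E < superlevel_measure f s.
Proof.
move=> mf; split => [|/(superlevel_measure_right_continuous mf)[e e0 tfe]].
  apply: contraTT; rewrite -!leNgt => fst; apply: ereal_inf_lbound.
  by exists s.
rewrite (@lt_le_trans _ _ (s + e)%:E)// ?lte_fin ?ltrDl//.
apply: le_ereal_inf_tmp => _ [r /= frt <-]; rewrite lee_fin leNgt; apply/negP => rse.
have := lt_le_trans tfe (superlevel_measure_nonincreasing mf (ltW rse)).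
by rewrite ltNge frt.
Qed.

Lemma rearrangement_le_superlevel f (c t : R) :
  leb [set x | (c < `|f x|)%R] <= t%:E -> rearrangement f t <= c%:E.
Proof. by move=> ct; apply: ereal_inf_lbound; exists c. Qed.

Lemma rearrangement_ge0 f t : measurable_fun setT f -> 0 <= rearrangement f t.
Proof.
move=> mf; apply: lee_real_minorants => s; rewrite lte_fin => s0.
apply/rearrangement_gt => //; rewrite /superlevel_measure (_ : mkset _ = setT).
  apply: (lt_le_trans (ltry t)).
  by rewrite -set_itvNyy (lebesgue_measure_itv `]-oo, +oo[%R).
by apply/seteqP; split => // x _ /=; exact: lt_le_trans (normr_ge0 _).
Qed.

Lemma rearrangement_nonincreasing f s t : (s <= t)%R ->
  rearrangement f t <= rearrangement f s.
Proof.
move=> st; apply: le_ereal_inf_tmp => _ [r /= fr <-].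
apply: ereal_inf_lbound; exists r => //=.
by rewrite (le_trans fr)// lee_fin.
Qed.

Lemma measurable_rearrangement f (D : set R) : measurable D ->
  measurable_fun D (rearrangement f).
Proof.
move=> mD; apply: (measurable_funS measurableT) => //.
apply: nonincreasing_emeasurable => // x y _ _; exact: rearrangement_nonincreasing.
Qed.

Lemma le_rearrangement f g t : measurable_fun setT f -> measurable_fun setT g ->
  {ae leb, forall x, (`|f x| <= `|g x|)%R} -> rearrangement f t <= rearrangement g t.
Proof.
move=> mf mg fg; apply: lee_real_minorants => s /(rearrangement_gt _ _ mf) ft.
apply/(rearrangement_gt _ _ mg); apply: lt_le_trans ft _; exact: le_superlevel_measure.
Qed.

Lemma rearrangementZ (c : R) f t : measurable_fun setT f -> (0 < t)%R ->
  rearrangement (fun x => c * f x)%R t = `|c|%:E * rearrangement f t.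
Proof.
move=> mf t0; have mcf : measurable_fun setT (fun x => c * f x)%R.
  exact: measurable_funM.
have [->|c0] := eqVneq c 0%R.
  rewrite normr0 mul0e; apply/eqP; rewrite eq_le rearrangement_ge0 ?andbT; last first.
    exact: measurable_funM.
  apply: ereal_inf_lbound; exists 0%R => //=.
  rewrite (_ : mkset _ = set0) ?measure0 ?lee_fin ?ltW//.
  by apply/seteqP; split => // x /=; rewrite mul0r normr0 ltxx.
have nc0 : (0 < `|c|)%R by rewrite normr_gt0.
apply: eq_real_minorants => s; rewrite rearrangement_gt// -lte_pdivrMl//.
rewrite -EFinM rearrangement_gt// /superlevel_measure (_ : mkset _ = [set x | (`|c|^-1 * s < `|f x|)%R])//.
by apply/seteqP; split => x /=; rewrite normrM ltr_pdivrMl.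
Qed.

(** The excess of |f| above the level [s] and that of its rearrangement have
    superlevel sets of the same measure. *)
Lemma excess_integral f s : measurable_fun setT f ->
  \int[leb]_x (Num.max (`|f x| - s) 0)%:E =
  \int[leb]_(t in `]0%R, +oo[) maxe (rearrangement f t - s%:E) 0.
Proof.
move=> mf; have m0 : measurable (`]0%R, +oo[%classic : set R) by [].
apply: eq_integral_level_sets => //.
- apply/measurable_EFinP; apply: measurable_maxr => //; apply: measurable_funB => //.
  exact: measurableT_comp.
- by move=> x _; rewrite lee_fin le_max lexx orbT.
- apply: measurable_maxe => //; apply: emeasurable_funB => //.
  exact: measurable_rearrangement.
- by move=> x _; rewrite le_max lexx orbT.
move=> r r0; rewrite /level_set setTI.
rewrite (_ : [set x | _] = [set x | (r + s < `|f x|)%R]); last first.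
  by apply/seteqP; split => x /=; rewrite lte_fin lt_max ltrBrDr (ltNge r 0%R) (ltW r0) orbF.
rewrite (_ : [set x | r%:E < _] = [set t : R | t%:E < superlevel_measure f (r + s)]).
  exact/esym/(lebesgue_initial_segment (superlevel_measure_ge0 f (r + s))).
by apply/seteqP; split => t; rewrite /mkset lt_max lteBrDr// (lte_fin r 0%R)
  (ltNge r 0%R) (ltW r0) orbF -EFinD => /(rearrangement_gt _ _ mf).
Qed.

(** The integral of the rearrangement over (0, t). *)
Definition rearrangement_integral f t := \int[leb]_(s in `]0%R, t[) rearrangement f s.

Local Notation F := rearrangement_integral.

(** Together with [rearrangement_integral_ge], this identifies the integral of
    the rearrangement over (0, t) with the minimum over s >= 0 of t s + \int (|f| -
    s)^+, attained when s is the value of the rearrangement at t. *)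
Lemma rearrangement_integral_le f s t : measurable_fun setT f -> (0 <= s)%R -> (0 < t)%R ->
  F f t <= (t * s)%:E + \int[leb]_x (Num.max (`|f x| - s) 0)%:E.
Proof.
move=> mf s0 t0; rewrite excess_integral//.
have me (D : set R) : measurable D ->
    measurable_fun D (fun u => maxe (rearrangement f u - s%:E) 0).
  move=> mD; apply: measurable_maxe => //; apply: emeasurable_funB => //.
  exact: measurable_rearrangement.
have e0 u : 0 <= maxe (rearrangement f u - s%:E) 0 by rewrite le_max lexx orbT.
have mt : measurable (`]0%R, t[%classic : set R) by [].
have m0 : measurable (`]0%R, +oo[%classic : set R) by [].
rewrite (@le_trans _ _ (\int[leb]_(u in `]0%R, t[) (s%:E + maxe (rearrangement f u - s%:E) 0)))//.
  apply: ge0_le_integral => //.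
  - by move=> u _; exact: rearrangement_ge0.
  - exact: measurable_rearrangement.
  - by apply: emeasurable_funD => //; exact: me.
  - move=> u _; rewrite addeC -leeBlDr// le_max lexx//.
rewrite ge0_integralD//; last exact: me.
rewrite (integral_cst_initial s%:E t0) muleC leeD2l//.
apply: ge0_subset_integral => //; first exact: me.
by move=> u /=; rewrite !in_itv/= => /andP[->].
Qed.

Lemma rearrangement_integral_ge f s t : measurable_fun setT f -> (0 < t)%R ->
  rearrangement f t = s%:E ->
  (t * s)%:E + \int[leb]_x (Num.max (`|f x| - s) 0)%:E <= F f t.
Proof.
move=> mf t0 fts; rewrite excess_integral//.
have me (D : set R) : measurable D ->
    measurable_fun D (fun u => maxe (rearrangement f u - s%:E) 0).
  move=> mD; apply: measurable_maxe => //; apply: emeasurable_funB => //.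
  exact: measurable_rearrangement.
have e0 u : 0 <= maxe (rearrangement f u - s%:E) 0 by rewrite le_max lexx orbT.
have mt : measurable (`]0%R, t[%classic : set R) by [].
have s0 : (0 <= s)%R by rewrite -lee_fin -fts rearrangement_ge0.
rewrite (_ : \int[leb]_(u in `]0%R, +oo[) _ =
    \int[leb]_(u in `]0%R, t[) maxe (rearrangement f u - s%:E) 0); last first.
  rewrite integral_mkcond [RHS]integral_mkcond; apply: eq_integral => u _.
  rewrite !patchE; case: ifPn => u0; case: ifPn => // ut.
    rewrite max_r// leeBlDr// add0e -fts; apply: rearrangement_nonincreasing.
    rewrite leNgt; apply: contra ut => ut; move: u0; rewrite !inE/= !in_itv/= andbT => ->.
    by rewrite ut.
  by exfalso; move/negP: u0; apply; move: ut; rewrite !inE/= !in_itv/= andbT => /andP[].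
have <- : \int[leb]_(u in `]0%R, t[) (cst s%:E u) = (t * s)%:E.
  by rewrite integral_cst_initial// muleC.
rewrite -ge0_integralD//; last exact: me.
apply: ge0_le_integral => //.
- by move=> u _; rewrite adde_ge0// lee_fin.
- by apply: emeasurable_funD => //; exact: me.
- exact: measurable_rearrangement.
move=> u utI; have /andP[u0 ut] : (0 < u < t)%R by move: utI; rewrite /= in_itv.
have fu : s%:E <= rearrangement f u by rewrite -fts rearrangement_nonincreasing// ltW.
by rewrite max_l ?leeBrDr ?add0e// addeC subeK.
Qed.

Lemma rearrangement_integral_pinfty f t : (0 < t)%R -> rearrangement f t = +oo -> F f t = +oo.
Proof.
move=> t0 ft; rewrite /rearrangement_integral.
rewrite (eq_integral (cst +oo)); last first.
  move=> u; rewrite inE/= in_itv/= => /andP[u0 ut].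
  by apply/eqP; rewrite -leye_eq -ft rearrangement_nonincreasing// ltW.
rewrite integral_cst_initial//.
by rewrite gt0_mulye// lte_fin.
Qed.

Lemma rearrangement_integral_ge0 f t : measurable_fun setT f -> 0 <= F f t.
Proof. by move=> mf; apply: integral_ge0 => s _; exact: rearrangement_ge0. Qed.

(** Choosing the levels a and b that are optimal for f and g, the level a + b
    for f + g works because (|f + g| - a - b)^+ <= (|f| - a)^+ + (|g| - b)^+. *)
Lemma rearrangement_integralD f g t : measurable_fun setT f -> measurable_fun setT g ->
  (0 < t)%R -> F (fun x => f x + g x)%R t <= F f t + F g t.
Proof.
move=> mf mg t0; have mfg : measurable_fun setT (fun x => f x + g x)%R.
  exact: measurable_funD.
(* infinite values at t make the right-hand side infinite *)
case ft : (rearrangement f t) => [a| |]; last 2 first.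
- rewrite (rearrangement_integral_pinfty (f := f))// addye ?leey//.
  by rewrite gt_eqF// (lt_le_trans _ (rearrangement_integral_ge0 _ mg)).
- by have := rearrangement_ge0 t mf; rewrite ft.
case gt : (rearrangement g t) => [b| |]; last 2 first.
- rewrite (rearrangement_integral_pinfty (f := g))// addey ?leey//.
  by rewrite gt_eqF// (lt_le_trans _ (rearrangement_integral_ge0 _ mf)).
- by have := rearrangement_ge0 t mg; rewrite gt.
have a0 : (0 <= a)%R by rewrite -lee_fin -ft rearrangement_ge0.
have b0 : (0 <= b)%R by rewrite -lee_fin -gt rearrangement_ge0.
apply: le_trans (leeD (rearrangement_integral_ge mf t0 ft) (rearrangement_integral_ge mg t0 gt)).
apply: (le_trans (rearrangement_integral_le mfg (addr_ge0 a0 b0) t0)).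
rewrite addeACA -EFinD -mulrDr leeD2l//.
have mm (h : R -> R) (c : R) : measurable_fun setT h ->
    measurable_fun setT (fun x : R => (Num.max (`|h x| - c) 0)%:E).
  move=> mh; apply/measurable_EFinP; apply: measurable_maxr => //.
  by apply: measurable_funB => //; exact: measurableT_comp.
have m0 (h : R -> R) (c x : R) : 0 <= (Num.max (`|h x| - c) 0)%:E :> \bar R.
  by rewrite lee_fin le_max lexx orbT.
rewrite -ge0_integralD//; try exact: mm.
apply: ge0_le_integral => //; try exact: mm.
  by apply: emeasurable_funD; exact: mm.
move=> x _; rewrite -EFinD lee_fin ge_max; apply/andP; split; last first.
  by rewrite addr_ge0// le_max lexx orbT.
rewrite (@le_trans _ _ ((`|f x| - a) + (`|g x| - b))%R)//.
  by rewrite addrACA -opprD lerD2r ler_normD.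
by rewrite lerD// le_max lexx.
Qed.

End decreasing_rearrangement.

(** * The Lorentz functional *)

Section positive_half_line.
Context {R : realType}.
Local Notation leb := (@lebesgue_measure R).
Local Open Scope ereal_scope.
Implicit Types (v : R -> R) (p r : R).

Lemma ge0_le_poweR (x y : \bar R) r : (0 <= r)%R -> 0 <= x -> x <= y ->
  x `^ r <= y `^ r.
Proof.
move=> r0 x0 xy; apply: gt0_ler_poweR => //; rewrite in_itv/= leey andbT//.
exact: le_trans xy.
Qed.

Lemma lt_poweR_root (x : \bar R) p (s : R) : (0 < p)%R -> (0 <= s)%R -> 0 <= x ->
  (s%:E < x `^ p) = ((s `^ p^-1)%:E < x).
Proof.
move=> p0 s0; case: x => [x| |]//; rewrite ?lee_fin => x0; last first.
  by rewrite poweRyr ?gt_eqF// !ltry.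
rewrite poweR_EFin !lte_fin; apply/idP/idP => sx.
  have := @gt0_ltr_powR _ p^-1%R _ s (x `^ p)%R.
  rewrite invr_gt0 => /(_ p0); rewrite !nnegrE powR_ge0 s0 => /(_ isT isT sx).
  by rewrite -powRrM mulfV ?gt_eqF// powRr1.
have := @gt0_ltr_powR _ p p0 (s `^ p^-1)%R x.
rewrite !nnegrE powR_ge0 x0 => /(_ isT isT sx).
by rewrite -powRrM mulVf ?gt_eqF// powRr1.
Qed.

(** What the layer cake comparisons use of a weight. Unlike [weight], it does
    not ask for a finite primitive. *)
Definition nonneg_density v : Prop :=
  (forall x, (0 < x)%R -> (0 <= v x)%R) /\
  measurable_fun (`]0%R, +oo[%classic : set R) v.

Lemma bigcup_itv0n : \bigcup_n `]0%R, n.+1%:R[%classic = `]0%R, +oo[%classic :> set R.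
Proof.
apply/seteqP; split => [x [n _]|x]; rewrite /= !in_itv/= ?andbT.
  by case/andP.
move=> x0; exists (Num.truncn x) => //=; rewrite in_itv/= x0/=.
exact: truncnS_gt.
Qed.

Lemma weight_density v : weight v -> nonneg_density v.
Proof.
move=> [v0 iv]; split => //; rewrite -bigcup_itv0n.
apply/measurable_fun_bigcup => // n.
have /integrableP[mv _] : leb.-integrable `]0%R, n.+1%:R[ (EFin \o v) by exact: iv.
by move/measurable_EFinP: mv.
Qed.

Lemma measurable_density v (D : set R) : nonneg_density v -> measurable D ->
  D `<=` `]0%R, +oo[ -> measurable_fun D (fun x => (v x)%:E).
Proof.
move=> [_ mv] mD D0; apply/measurable_EFinP; exact: measurable_funS mv.
Qed.

Lemma measurable_tail_integrand v p (D : set R) : nonneg_density v -> measurable D -> D `<=` `]0%R, +oo[ ->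
  measurable_fun D (fun x => (v x / x `^ p)%:E).
Proof.
move=> [_ mv] mD D0; apply/measurable_EFinP; apply: measurable_funM.
  by apply: measurable_funS mv.
rewrite (_ : (fun x => _) = fun x => x `^ (- p))%R.
  by apply: measurable_funTS; exact: measurable_powR.
by apply/funext => x; rewrite powRN.
Qed.

Lemma itv0_subset (a : itv_bound R) : ([set` Interval (BRight 0%R) a] `<=` `]0%R, +oo[)%classic.
Proof. by move=> x /=; rewrite !in_itv/= => /andP[->]. Qed.

Lemma le_integral_exhaustion {d} {T : measurableType d}
    (mu : {measure set T -> \bar R}) (A : nat -> set T) (g : T -> \bar R) (M : \bar R) :
  nondecreasing_seq A -> (forall n, measurable (A n)) ->
  measurable_fun (\bigcup_n A n) g -> (forall x, (\bigcup_n A n) x -> 0 <= g x) ->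
  (forall n, \int[mu]_(x in A n) g x <= M) -> \int[mu]_(x in \bigcup_n A n) g x <= M.
Proof.
move=> ndA mA mg g0 gM.
have mgn n : measurable_fun (A n) g.
  by apply: measurable_funS mg => //; [exact: bigcupT_measurable|exact: bigcup_sup].
have gn0 n x : A n x -> 0 <= g x by move=> Anx; apply: g0; exists n.
have := @ge0_nondecreasing_set_cvg_integral _ _ _ A g mu ndA mA mgn gn0.
by move=> /cvge_to_le; apply; apply: nearW.
Qed.

Lemma le_integral_half_line (g : R -> \bar R) (M : \bar R) :
  measurable_fun (`]0%R, +oo[%classic : set R) g ->
  (forall x, (0 < x)%R -> 0 <= g x) ->
  (forall r, (0 < r)%R -> \int[leb]_(x in `]0%R, r[) g x <= M) ->
  \int[leb]_(x in `]0%R, +oo[) g x <= M.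
Proof.
move=> mg g0 gM; rewrite -bigcup_itv0n; apply: le_integral_exhaustion => //.
- apply/nondecreasing_seqP => n; apply/subsetPset => x; rewrite /= !in_itv/= => /andP[-> xn].
  by rewrite (lt_trans xn)// ltr_nat.
- by rewrite bigcup_itv0n.
- by rewrite bigcup_itv0n => x /=; rewrite in_itv/= andbT; exact: g0.
- by move=> n; exact: gM.
Qed.

Lemma integral_half_line_indic (r : R) (g : R -> \bar R) :
  \int[leb]_(t in `]0%R, +oo[) (g t * (\1_(`]0%R, r[%classic) t)%:E) =
   \int[leb]_(t in `]0%R, r[) g t.
Proof.
rewrite integral_mkcond [RHS]integral_mkcond; apply: eq_integral => t _.
rewrite !patchE indicE; case: (boolP (t \in `]0%R, r[%classic)) => tr.
  rewrite mule1 ifT//; move: tr; rewrite !inE/= !in_itv/= andbT.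
  by case/andP.
by rewrite mule0 if_same.
Qed.

End positive_half_line.

Section lorentz_functional.
Context {R : realType}.
Local Notation leb := (@lebesgue_measure R).
Local Open Scope ereal_scope.
Implicit Types (v : R -> R) (f g : R -> R) (p r : R).

(** The p-th power of the Lorentz functional. *)
Definition lorentz_integral p v f : \bar R :=
  \int[leb]_(t in `]0%R, +oo[) (rearrangement f t `^ p * (v t)%:E).

Section fixed_exponent.
Variables (p : R) (p0 : (0 < p)%R).

Let pn0 : p != 0%R. Proof. by rewrite gt_eqF. Qed.
Let pV0 : (p^-1 != 0)%R. Proof. by rewrite invr_eq0. Qed.

Lemma measurable_rearrangement_poweR f (D : set R) : measurable D ->
  measurable_fun D (fun t => rearrangement f t `^ p).
Proof.
move=> mD; apply: (measurableT_comp (measurable_poweR p)).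
exact: measurable_rearrangement.
Qed.

Lemma lorentz_integral_ge0 v f : nonneg_density v -> 0 <= lorentz_integral p v f.
Proof.
move=> [v0 _]; apply: integral_ge0 => t /=; rewrite in_itv/= andbT => t0.
by rewrite mule_ge0 ?poweR_ge0// lee_fin v0.
Qed.

(** Comparison of weights through their primitives. The superlevel sets of the
    p-th power of the rearrangement are intervals (0, r), and dilating the
    rearrangement by [c] dilates them; no monotonicity of the weights is
    needed. *)
Lemma le_dilated_lorentz_integral (v1 v2 : R -> R) (c K : R) f :
  nonneg_density v1 -> nonneg_density v2 -> measurable_fun setT f ->
  (0 < c)%R -> (0 <= K)%R ->
  (forall r, (0 < r)%R -> \int[leb]_(x in `]0%R, (c * r)%R[) (v1 x)%:E <=
    K%:E * \int[leb]_(x in `]0%R, r[) (v2 x)%:E) ->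
  \int[leb]_(t in `]0%R, +oo[) (rearrangement f (t / c) `^ p * (v1 t)%:E) <=
  K%:E * lorentz_integral p v2 f.
Proof.
move=> dv1 dv2 mf c0 K0 v12; have [v10 mv1] := dv1; have [v20 mv2] := dv2.
have mpos : measurable (`]0%R, +oo[%classic : set R) by [].
have mg : measurable_fun (`]0%R, +oo[%classic : set R)
    (fun t => rearrangement f (t / c) `^ p).
  apply: (measurableT_comp (measurable_poweR p)).
  apply: nonincreasing_emeasurable; first exact: interval_is_interval.
  move=> x y _ _ xy; apply: rearrangement_nonincreasing.
  by rewrite ler_pM2r// invr_gt0.
apply: le_integral_level_sets => //.
- exact/measurable_EFinP.
- by move=> t _; exact: poweR_ge0.
- by move=> t /=; rewrite in_itv/= andbT lee_fin; exact: v10.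
- exact: measurable_rearrangement_poweR.
- exact/measurable_EFinP.
- by move=> t _; exact: poweR_ge0.
- by move=> t /=; rewrite in_itv/= andbT lee_fin; exact: v20.
move=> s s0; have lev1 : level_set (`]0%R, +oo[%classic : set R)
      (fun t => rearrangement f (t / c) `^ p) s =
    `]0%R, +oo[%classic `&` [set t : R | t%:E < c%:E * superlevel_measure f (s `^ p^-1)%R].
  congr (_ `&` _); apply/seteqP; split => t /=;
    rewrite lt_poweR_root ?rearrangement_ge0 ?ltW// -lte_pdivrMl// -EFinM mulrC;
    by move/(rearrangement_gt _ _ mf).
have lev2 : level_set (`]0%R, +oo[%classic : set R) (fun t => rearrangement f t `^ p) s =
    `]0%R, +oo[%classic `&` [set t : R | t%:E < superlevel_measure f (s `^ p^-1)%R].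
  congr (_ `&` _); apply/seteqP; split => t /=;
    rewrite lt_poweR_root ?rearrangement_ge0 ?ltW//;
    by move/(rearrangement_gt _ _ mf).
rewrite [X in \int[_]_(t in X) _ <= _]lev1 [X in _ <= _ * \int[_]_(t in X) _]lev2 !initial_segmentE.
have := superlevel_measure_ge0 f (s `^ p^-1).
case: (superlevel_measure f (s `^ p^-1)%R) => [r| |]//=; last first.
  move=> _; rewrite gt0_muley ?lte_fin//; apply: le_integral_half_line.
  - exact/measurable_EFinP.
  - by move=> x /v10.
  - move=> r r0; have cr : r = (c * (r / c))%R by rewrite mulrCA mulfV ?mulr1// gt_eqF.
    rewrite [in leLHS]cr (le_trans (v12 _ _))//; first by rewrite divr_gt0.
    apply: lee_wpmul2l; rewrite ?lee_fin//; apply: ge0_subset_integral => //.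
    + exact/measurable_EFinP.
    + by move=> x /=; rewrite in_itv/= andbT lee_fin; exact: v20.
    + exact: itv0_subset.
rewrite lee_fin le_eqVlt => /predU1P[<-|r0]; last exact: v12.
rewrite mulr0 set_itvoo0 !integral_set0 mule0//.
Qed.

Variables (v : R -> R) (dv : nonneg_density v).

Lemma measurable_lorentz_integrand f (D : set R) : measurable D -> D `<=` `]0%R, +oo[ ->
  measurable_fun D (fun t => rearrangement f t `^ p * (v t)%:E).
Proof.
move=> mD D0; apply: emeasurable_funM; first exact: measurable_rearrangement_poweR.
exact: measurable_density.
Qed.

Lemma le_lorentz_integral f g : measurable_fun setT f -> measurable_fun setT g ->
  {ae leb, forall x, (`|f x| <= `|g x|)%R} ->
  lorentz_integral p v f <= lorentz_integral p v g.
Proof.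
move=> mf mg fg; have [v0 mv] := dv; apply: ge0_le_integral => //.
- move=> t /=; rewrite in_itv/= andbT => t0.
  by rewrite mule_ge0 ?poweR_ge0// lee_fin v0.
- exact: measurable_lorentz_integrand.
- exact: measurable_lorentz_integrand.
- move=> t /=; rewrite in_itv/= andbT => t0.
  rewrite lee_wpmul2r ?lee_fin ?v0// ge0_le_poweR ?(ltW p0) ?rearrangement_ge0//.
  exact: le_rearrangement.
Qed.

Lemma lorentz_integralZ (c : R) f : measurable_fun setT f ->
  lorentz_integral p v (fun x => c * f x)%R = (`|c| `^ p)%:E * lorentz_integral p v f.
Proof.
move=> mf; have [v0 mv] := dv.
rewrite /lorentz_integral -ge0_integralZl_EFin ?powR_ge0//; last 2 first.
- move=> t /=; rewrite in_itv/= andbT => t0.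
  by rewrite mule_ge0 ?poweR_ge0// lee_fin v0.
- exact: measurable_lorentz_integrand.
apply: eq_integral => t; rewrite inE/= in_itv/= andbT => t0.
by rewrite rearrangementZ// poweRM ?rearrangement_ge0// poweR_EFin muleA.
Qed.

Lemma lorentz_normE f : lorentz_norm p v f = lorentz_integral p v f `^ p^-1.
Proof. by []. Qed.

Lemma lorentz_norm_lty f : (lorentz_norm p v f < +oo) = (lorentz_integral p v f < +oo).
Proof.
rewrite lorentz_normE; apply/idP/idP; last exact: poweR_lty.
exact: lty_poweRy.
Qed.

Lemma Lambda_carrierP f : carrier (Lambda p v) f <->
  measurable_fun setT f /\ lorentz_integral p v f < +oo.
Proof. by rewrite /= lorentz_norm_lty. Qed.

Lemma Lambda_qnormE f : carrier (Lambda p v) f ->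
  lorentz_integral p v f = (qnorm (Lambda p v) f `^ p)%:E.
Proof.
move=> /Lambda_carrierP[mf foo] /=.
rewrite lorentz_normE fine_poweR -powRrM mulVf// powRr1; last first.
  by rewrite fine_ge0// lorentz_integral_ge0.
by rewrite fineK// ge0_fin_numE// lorentz_integral_ge0.
Qed.

Lemma Lambda_qnorm_ge0 f : (0 <= qnorm (Lambda p v) f)%R.
Proof. by rewrite /= fine_ge0// lorentz_normE poweR_ge0. Qed.

Lemma Lambda_qnorm_le f (M : R) : carrier (Lambda p v) f -> (0 <= M)%R ->
  lorentz_integral p v f <= (M `^ p)%:E -> (qnorm (Lambda p v) f <= M)%R.
Proof.
move=> Lf M0; rewrite Lambda_qnormE// lee_fin => fM; rewrite leNgt; apply/negP => Mf.
have := gt0_ltr_powR p0 _ _ Mf; rewrite !nnegrE M0 Lambda_qnorm_ge0 => /(_ isT isT).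
by rewrite ltNge fM.
Qed.

(** No condition on the weight: closure under addition is not claimed. *)
Lemma Lambda_homogeneous : homogeneous_lattice leb (Lambda p v).
Proof.
split.
- by move=> f [].
- by move=> f _; exact: Lambda_qnorm_ge0.
- move=> c f /Lambda_carrierP[mf foo].
  have mcf : measurable_fun setT (fun x => c * f x)%R by exact: measurable_funM.
  split.
    apply/Lambda_carrierP; split; [exact: mcf|rewrite (lorentz_integralZ _ mf)].
    apply: lte_mul_pinfty; [by rewrite lee_fin powR_ge0|by []|exact: foo].
  rewrite /= !lorentz_normE lorentz_integralZ// poweRM ?lorentz_integral_ge0//.
  by rewrite poweR_EFin -powRrM mulfV// powRr1// fineM// fin_num_poweR// ge0_fin_numE//
    lorentz_integral_ge0.
- move=> f g mf /Lambda_carrierP[mg goo] fg.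
  have fgI := le_lorentz_integral mf mg fg.
  have Lf : carrier (Lambda p v) f.
    by apply/Lambda_carrierP; split; [exact: mf|exact: le_lt_trans goo].
  have Lg : carrier (Lambda p v) g by apply/Lambda_carrierP.
  split; [exact: Lf|apply: Lambda_qnorm_le; [exact: Lf|exact: Lambda_qnorm_ge0|]].
  by rewrite -(Lambda_qnormE Lg).
Qed.

End fixed_exponent.
End lorentz_functional.

(** * Primitives of weights and step functions *)

Section primitive.
Context {R : realType}.
Local Notation leb := (@lebesgue_measure R).
Implicit Types (v : R -> R) (p r : R).

(** The integral of [v] over (0, r), a real number because weights are
    integrable near the origin. *)
Definition primitive v r : R := fine (\int[leb]_(x in `]0%R, r[) (v x)%:E)%E.

Variables (v : R -> R) (wv : weight v).

Let v0 x : 0 < x -> 0 <= v x. Proof. by case: wv => + _; exact. Qed.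
Let dv : nonneg_density v. Proof. exact: weight_density. Qed.

Lemma integral_density_ge0 (D : set R) : D `<=` `]0, +oo[ ->
  (0 <= \int[leb]_(x in D) (v x)%:E)%E.
Proof.
move=> D0; apply: integral_ge0 => x /D0 /=.
by rewrite in_itv/= andbT lee_fin => /v0.
Qed.

Lemma primitiveE r : 0 < r -> (\int[leb]_(x in `]0%R, r[) (v x)%:E = (primitive v r)%:E)%E.
Proof.
move=> r0; rewrite fineK// ge0_fin_numE; last first.
  by apply: integral_density_ge0; exact: itv0_subset.
have [_ /(_ _ r0)/integrableP[_]] := wv; apply: le_lt_trans.
apply: ge0_le_integral => //.
- by move=> x /=; rewrite in_itv/= lee_fin => /andP[/v0].
- by apply: measurable_density => //; exact: itv0_subset.
- by apply: measurableT_comp => //; apply: measurable_density => //; exact: itv0_subset.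
- by move=> x _ /=; rewrite lee_fin ler_norm.
Qed.

Lemma primitive_ge0 r : 0 <= primitive v r.
Proof.
by rewrite fine_ge0//; apply: integral_density_ge0; exact: itv0_subset.
Qed.

Lemma primitive_nondecreasing r s : 0 < r -> r <= s -> primitive v r <= primitive v s.
Proof.
move=> r0 rs; rewrite -lee_fin -!primitiveE//; last exact: lt_le_trans rs.
apply: ge0_subset_integral => //.
- by apply: measurable_density => //; exact: itv0_subset.
- by move=> x /=; rewrite in_itv/= lee_fin => /andP[/v0].
- by move=> x /=; rewrite !in_itv/= => /andP[->] /lt_le_trans ->.
Qed.

Lemma primitive_gt0_ex :
  ~ {ae leb, forall x, 0 < x -> v x = 0} -> exists2 r, 0 < r & 0 < primitive v r.
Proof.
move=> nv; apply: contrapT => nr; apply: nv.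
have mv : measurable_fun (`]0, +oo[%classic : set R) (fun x => (v x)%:E).
  exact: measurable_density.
have v_0 : (\int[leb]_(x in `]0%R, +oo[) `|(v x)%:E| = 0)%E.
  apply/eqP; rewrite eq_le integral_ge0// andbT; apply: le_integral_half_line.
  - exact: measurableT_comp.
  - by [].
  - move=> r r0; rewrite [leLHS](_ : _ = (primitive v r)%:E); last first.
      rewrite -primitiveE//; apply: eq_integral => x.
      by rewrite inE/= in_itv/= => /andP[x0 _]; rewrite ger0_norm// v0.
    rewrite lee_fin leNgt; apply: contra_notN nr => r_gt0.
    by exists r.
have /(ae_eq_integral_abs leb _ mv) := v_0 => /(_ (measurable_itv _)).
by apply: filterS => x vx x0; have := vx; rewrite /= in_itv/= x0 => /(_ isT)[].
Qed.

(** If a zero of the primitive propagates to all its dyadic dilates, then a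
    nontrivial weight has a positive primitive. *)
Lemma primitive_gt0_doubling : ~ {ae leb, forall x, 0 < x -> v x = 0} ->
  (forall r, 0 < r -> primitive v r = 0 -> forall j, primitive v (2 ^+ j * r) = 0) ->
  forall r, 0 < r -> 0 < primitive v r.
Proof.
move=> /primitive_gt0_ex[s s0 Vs] V0 r r0; rewrite lt_def primitive_ge0 andbT.
apply/negP => /eqP /(V0 _ r0) Vj.
(* 2^(j+1) r exceeds s *)
pose j := Num.truncn (s / r).
have : primitive v s <= primitive v (2 ^+ j.+1 * r).
  apply: primitive_nondecreasing => //; rewrite -ler_pdivrMr//.
  rewrite (le_trans (ltW (truncnS_gt _)))// -natrX ler_nat -/j.
  by rewrite ltnW// ltn_expl.
by rewrite Vj leNgt Vs.
Qed.

End primitive.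

Section cells.
Context {R : realType}.
Local Notation leb := (@lebesgue_measure R).
Variables (r : R) (r0 : 0 < r) (n : nat).
Implicit Types (a : 'I_n.+1 -> R).

(** The cells [i r, (i + 1) r) of a grid of mesh [r]. *)
Definition cell (i : nat) : set R := `[i%:R * r, i.+1%:R * r[.

(** The step function with height [a i] on the i-th cell. *)
Definition step_function a (x : R) : R := \sum_(i < n.+1) a i * \1_(cell i) x.

Lemma cell_inj i j x : cell i x -> cell j x -> i = j.
Proof.
rewrite /cell/= !in_itv/= => /andP[ix xi] /andP[jx xj]; apply/eqP.
have := le_lt_trans ix xj; have := le_lt_trans jx xi.
by rewrite !ltr_pM2r// !ltr_nat !ltnS eqn_leq => -> ->.
Qed.

Lemma step_function_cell a (i : 'I_n.+1) x : cell i x -> step_function a x = a i.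
Proof.
move=> ix; rewrite /step_function (bigD1 i)//= big1 ?addr0.
  by rewrite indicE mem_set// mulr1.
move=> j ji; rewrite indicE memNset ?mulr0// => jx.
by move/eqP: ji; apply; apply: val_inj; exact: cell_inj jx ix.
Qed.

Lemma step_function_support a x : step_function a x != 0 ->
  exists i : 'I_n.+1, cell i x.
Proof.
move=> fx; apply: contrapT => nx; move/eqP: fx; apply.
rewrite /step_function big1// => i _; rewrite indicE memNset ?mulr0// => ix.
by apply: nx; exists i.
Qed.

Lemma cell_cover x : 0 <= x -> x < n.+1%:R * r -> exists i : 'I_n.+1, cell i x.
Proof.
move=> x0 xn; have xr0 : 0 <= x / r by rewrite divr_ge0// ltW.
have /andP[lx ux] := truncn_itv xr0.
have ltn : (Num.truncn (x / r) < n.+1)%N.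
  by rewrite -(ltr_nat R) (le_lt_trans lx)// ltr_pdivrMr.
exists (Ordinal ltn); rewrite /cell/= in_itv/=.
by rewrite -ler_pdivlMr// lx -ltr_pdivrMr.
Qed.

Lemma measurable_step_function a : measurable_fun setT (step_function a).
Proof.
rewrite /step_function; apply: measurable_sum => i.
by apply: measurable_funM => //; apply: measurable_indic; exact: measurable_itv.
Qed.

(** Finite subadditivity of the measure; the heights above [c] are counted. *)
Lemma step_function_superlevel a (c : R) : 0 <= c ->
  (leb [set x | (c < `|step_function a x|)%R] <=
    (#|[pred i | (c < `|a i|)%R]|%:R * r)%:E)%E.
Proof.
move=> c0; pose A k : set R := if c < `|a (inord k)| then cell k else set0.
have mA k : measurable (A k).
  by rewrite /A; case: ifP => _; [exact: measurable_itv|exact: measurable0].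
rewrite (le_trans (@content_subadditive _ _ _ leb _ A n.+1 _ _ _))//.
- by move=> k _; exact: mA.
- by apply: measurable_superlevel; exact: measurable_step_function.
- move=> x /= cx; have [|i ix] := @step_function_support a x.
    by rewrite -normr_gt0 (le_lt_trans c0 cx).
  rewrite -bigcup_mkord; exists i => //=.
  by rewrite /A inord_val -(step_function_cell a ix) cx.
rewrite (eq_bigr (fun i : 'I_n.+1 => ((c < `|a i|)%R%:R * r)%:E)) => [|i _]; last first.
  rewrite /A inord_val; case: ifP => _; last by rewrite measure0 mul0r.
  apply: (etrans (lebesgue_measure_itv _)) => /=.
  by rewrite lte_fin ltr_pM2r// ltr_nat ltnSn -EFinB -mulrBl -natrB// subSnn.
rewrite sumEFin lee_fin -mulr_suml ler_pM2r//.
rewrite -(natr_sum _ _ _ (fun i : 'I_n.+1 => nat_of_bool (c < `|a i|))) ler_nat.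
by rewrite -sum1_card [leqRHS]big_mkcond/=; apply: leq_sum => i _; rewrite unfold_in/=; case: ifP.
Qed.

Lemma step_function_le1 a x : (forall i, `|a i| <= 1) ->
  `|step_function a x| <= 1.
Proof.
move=> a1; have [->|fx] := eqVneq (step_function a x) 0; first by rewrite normr0.
by have [i ix] := step_function_support fx; rewrite (step_function_cell a ix).
Qed.

End cells.

(** * Necessity of the conditions on the weights *)

Lemma card_shift n (s : 'I_n.+1) (P : pred 'I_n.+1) :
  #|[pred i | P (i + s)]| = #|[pred i | P i]|.
Proof. by rewrite -!sum1_card [RHS](reindex_inj (@addIr _ s)). Qed.

Lemma card_ord_lt n K : (#|[pred i : 'I_n | (i < K)%N]| <= K)%N.
Proof.
rewrite -sum1_card; have [Kn|nK] := leqP K n.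
  by rewrite (big_ord_narrow Kn) sum1_card card_ord.
by rewrite sum1_card (leq_trans (max_card _))// card_ord ltnW.
Qed.

Lemma harmonic_sum_ge {R : realFieldType} m n : n.+1 = (2 ^ m)%N ->
  1 + m%:R / 2 <= \sum_(i < n.+1) (i.+1%:R^-1 : R).
Proof.
move=> ->; elim: m => [|m IHm].
  by rewrite expn0 big_ord1 mul0r addr0 invr1.
rewrite expnS mul2n -addnn big_split_ord/=.
rewrite (_ : 1 + _ = (1 + m%:R / 2) + 2^-1); last by rewrite -natr1; field.
rewrite lerD//.
rewrite (le_trans _ (ler_sum _ (F := fun=> ((2 ^ m.+1)%:R^-1 : R)) _))//.
  rewrite sumr_const card_ord -[leRHS]mulr_natl [leRHS](_ : _ = 2^-1 :> R)//.
  rewrite expnS natrM; field.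
  by rewrite pnatr_eq0 expn_eq0.
move=> i _; rewrite lef_pV2 ?posrE ?ltr0n ?expn_gt0// ler_nat.
by rewrite expnS mul2n -addnn -addnS leq_add2l.
Qed.

Section lorentz_test_functions.
Context {R : realType}.
Local Notation leb := (@lebesgue_measure R).
Variables (v : R -> R) (wv : weight v) (p : R) (p0 : 0 < p).
Implicit Types (f : R -> R) (r : R).

Local Notation V := (primitive v).
Let dv : nonneg_density v. Proof. exact: weight_density. Qed.
Let v0 x : 0 < x -> 0 <= v x. Proof. by case: wv => + _; exact. Qed.

(** The Lorentz functional of the indicator of a set of measure [r]. *)
Definition fundamental_function r : R := V r `^ p^-1.
Local Notation phi := fundamental_function.

Lemma fundamental_function_ge0 r : 0 <= phi r.
Proof. exact: powR_ge0. Qed.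

Lemma fundamental_functionK r : phi r `^ p = V r.
Proof.
by rewrite /phi -powRrM mulVf ?gt_eqF// powRr1// primitive_ge0.
Qed.

(** Suppose that |f| <= 1, that |f| exceeds 2^-k on a set of measure at most
    2^k r for 0 < k <= m, and that [f] lives on a set of measure at most 2^m r. Then
    its rearrangement is at most 2 * 2^-k between 2^(k-1) r and 2^k r, and vanishes
    beyond 2^m r. *)
Lemma lorentz_integral_le_profile m r f : measurable_fun setT f -> 0 < r ->
  (forall x, `|f x| <= 1) ->
  (forall k, (0 < k <= m)%N -> (leb [set x | (2 ^- k < `|f x|)%R] <= (2 ^+ k * r)%:E)%E) ->
  (leb [set x | (0 < `|f x|)%R] <= (2 ^+ m * r)%:E)%E ->
  (lorentz_integral p v f <=
    (2 `^ p * \sum_(k < m.+1) (2 ^- k) `^ p * V (2 ^+ k * r))%:E)%E.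
Proof.
move=> mf r0 f1 fk fm.
have f1t t : 0 < t -> (rearrangement f t <= 1%:E)%E.
  move=> t0; apply: rearrangement_le_superlevel; rewrite (_ : mkset _ = set0).
    by rewrite measure0 lee_fin ltW.
  by apply/seteqP; split => // x /=; rewrite ltNge f1.
have kr0 k : 0 < 2 ^+ k * r by rewrite mulr_gt0// exprn_gt0.
pose term k t := ((fun t => (v t)%:E) \_ `]0, 2 ^+ k * r[%classic) t : \bar R.
have mterm k : measurable_fun (`]0, +oo[%classic : set R) (term k).
  apply/measurable_restrict => //; apply: measurable_density; [exact: dv| |by move=> x []].
  exact: measurableI.
have term0 k t : (0 <= term k t)%E.
  rewrite /term patchE; case: ifPn => //; rewrite inE/= in_itv/= lee_fin => /andP[t0 _].
  exact: v0.
pose c k : R := 2 `^ p * (2 ^- k) `^ p.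
have c0 k : 0 <= c k by rewrite mulr_ge0// powR_ge0.
rewrite mulr_sumr -sumEFin.
rewrite (eq_bigr (fun k : 'I_m.+1 => \int[leb]_(t in `]0%R, +oo[) ((c k)%:E * term k t))%E); last first.
  move=> k _; rewrite ge0_integralZl_EFin; [|by []|by []|exact: mterm|exact: c0].
  rewrite mulrA EFinM -primitiveE//; congr (_ * _)%E.
  by rewrite -integral_mkcondr; congr (integral _ _ _); rewrite setIidr//; exact: itv0_subset.
rewrite -ge0_integral_sum//; last 2 first.
- by move=> k; apply: measurable_funeM; exact: mterm.
- by move=> k t _; rewrite mule_ge0// lee_fin.
apply: ge0_le_integral => //.
- move=> t /=; rewrite in_itv/= andbT => t0.
  by rewrite mule_ge0 ?poweR_ge0// lee_fin v0.
- exact: measurable_lorentz_integrand.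
- by apply: emeasurable_sum => k; apply: measurable_funeM; exact: mterm.
move=> t /=; rewrite in_itv/= andbT => t0.
have sum0 : (0 <= \sum_(k < m.+1) (c k)%:E * term k t)%E.
  by apply: sume_ge0 => k _; rewrite mule_ge0// lee_fin.
have [tm|mt] := ltP t (2 ^+ m * r); last first.
  have -> : rearrangement f t = 0%E.
    apply/eqP; rewrite eq_le rearrangement_ge0// andbT.
    by apply: rearrangement_le_superlevel; rewrite (le_trans fm)// lee_fin.
  by rewrite poweR0r ?gt_eqF// mul0e.
(* the term of the first interval (0, 2^k r) containing t dominates *)
have exk : exists k, t < 2 ^+ k * r by exists m.
case: (ex_minnP exk) => k tk kmin.
have km : (k < m.+1)%N by rewrite ltnS; exact: kmin.
have ft : (rearrangement f t <= (2 * 2 ^- k)%:E)%E.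
  case: k tk kmin km => [|k] tk kmin km.
    by rewrite expr0 invr1 mulr1 (le_trans (f1t _ t0))// lee_fin ler1n.
  rewrite exprS invfM mulrA mulfV// mul1r.
  have kt : 2 ^+ k * r <= t.
    by rewrite leNgt; apply/negP => /kmin; rewrite ltnn.
  case: k kt kmin km tk => [|k] kt kmin km tk.
    by rewrite expr0 invr1 f1t.
  apply: rearrangement_le_superlevel; apply: (le_trans (fk _ _)).
    by rewrite /= -ltnS; exact: ltnW.
  by rewrite lee_fin.
rewrite (bigD1 (Ordinal km))//= -[leLHS]adde0 leeD//; last first.
  by apply: sume_ge0 => j _; rewrite mule_ge0// lee_fin.
rewrite /term patchE ifT ?inE/= ?in_itv/= ?t0//.
rewrite lee_wpmul2r ?lee_fin ?v0//.
rewrite (le_trans (ge0_le_poweR (ltW p0) (rearrangement_ge0 t mf) ft))//.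
by rewrite poweR_EFin powRM// invr_ge0 exprn_ge0.
Qed.

(** Lower bound from an interval of length [L] on which |f| is at least [c]. *)
Lemma lorentz_integral_ge_itv (L c : R) f : measurable_fun setT f -> 0 < L -> 0 <= c ->
  (forall x, 0 <= x -> x < L -> c <= `|f x|) ->
  ((c `^ p * V L)%:E <= lorentz_integral p v f)%E.
Proof.
move=> mf L0 c0 cf.
have ft t : 0 < t -> t < L -> (c%:E <= rearrangement f t)%E.
  move=> t0 tL; apply: lee_real_minorants => s; rewrite lte_fin => sc.
  apply/rearrangement_gt => //; apply: (@lt_le_trans _ _ L%:E); first by rewrite lte_fin.
  rewrite (_ : L%:E = leb `[0, L[%classic); last first.
    by rewrite lebesgue_measure_itv/= lte_fin L0 sube0.
  apply: le_measure; rewrite ?inE//; first exact: measurable_superlevel.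
  by move=> x /=; rewrite in_itv/= => /andP[x0 xL]; rewrite (lt_le_trans sc)// cf.
rewrite EFinM -primitiveE// -ge0_integralZl_EFin ?powR_ge0//; last 2 first.
- by move=> x /=; rewrite in_itv/= lee_fin => /andP[/v0].
- by apply: measurable_density => //; exact: itv0_subset.
apply: (@le_trans _ _ (\int[leb]_(t in `]0%R, L[) (rearrangement f t `^ p * (v t)%:E))%E).
  apply: ge0_le_integral => //.
  - move=> t /=; rewrite in_itv/= => /andP[t0 _].
    by rewrite mule_ge0 ?lee_fin ?powR_ge0// v0.
  - apply: measurable_funeM; apply: measurable_density => //; exact: itv0_subset.
  - by apply: measurable_lorentz_integrand => //; exact: itv0_subset.
  - move=> t /=; rewrite in_itv/= => /andP[t0 tL].
    rewrite lee_wpmul2r ?lee_fin ?v0// -poweR_EFin.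
    by apply: ge0_le_poweR; [exact: ltW|rewrite lee_fin|exact: ft].
apply: ge0_subset_integral => //.
- exact: measurable_lorentz_integrand.
- by move=> t /=; rewrite in_itv/= andbT => t0; rewrite mule_ge0 ?poweR_ge0// lee_fin v0.
- exact: itv0_subset.
Qed.

Lemma Lambda_profile m r f (B : R) : measurable_fun setT f -> 0 < r -> 0 <= B ->
  (forall x, `|f x| <= 1) ->
  (forall k, (0 < k <= m)%N -> (leb [set x | (2 ^- k < `|f x|)%R] <= (2 ^+ k * r)%:E)%E) ->
  (leb [set x | (0 < `|f x|)%R] <= (2 ^+ m * r)%:E)%E ->
  2 `^ p * \sum_(k < m.+1) (2 ^- k) `^ p * V (2 ^+ k * r) <= B `^ p ->
  carrier (Lambda p v) f /\ qnorm (Lambda p v) f <= B.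
Proof.
move=> mf r0 B0 f1 fk fm sB; have fI := lorentz_integral_le_profile mf r0 f1 fk fm.
have Lf : carrier (Lambda p v) f.
  by apply/Lambda_carrierP => //; split; [exact: mf|exact: le_lt_trans fI (ltry _)].
split; [exact: Lf|apply: Lambda_qnorm_le => //].
by apply: (le_trans fI); rewrite lee_fin.
Qed.

Section cyclic_shifts.
Variable C : R.
Hypotheses (C0 : 0 < C) (linL : linear_subspace (carrier (Lambda p v))).
Hypothesis subL : forall n (f_ : nat -> R -> R), (forall i, carrier (Lambda p v) (f_ i)) ->
  qnorm (Lambda p v) (fun x => \sum_(i < n) f_ i x) <=
    C * \sum_(i < n) qnorm (Lambda p v) (f_ i).

(** The n + 1 cyclic shifts of a step function on n + 1 cells, of heights [a i],
    add up to the constant sum of the heights on [0, (n + 1) r). The index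
    [i + s] is taken modulo n + 1. *)
Lemma cyclic_shifts_bound n (a : 'I_n.+1 -> R) r B : 0 < r ->
  (forall i, 0 <= a i) ->
  (forall s, let f := step_function r (fun i : 'I_n.+1 => a (i + s)) in
     carrier (Lambda p v) f /\ qnorm (Lambda p v) f <= B) ->
  (\sum_i a i) * phi (n.+1%:R * r) <= C * (n.+1%:R * B).
Proof.
move=> r0 a0 fB; pose F s := step_function r (fun i : 'I_n.+1 => a (i + s)).
pose f_ j := F (inord j); have Lf j : carrier (Lambda p v) (f_ j) by case: (fB (inord j)).
pose g x := \sum_(j < n.+1) f_ j x.
have Lg : carrier (Lambda p v) g by exact: linear_subspace_sum.
have [mg _] := Lg.
have H0 : 0 <= \sum_i a i by exact: sumr_ge0.
have gH x : 0 <= x -> x < n.+1%:R * r -> \sum_i a i <= `|g x|.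
  move=> x0 xn; have [i ix] := cell_cover r0 x0 xn.
  rewrite (_ : g x = \sum_i a i) ?ger0_norm//.
  (* over a fixed cell i, the shifts run through all the heights *)
  rewrite (reindex_inj (addrI i)); apply: eq_bigr => j _.
  by rewrite /f_ /F inord_val (step_function_cell r0 _ ix).
have gI := lorentz_integral_ge_itv mg (mulr_gt0 (ltr0Sn R n) r0) H0 gH.
have Hg : (\sum_i a i) * phi (n.+1%:R * r) <= qnorm (Lambda p v) g.
  rewrite leNgt; apply/negP => gHphi.
  have := gt0_ltr_powR p0 _ _ gHphi.
  rewrite !nnegrE Lambda_qnorm_ge0 mulr_ge0 ?fundamental_function_ge0// => /(_ isT isT).
  rewrite powRM ?fundamental_function_ge0// fundamental_functionK.
  by rewrite (Lambda_qnormE p0 dv Lg) lee_fin in gI; rewrite ltNge gI.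
rewrite (le_trans Hg)// (le_trans (subL n.+1 Lf))// ler_pM2l//.
rewrite (le_trans (ler_sum _ (G := fun=> B) _))//.
  by move=> j _; have [] := fB (inord j).
by rewrite sumr_const card_ord mulr_natl.
Qed.

(** The shifts of the indicator of one cell. *)
Lemma fundamental_function_mulS n r : 0 < r ->
  phi (n.+1%:R * r) <= 2 * C * n.+1%:R * phi r.
Proof.
move=> r0; pose a (i : 'I_n.+1) : R := (i == 0)%:R.
have sum1 : \sum_i a i = 1.
  by rewrite (bigD1 0)//= big1 ?addr0 /a ?eqxx// => i /negbTE ->.
rewrite (_ : 2 * C * n.+1%:R * phi r = C * (n.+1%:R * (2 * phi r))); last by ring.
have a0 i : 0 <= a i by rewrite ler0n.
rewrite -[leLHS]mul1r -[X in X * _ <= _]sum1; apply: (cyclic_shifts_bound r0 a0).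
move=> s f; have B0 : 0 <= 2 * phi r by rewrite mulr_ge0// fundamental_function_ge0.
apply: (@Lambda_profile 0 r); [|by []|by []| | | |].
- exact: measurable_step_function.
- move=> x; apply: (step_function_le1 r0) => i.
  by rewrite /a; case: eqP; rewrite ?normr1 ?normr0.
- by case.
- rewrite (le_trans (step_function_superlevel r0 _ (lexx 0)))// lee_fin.
  rewrite expr0 ler_pM2r// lern1 (card_shift s (fun i => 0 < `|a i|)) -(card1 (0 : 'I_n.+1)).
  apply: subset_leq_card; apply/fintype.subsetP => i; rewrite !inE /a.
  by case: eqP => //; rewrite normr0 ltxx.
- rewrite big_ord1 expr0 invr1 powR1 !mul1r powRM ?fundamental_function_ge0//.
  by rewrite fundamental_functionK.
Qed.

(** The shifts of the step function with heights 1, 1/2, 1/3, ..., 1/2^m. Heights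
    above 2^-k occur at most 2^k times, so [lorentz_integral_le_profile] applies,
    and by [fundamental_function_mulS] each of its m + 1 terms is at most
    (2 C phi(r))^p. *)
Lemma fundamental_function_dyadic m r : 0 < r ->
  (1 + m%:R / 2) * phi (2 ^+ m * r) <=
  4 * C ^+ 2 * m.+1%:R `^ p^-1 * 2 ^+ m * phi r.
Proof.
move=> r0; have [n nE] : exists n, n.+1 = (2 ^ m)%N.
  by exists (2 ^ m).-1; rewrite prednK// expn_gt0.
have nER : n.+1%:R = 2 ^+ m :> R by rewrite nE natrX.
pose a (i : 'I_n.+1) : R := i.+1%:R^-1.
have a0 i : 0 <= a i by rewrite invr_ge0.
pose B := 4 * C * m.+1%:R `^ p^-1 * phi r.
have phi0 := fundamental_function_ge0; have C_ge0 := ltW C0.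
have B0 : 0 <= B.
  by rewrite mulr_ge0// mulr_ge0 ?powR_ge0// mulr_ge0// ltW.
rewrite -nER (_ : 4 * _ * _ * _ * _ = C * (n.+1%:R * B)); last by rewrite /B; ring.
apply: (@le_trans _ _ ((\sum_i a i) * phi (n.+1%:R * r))).
  by rewrite ler_wpM2r// harmonic_sum_ge.
apply: (cyclic_shifts_bound r0 a0) => s f.
apply: (@Lambda_profile m r); [|by []|by []| | | |].
- exact: measurable_step_function.
- move=> x; apply: (step_function_le1 r0) => i.
  by rewrite ger0_norm// invf_le1 ?ler1n.
- move=> k /andP[k0 km]; rewrite (le_trans (step_function_superlevel r0 _ _))//.
  rewrite lee_fin ler_pM2r// -natrX ler_nat (card_shift s (fun i => (2 ^ k)%:R^-1 < `|a i|)).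
  apply: leq_trans (card_ord_lt n.+1 (2 ^ k)).
  apply: subset_leq_card; apply/fintype.subsetP => i; rewrite !inE ger0_norm// /a.
  rewrite ltf_pV2 ?posrE ?ltr0n ?expn_gt0// ltr_nat => /ltnW ik; exact: ik.
- rewrite (le_trans (step_function_superlevel r0 _ (lexx 0)))//.
  rewrite lee_fin ler_pM2r// -nER ler_nat.
  by rewrite (leq_trans (max_card _))// card_ord.
- rewrite (_ : B = 2 * (2 * C * phi r * m.+1%:R `^ p^-1)); last by rewrite /B; ring.
  have h0 : 0 <= 2 * C * phi r by rewrite mulr_ge0// mulr_ge0// ltW.
  rewrite [leRHS]powRM ?mulr_ge0 ?powR_ge0//// ler_wpM2l ?powR_ge0//.
  rewrite powRM ?powR_ge0// -powRrM mulVf ?gt_eqF// powRr1//.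
  rewrite [leRHS]mulr_natr -[X in _ <= _ *+ X](card_ord m.+1) -sumr_const ler_sum// => k _.
  have pk : phi (2 ^+ k * r) <= 2 * C * 2 ^+ k * phi r.
    have [j jE] : exists j, j.+1 = (2 ^ k)%N.
      by exists (2 ^ k).-1; rewrite prednK// expn_gt0.
    have jER : j.+1%:R = 2 ^+ k :> R by rewrite jE natrX.
    by rewrite -jER; exact: fundamental_function_mulS.
  have k0 : 0 <= 2 ^- k :> R by rewrite invr_ge0 exprn_ge0.
  rewrite -(fundamental_functionK (2 ^+ k * r)) -(powRM p k0 (phi0 _)).
  apply: ge0_ler_powR; [exact: ltW|by rewrite nnegrE mulr_ge0|by rewrite nnegrE|].
  rewrite ler_pdivrMl ?exprn_gt0//; apply: (le_trans pk).
  by rewrite le_eqVlt; apply/orP; left; apply/eqP; ring.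
Qed.

End cyclic_shifts.
End lorentz_test_functions.

Lemma quarter_succ_le (R : realFieldType) m : m.+1%:R / 4 <= (1 + m%:R / 2) / 2 :> R.
Proof. by rewrite -(natr1 m); have := ler0n R m; move: (m%:R : R) => y; lra. Qed.

Section necessity.
Context {R : realType}.
Local Notation leb := (@lebesgue_measure R).
Variables (v : R -> R) (wv : weight v).
Implicit Types (p r : R).

Local Notation V := (primitive v).
Let dv : nonneg_density v. Proof. exact: weight_density. Qed.
Let v0 x : 0 < x -> 0 <= v x. Proof. by case: wv => + _; exact. Qed.

(** If the primitive grows by a factor strictly less than N^p when r is
    multiplied by N, the integrals of v(x) / x^p over the pieces (N^j r, N^(j+1) r)
    decay geometrically. *)
Lemma growth_Bp p (N e : R) : 0 < p -> 2 <= N -> 0 <= e -> e < 1 ->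
  (forall r, 0 < r -> V (N * r) <= e * N `^ p * V r) -> Bp p v.
Proof.
move=> p0 N2 e0 e1 VN; have N0 : 0 < N by rewrite (lt_le_trans _ N2).
have N1 : 1 <= N by rewrite (le_trans _ N2)// ler1n.
(* chosen so that e N^p + B e = B, which closes the induction below *)
pose B := e * N `^ p / (1 - e).
have e1' : 0 < 1 - e by rewrite subr_gt0.
have B0 : 0 <= B by rewrite divr_ge0 ?mulr_ge0 ?powR_ge0// ltW.
have BE : e * N `^ p + B * e = B by rewrite /B; field; rewrite gt_eqF.
have g0 x : 0 < x -> (0 <= (v x / x `^ p)%:E)%E.
  by move=> x0; rewrite lee_fin divr_ge0 ?powR_ge0// v0.
have sub0 r (b : itv_bound R) : 0 < r -> [set` Interval (BRight r) b] `<=` `]0, +oo[.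
  by move=> r0 x /=; rewrite !in_itv/= => /andP[/(lt_trans r0) ->].
(* induction on the number of pieces: (r, N r] is bounded by V(N r) / r^p, the
   others by the hypothesis at N r *)
have Phi j : forall r, 0 < r ->
    (\int[leb]_(x in `]r, (N ^+ j * r)%R]) (v x / x `^ p)%:E <= (B * (V r / r `^ p))%:E)%E.
  elim: j => [|j IHj] r r0.
    rewrite expr0 mul1r set_itvoc0 integral_set0 lee_fin.
    by rewrite mulr_ge0// divr_ge0 ?powR_ge0// primitive_ge0.
  have Nr0 : 0 < N * r by rewrite mulr_gt0.
  have rN : r <= N * r by rewrite ler_peMl// ltW.
  have NrN : N * r <= N ^+ j.+1 * r.
    by rewrite exprS -mulrA ler_wpM2l ?(ltW N0)// ler_peMl ?(ltW r0)// exprn_ege1.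
  rewrite (_ : `]r, (N ^+ j.+1 * r)%R]%classic = `]r, (N * r)%R]%classic `|` `](N * r)%R, (N ^+ j.+1 * r)%R]%classic); last first.
    by rewrite -itv_bndbnd_setU// bnd_simp.
  rewrite ge0_integral_setU//; last 3 first.
  - apply: (measurable_tail_integrand _ dv); first exact: measurableU.
    by move=> x [/(sub0 _ _ r0)|/(sub0 _ _ Nr0)].
  - by move=> x [/(sub0 _ _ r0)|/(sub0 _ _ Nr0)]; rewrite /= in_itv/= andbT => /g0.
  - apply/disj_setPS => x [/=]; rewrite !in_itv/= => /andP[_ xN] /andP[Nx _].
    by have := lt_le_trans Nx xN; rewrite ltxx.
  have first_piece : (\int[leb]_(x in `]r, (N * r)%R]) (v x / x `^ p)%:E <=
      (V (N * r) / r `^ p)%:E)%E.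
    rewrite (@le_trans _ _ (\int[leb]_(x in `]r, (N * r)%R]) ((r `^ p)^-1%:E * (v x)%:E)))%E//.
      apply: ge0_le_integral => //.
      - by move=> x /(sub0 _ _ r0); rewrite /= in_itv/= andbT => /g0.
      - by apply: (measurable_tail_integrand _ dv) => //; exact: sub0.
      - by apply: measurable_funeM; apply: measurable_density => //; exact: sub0.
      move=> x; rewrite /= in_itv/= => /andP[rx _]; rewrite lee_fin mulrC.
      rewrite ler_wpM2r ?v0 ?(lt_trans r0)// lef_pV2 ?posrE ?powR_gt0// ?(lt_trans r0)//.
      by apply: ge0_ler_powR; rewrite ?nnegrE ?(ltW p0) ?(ltW r0) ?(ltW rx)// ltW// (lt_trans r0).
    rewrite ge0_integralZl_EFin//; last 3 first.
    - move=> x /(sub0 _ _ r0); rewrite /= in_itv/= andbT lee_fin; exact: v0.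
    - by apply: measurable_density => //; exact: sub0.
    - by rewrite invr_ge0 powR_ge0.
    rewrite [V (N * r) / _]mulrC EFinM -primitiveE//; apply: lee_wpmul2l.
      by rewrite lee_fin invr_ge0 powR_ge0.
    rewrite integral_itv_bndo_bndc; last first.
      by apply: measurable_density => //; exact: itv0_subset.
    apply: ge0_subset_integral => //.
    - by apply: measurable_density => //; exact: itv0_subset.
    - by move=> x /=; rewrite in_itv/= lee_fin => /andP[/v0].
    - by move=> x /=; rewrite !in_itv/= => /andP[/(lt_trans r0) -> ->].
  apply: (le_trans (leeD first_piece _)).
    by rewrite exprSr -mulrA; exact: IHj.
  rewrite -EFinD lee_fin powRM ?(ltW N0) ?(ltW r0)// invfM.
  have rp : 0 <= (r `^ p)^-1 by rewrite invr_ge0 powR_ge0.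
  have VNr := VN r r0.
  rewrite (_ : _ + _ = (1 + B / N `^ p) * (V (N * r)) * (r `^ p)^-1); last by ring.
  rewrite [leRHS]mulrA ler_wpM2r//.
  have Np0 : N `^ p != 0 by rewrite gt_eqF// powR_gt0.
  rewrite (@le_trans _ _ ((1 + B / N `^ p) * (e * N `^ p * V r)))//.
    by rewrite ler_wpM2l// addr_ge0// divr_ge0 ?powR_ge0.
  by rewrite -[in leRHS]BE le_eqVlt; apply/orP; left; apply/eqP; field.
exists (B + 1); first by rewrite ltr_pwDr.
move=> r r0; have rp : 0 < r `^ p by rewrite powR_gt0.
have cover : \bigcup_j `]r, (N ^+ j * r)%R]%classic = `]r, +oo[%classic :> set R.
  apply/seteqP; split => [x [j _]|x]; rewrite /= !in_itv/= ?andbT; first by case/andP.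
  move=> rx; exists (Num.truncn (x / r)).+1 => //=; rewrite in_itv/= rx/=.
  rewrite -ler_pdivrMr// ltW// (lt_le_trans (truncnS_gt _))//.
  rewrite (@le_trans _ _ (2 ^+ (Num.truncn (x / r)).+1))//.
    by rewrite -natrX ler_nat ltnW// ltn_expl.
  by rewrite lerXn2r// nnegrE// ltW.
have Phir : (\int[leb]_(x in `]r, +oo[) (v x / x `^ p)%:E <= (B * (V r / r `^ p))%:E)%E.
  rewrite -cover; apply: le_integral_exhaustion => //.
  - apply/nondecreasing_seqP => j; apply/subsetPset => x; rewrite /= !in_itv/=.
    move=> /andP[-> /le_trans]; apply; rewrite ler_wpM2r ?(ltW r0)//.
    by rewrite ler_weXn2l.
  - by rewrite cover; apply: (measurable_tail_integrand _ dv) => //; exact: sub0.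
  - by rewrite cover => x /(sub0 _ _ r0); rewrite /= in_itv/= andbT => /g0.
  - by move=> j; exact: Phi.
rewrite primitiveE//; apply: (@le_trans _ _ ((r `^ p)%:E * (B * (V r / r `^ p))%:E)%E).
  by apply: lee_wpmul2l => //; rewrite lee_fin ltW.
rewrite -!EFinM lee_fin (_ : r `^ p * (B * (V r / r `^ p)) = B * V r); last by field; rewrite gt_eqF.
by rewrite ler_wpM2r ?primitive_ge0// lerDl.
Qed.

(** By [fundamental_function_dyadic], phi(2^m r) is at most 2^m phi(r) times a
    factor of order m^(1/p - 1), which is small for m large because p > 1. *)
Lemma Lambda_Bp p : 1 < p -> linear_subspace (carrier (Lambda p v)) ->
  finitely_subadditive (Lambda p v) -> Bp p v.
Proof.
move=> p1 linL [C C0 subL]; have p0 : 0 < p by rewrite (lt_trans _ p1).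
have q0 : 0 < 1 - p^-1 by rewrite subr_gt0 invf_lt1.
(* m + 1 >= X gives 4 C^2 (m + 1)^(1/p) <= (m + 1) / 4 <= (1 + m / 2) / 2 *)
pose X := (16 * C ^+ 2) `^ (1 - p^-1)^-1.
have XE : X `^ (1 - p^-1) = 16 * C ^+ 2.
  by rewrite -powRrM mulVf ?gt_eqF// powRr1// mulr_ge0// exprn_ge0// ltW.
have [m m_gt0 Xm] : exists2 m, (0 < m)%N & X <= m.+1%:R.
  exists (Num.truncn X).+1 => //.
  by rewrite (le_trans (ltW (truncnS_gt X)))// ler_nat.
have m0 : 0 < m.+1%:R :> R by [].
have half r : 0 < r ->
    fundamental_function v p (2 ^+ m * r) <= 2^-1 * 2 ^+ m * fundamental_function v p r.
  move=> r0; have dy := fundamental_function_dyadic wv p0 C0 linL subL m r0.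
  have f0 := fundamental_function_ge0 v p r.
  have m2 : 0 < 1 + m%:R / 2 :> R by rewrite ltr_pwDl// divr_ge0.
  rewrite -(ler_pM2l m2) (le_trans dy)//.
  rewrite (_ : (1 + m%:R / 2) * _ = ((1 + m%:R / 2) / 2) * 2 ^+ m * fundamental_function v p r); last by ring.
  rewrite ler_wpM2r// ler_pM2r ?exprn_gt0//.
  apply: (@le_trans _ _ (m.+1%:R / 4)); last first.
    exact: quarter_succ_le.
  have mp : 0 < m.+1%:R `^ p^-1 :> R by rewrite powR_gt0.
  have mE : m.+1%:R = m.+1%:R `^ (1 - p^-1) * m.+1%:R `^ p^-1 :> R.
    by rewrite -powRD ?subrK ?powRr1// pnatr_eq0 implybT.
  rewrite ler_pdivlMr// [leRHS]mE.
  rewrite (_ : _ * 4 = 16 * C ^+ 2 * m.+1%:R `^ p^-1); last by ring.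
  rewrite ler_wpM2r ?(ltW mp)//.
  rewrite -XE; apply: ge0_ler_powR; rewrite ?nnegrE ?(ltW q0) ?powR_ge0//.
apply: (@growth_Bp p (2 ^+ m) (2^-1 `^ p)) => //.
- by case: m m_gt0 {Xm m0 half} => // m _; rewrite exprS ler_peMr// exprn_ege1// ler1n.
- by rewrite -[ltRHS](congr1 (@^~ p) (powR1 R)); apply: gt0_ltr_powR; rewrite ?nnegrE// invf_lt1// ltr1n.
move=> r r0; rewrite -(fundamental_functionK wv p0 (2 ^+ m * r)).
rewrite -(fundamental_functionK wv p0 r).
have f0 t := fundamental_function_ge0 v p t.
rewrite -powRM ?exprn_ge0// -powRM ?mulr_ge0 ?exprn_ge0//.
apply: ge0_ler_powR; [exact: ltW|by rewrite nnegrE| |exact: half].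
by rewrite nnegrE !mulr_ge0// exprn_ge0.
Qed.

(** For p = 1 the fundamental function is the primitive, and
    [fundamental_function_mulS] with n the integer part of r / s gives the claim. *)
Lemma Lambda_B1oo : linear_subspace (carrier (Lambda 1 v)) ->
  finitely_subadditive (Lambda 1 v) -> B1oo v.
Proof.
move=> linL [C C0 subL]; exists (4 * C); first by rewrite mulr_gt0.
move=> s r s0 sr; have r0 : 0 < r by exact: lt_le_trans sr.
have phiV t : fundamental_function v 1 t = V t.
  by rewrite /fundamental_function invr1 powRr1// primitive_ge0.
have rs0 : 0 <= r / s by rewrite divr_ge0// ltW.
have /andP[nr rn] := truncn_itv rs0; set n := Num.truncn _ in nr rn.
have n1 : (1 <= n)%N by rewrite truncn_gt0 ler_pdivlMr// mul1r.
have h := fundamental_function_mulS wv ltr01 C0 linL subL n s0; rewrite !phiV in h.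
have Vr : V r <= V (n.+1%:R * s).
  by apply: primitive_nondecreasing => //; rewrite -ler_pdivrMr// ltW.
rewrite !primitiveE// -!EFinM lee_fin ler_pdivrMl//.
apply: (le_trans Vr); apply: (le_trans h).
rewrite (_ : r * _ = 4 * C * (r / s) * V s); last by ring.
rewrite ler_wpM2r ?primitive_ge0//.
rewrite (_ : 2 * C * n.+1%:R = 4 * C * (n.+1%:R / 2)); last by field.
rewrite ler_wpM2l ?mulr_ge0 ?(ltW C0)// (le_trans _ nr)// ler_pdivrMr// -natrM ler_nat.
by rewrite muln2 -addnn -addn1 leq_add2l.
Qed.

End necessity.

(** * Lorentz spaces as function lattices *)

Section lorentz_lattice.
Context {R : realType}.
Local Notation leb := (@lebesgue_measure R).
Variables (v : R -> R) (wv : weight v) (p : R) (p0 : 0 < p).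
Implicit Types (f : R -> R) (r : R).

Local Notation V := (primitive v).
Let dv : nonneg_density v. Proof. exact: weight_density. Qed.
Let v0 x : 0 < x -> 0 <= v x. Proof. by case: wv => + _; exact. Qed.
Let pV0 : (p^-1 != 0)%R. Proof. by rewrite invr_eq0 gt_eqF. Qed.

(** The indicator of an interval [0, r) on which [v] has positive mass. *)
Lemma Lambda_nontrivial : ~ {ae leb, forall x, 0 < x -> v x = 0} ->
  exists2 f, carrier (Lambda p v) f & 0 < qnorm (Lambda p v) f.
Proof.
move=> /(primitive_gt0_ex wv)[r r0 Vr]; pose f : R -> R := \1_(`[0, r[%classic).
have mf : measurable_fun setT f by apply: measurable_indic; exact: measurable_itv.
have f1 x : `|f x| <= 1.
  by rewrite /f indicE; case: (_ \in _); rewrite ?normr1 ?normr0.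
have supp_f : (leb [set x | (0 < `|f x|)%R] <= (2 ^+ 0 * r)%:E)%E.
  rewrite (_ : mkset _ = `[0, r[%classic); last first.
    apply/seteqP; split => x /=.
      by rewrite /f indicE mem_setE; case: (_ \in _); rewrite ?normr0 ?ltxx.
    by move=> xr; rewrite /f indicE mem_set// normr1.
  by rewrite lebesgue_measure_itv/= lte_fin r0 sube0 expr0 mul1r.
have fI := lorentz_integral_le_profile wv p0 mf r0 f1 _ supp_f.
have Lf : carrier (Lambda p v) f.
  apply/Lambda_carrierP; [exact: p0|split; [exact: mf|]].
  by apply: le_lt_trans (fI _) (ltry _); case.
exists f; [exact: Lf|rewrite lt_def Lambda_qnorm_ge0 andbT; apply/negP => /eqP f0].
have : (0 < lorentz_integral p v f)%E.
  apply: lt_le_trans (lorentz_integral_ge_itv wv p0 mf r0 ler01 _).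
    by rewrite lte_fin mulr_gt0// powR_gt0.
  by move=> x x0 xr; rewrite /f indicE mem_set ?normr1//= in_itv/= x0.
by rewrite (Lambda_qnormE p0 dv Lf) f0 powR0 ?ltxx// gt_eqF.
Qed.

(** If the functional vanishes, the rearrangement vanishes on the half-line,
    because [v] has mass near the origin; hence [f] is null. *)
Lemma lorentz_integral_eq0 f : (forall r, 0 < r -> 0 < V r) ->
  measurable_fun setT f -> lorentz_integral p v f = 0%E <-> ae_zero leb f.
Proof.
move=> Vpos mf; split=> [f0|[N [mN N0 fN]]]; last first.
  apply: integral0_eq => t; rewrite /= in_itv/= andbT => t0.
  have -> : rearrangement f t = 0%E.
    apply/eqP; rewrite eq_le rearrangement_ge0// andbT.
    apply: rearrangement_le_superlevel; rewrite (@le_trans _ _ (leb N))//; last first.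
      by rewrite N0 lee_fin ltW.
    apply: le_measure; rewrite ?inE//; first exact: measurable_superlevel.
    move=> x /=; rewrite normr_gt0 => fx; apply: fN => /= fx0.
    by rewrite fx0 eqxx in fx.
  by rewrite poweR0r ?mul0e// gt_eqF.
have fle t : 0 < t -> (leb [set x | (0 < `|f x|)%R] <= t%:E)%E.
  move=> t0; rewrite leNgt; apply/negP => /(rearrangement_gt _ _ mf) ft.
  have [c c0 ct] : exists2 c : R, 0 < c & (c%:E <= rearrangement f t)%E.
    move: ft; case: (rearrangement f t) => [c| |]// c0; first by exists c.
    by exists 1 => //; rewrite leey.
  have : ((c `^ p * V t)%:E <= lorentz_integral p v f)%E.
    rewrite EFinM -primitiveE// -ge0_integralZl_EFin ?powR_ge0//; last 2 first.
    - by move=> x /=; rewrite in_itv/= lee_fin => /andP[/v0].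
    - by apply: measurable_density => //; exact: itv0_subset.
    apply: (@le_trans _ _ (\int[leb]_(t in `]0%R, t[) (rearrangement f t `^ p * (v t)%:E))%E).
      apply: ge0_le_integral => //.
      - move=> x /=; rewrite in_itv/= => /andP[x0 _].
        by rewrite mule_ge0 ?lee_fin ?powR_ge0// v0.
      - apply: measurable_funeM; apply: measurable_density => //; exact: itv0_subset.
      - by apply: measurable_lorentz_integrand => //; exact: itv0_subset.
      - move=> x /=; rewrite in_itv/= => /andP[x0 xt].
        rewrite lee_wpmul2r ?lee_fin ?v0// -poweR_EFin.
        apply: ge0_le_poweR; [exact: ltW|by rewrite lee_fin ltW|].
        by rewrite (le_trans ct)// rearrangement_nonincreasing// ltW.
    apply: ge0_subset_integral => //.
    - exact: measurable_lorentz_integrand.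
    - by move=> x /=; rewrite in_itv/= andbT => x0; rewrite mule_ge0 ?poweR_ge0// lee_fin v0.
    - exact: itv0_subset.
  by rewrite f0 lee_fin leNgt mulr_gt0 ?powR_gt0// Vpos.
have mS := measurable_superlevel 0 mf.
exists [set x | (0 < `|f x|)%R]; split => //; last first.
  by move=> x /= fx; rewrite normr_gt0; apply/eqP.
apply/eqP; rewrite eq_le measure_ge0 andbT; apply/lee_addgt0Pr => e e0.
by rewrite add0e fle.
Qed.

(** A quasi-triangle inequality for all measurable functions, with infinite
    values allowed, suffices: closure under sums follows from it. *)
Lemma Lambda_lattice :
  ~ {ae leb, forall x, 0 < x -> v x = 0} -> (forall r, 0 < r -> 0 < V r) ->
  (exists2 C : R, 0 < C & forall n (f_ : nat -> R -> R),
     (forall i, measurable_fun setT (f_ i)) ->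
     (lorentz_norm p v (fun x => \sum_(i < n) f_ i x)%R <=
        C%:E * \sum_(i < n) lorentz_norm p v (f_ i))%E) ->
  quasi_normed_function_lattice leb (Lambda p v) /\ finitely_subadditive (Lambda p v).
Proof.
move=> nv Vpos [C C0 CS].
have [mL qL0 LZ latL] := Lambda_homogeneous p0 dv.
have finL f : carrier (Lambda p v) f ->
    (lorentz_norm p v f = (qnorm (Lambda p v) f)%:E)%E.
  by case=> _ foo; rewrite fineK// ge0_fin_numE// lorentz_normE poweR_ge0.
have sumL n (f_ : nat -> R -> R) : (forall i, carrier (Lambda p v) (f_ i)) ->
    carrier (Lambda p v) (fun x => \sum_(i < n) f_ i x) /\
    qnorm (Lambda p v) (fun x => \sum_(i < n) f_ i x) <=
      C * \sum_(i < n) qnorm (Lambda p v) (f_ i).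
  move=> Lf; have := CS n f_ (fun i => mL _ (Lf i)).
  rewrite (eq_bigr (fun i : 'I_n => (qnorm (Lambda p v) (f_ i))%:E)); last first.
    by move=> i _; exact: finL.
  rewrite sumEFin -EFinM => le_sum.
  have Ls : carrier (Lambda p v) (fun x => \sum_(i < n) f_ i x).
    split; last exact: le_lt_trans le_sum (ltry _).
    by apply: measurable_sum => i; exact: mL.
  by split; [exact: Ls|rewrite -lee_fin -finL].
have [f0 Lf0 _] := Lambda_nontrivial nv.
have sum2 (c : nat -> R) : \sum_(i < 2) c i = c 0%N + c 1%N.
  by rewrite !big_ord_recl big_ord0 addr0.
have addL f g : carrier (Lambda p v) f -> carrier (Lambda p v) g ->
    carrier (Lambda p v) (fun x => f x + g x) /\
    qnorm (Lambda p v) (fun x => f x + g x) <=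
      C * (qnorm (Lambda p v) f + qnorm (Lambda p v) g).
  move=> Lf Lg; pose h (i : nat) := if i is 0%N then f else g.
  have Lh i : carrier (Lambda p v) (h i).
    by case: i => [|i]; [exact: Lf|exact: Lg].
  have hE : (fun x => \sum_(i < 2) h i x) = fun x => f x + g x.
    by apply/funext => x; rewrite !big_ord_recl big_ord0 addr0.
  have qhE : \sum_(i < 2) qnorm (Lambda p v) (h i) =
      qnorm (Lambda p v) f + qnorm (Lambda p v) g.
    exact: (sum2 (fun i => qnorm (Lambda p v) (h i))).
  by have := sumL 2%N h Lh; rewrite hE qhE.
split; last by exists C => // n f_ /(sumL n)[].
split.
- split.
  + have [+ _] := LZ 0 f0 Lf0; rewrite (_ : (fun _ => _) = fun=> 0)//.
    by apply/funext => x; rewrite mul0r.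
  + by move=> f g Lf Lg; have [] := addL f g Lf Lg.
  + by move=> c f Lf; have [] := LZ c f Lf.
- exact: mL.
- exists C; split.
  + exact: qL0.
  + move=> f Lf; rewrite -lorentz_integral_eq0//; last exact: mL.
    rewrite (Lambda_qnormE p0 dv Lf); split=> [->|[]].
      by rewrite powR0// gt_eqF.
    exact: powR_eq0_eq0.
  + by move=> c f Lf; have [] := LZ c f Lf.
  + by move=> f g Lf Lg; have [] := addL f g Lf Lg.
- exact: latL.
Qed.

End lorentz_lattice.

(** * Sufficiency of the B_p condition *)

Section Bp_growth.
Context {R : realType}.
Local Notation leb := (@lebesgue_measure R).
Variables (v : R -> R) (wv : weight v) (p : R) (p0 : 0 < p) (BpV : Bp p v).
Implicit Types (r : R).

Local Notation V := (primitive v).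
Let dv : nonneg_density v. Proof. exact: weight_density. Qed.
Let v0 x : 0 < x -> 0 <= v x. Proof. by case: wv => + _; exact. Qed.

(** The integral of v(x) / x^p over (r, oo), finite under B_p. *)
Definition tail_integral r : R := fine (\int[leb]_(x in `]r, +oo[) (v x / x `^ p)%:E)%E.
Local Notation Phi := tail_integral.

Let sub0 r (b : itv_bound R) : 0 < r -> [set` Interval (BRight r) b] `<=` `]0, +oo[.
Proof. by move=> r0 x /=; rewrite !in_itv/= => /andP[/(lt_trans r0) ->]. Qed.

Let g0 x : 0 < x -> (0 <= (v x / x `^ p)%:E)%E.
Proof. by move=> x0; rewrite lee_fin divr_ge0 ?powR_ge0// v0. Qed.

Lemma tail_integralE r : 0 < r ->
  (\int[leb]_(x in `]r, +oo[) (v x / x `^ p)%:E = (Phi r)%:E)%E.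
Proof.
move=> r0; rewrite fineK// ge0_fin_numE; last first.
  by apply: integral_ge0 => x /(sub0 r0); rewrite /= in_itv/= andbT => /g0.
have [C C0 /(_ r r0)] := BpV; rewrite primitiveE// -EFinM => CB.
rewrite ltey; apply/negP => /eqP E; move: CB; rewrite E gt0_muley ?lte_fin ?powR_gt0//.
Qed.

Lemma tail_integral_step r : 0 < r ->
  Phi (2 * r) + (V (2 * r) - V r) / (2 * r) `^ p <= Phi r.
Proof.
move=> r0; have r20 : 0 < 2 * r by rewrite mulr_gt0.
have r2r : r <= 2 * r by rewrite ler_peMl ?ler1n// ltW.
rewrite -lee_fin -tail_integralE//.
rewrite (_ : `]r, +oo[%classic = `]r, (2 * r)%R]%classic `|` `](2 * r)%R, +oo[%classic); last first.
  by rewrite -itv_bndbnd_setU// bnd_simp.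
rewrite ge0_integral_setU//; last 3 first.
- apply: (measurable_tail_integrand _ dv); first exact: measurableU.
  by move=> x [/(sub0 r0)|/(sub0 r20)].
- by move=> x [/(sub0 r0)|/(sub0 r20)]; rewrite /= in_itv/= andbT => /g0.
- apply/disj_setPS => x [/=]; rewrite !in_itv/= andbT => /andP[_ xN] Nx.
  by have := lt_le_trans Nx xN; rewrite ltxx.
rewrite EFinD addeC tail_integralE// leeD2r//.
have cp0 : 0 <= ((2 * r) `^ p)^-1 by rewrite invr_ge0 powR_ge0.
have VrE : (\int[leb]_(x in `]r, (2 * r)%R]) (v x)%:E = (V (2 * r) - V r)%:E)%E.
  have := primitiveE wv r20.
  rewrite integral_itv_bndo_bndc; last by apply: measurable_density => //; exact: itv0_subset.
  rewrite (_ : `]0%R, (2 * r)%R]%classic = `]0%R, r]%classic `|` `]r, (2 * r)%R]%classic); last first.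
    by rewrite -itv_bndbnd_setU// bnd_simp// ltW.
  rewrite ge0_integral_setU//; last 3 first.
  - apply: measurable_density => //; first exact: measurableU.
    by move=> x [|/(sub0 r0)//]; exact: itv0_subset.
  - move=> x [|/(sub0 r0)]; rewrite /= in_itv/= ?andbT lee_fin; last exact: v0.
    by move=> /andP[/v0].
  - apply/disj_setPS => x [/=]; rewrite !in_itv/= => /andP[_ xN] /andP[Nx _].
    by have := lt_le_trans Nx xN; rewrite ltxx.
  rewrite -(integral_itv_bndo_bndc (a := BRight 0)); last first.
    by apply: measurable_density => //; exact: itv0_subset.
  rewrite primitiveE// => h; rewrite EFinB -h addeAC subee ?add0e//.
rewrite mulrC EFinM -VrE -ge0_integralZl_EFin//; last 2 first.
- by move=> x /(sub0 r0); rewrite /= in_itv/= andbT lee_fin => /v0.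
- by apply: measurable_density => //; exact: sub0.
apply: ge0_le_integral => //.
- move=> x /(sub0 r0); rewrite /= in_itv/= andbT => x0.
  by rewrite lee_fin mulr_ge0// v0.
- by apply: measurable_funeM; apply: measurable_density => //; exact: sub0.
- by apply: (measurable_tail_integrand _ dv) => //; exact: sub0.
move=> x; rewrite /= in_itv/= => /andP[rx xr]; have x0 := lt_trans r0 rx.
rewrite lee_fin mulrC ler_wpM2l ?v0// lef_pV2 ?posrE ?powR_gt0//.
by apply: ge0_ler_powR; rewrite ?nnegrE ?(ltW p0) ?(ltW x0) ?(ltW r20).
Qed.

(** Self-improvement of B_p: the quantity S(r) = V(r) / r^p plus the tail
    integral, comparable to V(r) / r^p by B_p, is multiplied by at most a factor
    th < 1 when r doubles. *)
Lemma Bp_doubling_growth : exists K th : R, [/\ 0 < K, 0 < th, th < 1 &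
  forall r j, 0 < r -> V (2 ^+ j * r) <= K * th ^+ j * (2 ^+ j) `^ p * V r].
Proof.
have [C C0 BC] := BpV.
have PhiC r : 0 < r -> Phi r <= C * (V r / r `^ p).
  move=> r0; have := BC r r0; rewrite primitiveE// tail_integralE// -!EFinM lee_fin.
  by rewrite mulrA ler_pdivlMr ?powR_gt0// mulrC.
pose S r := V r / r `^ p + Phi r.
have Phi0 r : 0 < r -> 0 <= Phi r.
  move=> r0; rewrite fine_ge0//.
  by apply: integral_ge0 => x /(sub0 r0); rewrite /= in_itv/= andbT => /g0.
(* S(2 r) + c V(r) / r^p <= S(r) by splitting the tail at 2 r, and S(r) is at
   most (1 + C) V(r) / r^p by B_p *)
pose c := 1 - (2 `^ p)^-1.
have twop : 1 < 2 `^ p :> R.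
  rewrite -[ltLHS](congr1 (@^~ p) (powR1 R)); apply: gt0_ltr_powR; rewrite ?nnegrE//.
  by rewrite ltr1n.
have c0 : 0 < c by rewrite subr_gt0 invf_lt1// (lt_trans _ twop).
have c1 : c < 1 by rewrite gtrBl invr_gt0 (lt_trans _ twop).
pose th := 1 - c / (1 + C).
have C1 : 0 < 1 + C by rewrite addr_gt0.
have th1 : th < 1 by rewrite gtrBl divr_gt0.
have th0 : 0 < th by rewrite subr_gt0 ltr_pdivrMr// mul1r (lt_le_trans c1)// lerDl ltW.
have SC r : 0 < r -> S r <= (1 + C) * (V r / r `^ p).
  by move=> r0; rewrite /S mulrDl mul1r lerD2l PhiC.
have S2 r : 0 < r -> S (2 * r) <= th * S r.
  move=> r0; have st := tail_integral_step r0.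
  have E2 : (2 * r) `^ p = 2 `^ p * r `^ p by rewrite powRM// ltW.
  have rp : 0 < r `^ p by rewrite powR_gt0.
  have SP : S (2 * r) + c * (V r / r `^ p) <= S r.
    rewrite /S (le_trans _ (lerD (lexx (V r / r `^ p)) st))//.
    rewrite le_eqVlt; apply/orP; left; apply/eqP; rewrite E2 /c; field.
    by rewrite !gt_eqF// (lt_trans _ twop).
  rewrite /th mulrBl mul1r lerBrDr (le_trans _ SP)// lerD2l.
  by rewrite -mulrA ler_pM2l// mulrC ler_pdivrMr// [leRHS]mulrC SC.
have Sj r j : 0 < r -> S (2 ^+ j * r) <= th ^+ j * S r.
  move=> r0; elim: j => [|j IHj]; first by rewrite !expr0 !mul1r.
  rewrite !exprS -!mulrA (le_trans (S2 _ _)) ?mulr_gt0 ?exprn_gt0//.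
  by rewrite ler_pM2l.
exists (1 + C), th; split => // r j r0.
have jr0 : 0 < 2 ^+ j * r by rewrite mulr_gt0// exprn_gt0.
have rp : 0 < r `^ p by rewrite powR_gt0.
have : V (2 ^+ j * r) / (2 ^+ j * r) `^ p <= th ^+ j * ((1 + C) * (V r / r `^ p)).
  rewrite (@le_trans _ _ (S (2 ^+ j * r)))//; first by rewrite lerDl Phi0.
  by rewrite (le_trans (Sj _ j r0))// ler_pM2l ?exprn_gt0// SC.
rewrite ler_pdivrMr ?powR_gt0// powRM ?exprn_ge0// ?(ltW r0)// => /le_trans; apply.
rewrite le_eqVlt; apply/orP; left; apply/eqP; field.
by rewrite gt_eqF.
Qed.

Lemma Bp_primitive_gt0 : ~ {ae leb, forall x, 0 < x -> v x = 0} ->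
  forall r, 0 < r -> 0 < V r.
Proof.
move=> nv; apply: (primitive_gt0_doubling wv) => // r r0 Vr j.
have [K [th [_ _ _ /(_ r j r0)]]] := Bp_doubling_growth.
by rewrite Vr mulr0 => h; apply/eqP; rewrite eq_le h (primitive_ge0 wv).
Qed.

End Bp_growth.

Section weighted_minkowski.
Context {R : realType}.
Local Notation leb := (@lebesgue_measure R).
Variables (p : R) (p1 : 1 <= p).
Local Open Scope ereal_scope.

Let p0 : (0 < p)%R. Proof. exact: lt_le_trans p1. Qed.

(** Convexity of the p-th power at the points x / a and y / b with weights a
    and b. *)
Lemma powR_convex_split (a b x y : R) : (0 < a)%R -> (0 < b)%R -> (a + b = 1)%R ->
  (0 <= x)%R -> (0 <= y)%R ->
  ((x + y) `^ p <= a `^ (1 - p) * x `^ p + b `^ (1 - p) * y `^ p)%R.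
Proof.
move=> a0 b0 ab x0 y0.
have a_ge0 := ltW a0; have a_le1 : (a <= 1)%R by rewrite -ab lerDl ltW.
have bE : (1 - a)%R = b by rewrite -ab addrAC subrr add0r.
have ax (c z : R) : (0 < c)%R -> (0 <= z)%R -> (c * (c^-1 * z) `^ p = c `^ (1 - p) * z `^ p)%R.
  move=> c0 z0; rewrite powRM// ?invr_ge0 ?(ltW c0)// mulrA; congr (_ * _)%R.
  rewrite powRB; last by rewrite (gt_eqF c0) implybT.
  by rewrite powRr1 ?(ltW c0)// -powR_inv1 ?(ltW c0)// -powRrM mulN1r powRN.
have ha0 : (0 <= a^-1 * x)%R by rewrite mulr_ge0// invr_ge0 ltW.
have hb0 : (0 <= b^-1 * y)%R by rewrite mulr_ge0// invr_ge0 ltW.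
have := @convex_powR R p p1 (Itv01 a_ge0 a_le1) (a^-1 * x)%R (b^-1 * y)%R.
rewrite !inE/= !in_itv/= !andbT => /(_ ha0 hb0).
rewrite !convRE/= /mathcomp.classical.unstable.onem bE ax// ax//.
set c := conv _ _ _; have -> // : c = (x + y)%R.
transitivity (a * (a^-1 * x) + (1 - a) * (b^-1 * y))%R => //.
by rewrite bE mulrA mulfV ?gt_eqF// mul1r mulrA mulfV ?gt_eqF// mul1r.
Qed.

Lemma poweR_convex_split (a b : R) (x y : \bar R) : (0 < a)%R -> (0 < b)%R ->
  (a + b = 1)%R -> 0 <= x -> 0 <= y ->
  (x + y) `^ p <= (a `^ (1 - p))%:E * x `^ p + (b `^ (1 - p))%:E * y `^ p.
Proof.
move=> a0 b0 ab; have pn0 : p != 0%R by rewrite gt_eqF.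
have ap : 0 < (a `^ (1 - p))%:E :> \bar R by rewrite lte_fin powR_gt0.
have bp : 0 < (b `^ (1 - p))%:E :> \bar R by rewrite lte_fin powR_gt0.
case: x => [x| |]//; case: y => [y| |]// x0 y0.
- by rewrite -EFinD !poweR_EFin -!EFinM -EFinD lee_fin powR_convex_split.
- rewrite [in leRHS]poweRyr// (gt0_muley bp) addey ?leey//.
- rewrite [in leRHS]poweRyr// (gt0_muley ap) addye ?leey//.
- by rewrite poweRyr// (gt0_muley ap) (gt0_muley bp) leey.
Qed.

Variables (v : R -> R) (dv : nonneg_density v).

(** The p-th power of the norm of [G] in L^p((0, oo), v dt). *)
Definition weighted_power_integral (G : R -> \bar R) : \bar R :=
  \int[leb]_(t in `]0%R, +oo[) (G t `^ p * (v t)%:E).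
Local Notation I := weighted_power_integral.

Let v0 x : (0 < x)%R -> (0 <= v x)%R. Proof. by case: dv => + _; exact. Qed.

Lemma measurable_weighted_power G : measurable_fun (`]0%R, +oo[%classic : set R) G ->
  measurable_fun (`]0%R, +oo[%classic : set R) (fun t => G t `^ p * (v t)%:E).
Proof.
move=> mG; apply: emeasurable_funM; last exact: measurable_density.
exact: (measurableT_comp (measurable_poweR p)).
Qed.

Lemma weighted_power_ge0 G t : (0 < t)%R -> 0 <= G t `^ p * (v t)%:E.
Proof. by move=> t0; rewrite mule_ge0 ?poweR_ge0// lee_fin v0. Qed.

Lemma weighted_power_integral_ge0 G : 0 <= I G.
Proof.
by apply: integral_ge0 => t /=; rewrite in_itv/= andbT; exact: weighted_power_ge0.
Qed.

Lemma le_weighted_power_integral G H :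
  measurable_fun (`]0%R, +oo[%classic : set R) G ->
  measurable_fun (`]0%R, +oo[%classic : set R) H ->
  (forall t, (0 < t)%R -> 0 <= G t /\ G t <= H t) -> I G <= I H.
Proof.
move=> mG mH GH; apply: ge0_le_integral => //.
- by move=> t /=; rewrite in_itv/= andbT; exact: weighted_power_ge0.
- exact: measurable_weighted_power.
- exact: measurable_weighted_power.
- move=> t /=; rewrite in_itv/= andbT => t0; have [G0 GHt] := GH t t0.
  by rewrite lee_wpmul2r ?lee_fin ?v0// ge0_le_poweR// ltW.
Qed.

(** Minkowski's inequality for bounds A and B on the two norms; the weights
    A / (A + B) and B / (A + B) are optimal in [powR_convex_split]. *)
Lemma weighted_power_integralD_le (G H : R -> \bar R) (A B : R) :
  measurable_fun (`]0%R, +oo[%classic : set R) G ->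
  measurable_fun (`]0%R, +oo[%classic : set R) H ->
  (forall t, (0 < t)%R -> 0 <= G t) -> (forall t, (0 < t)%R -> 0 <= H t) ->
  (0 < A)%R -> (0 < B)%R ->
  I G <= (A `^ p)%:E -> I H <= (B `^ p)%:E -> I (G \+ H) <= ((A + B) `^ p)%:E.
Proof.
move=> mG mH G0 H0 A0 B0 IG IH; have AB0 : (0 < A + B)%R by rewrite addr_gt0.
pose a := (A / (A + B))%R; pose b := (B / (A + B))%R.
have a0 : (0 < a)%R by rewrite divr_gt0.
have b0 : (0 < b)%R by rewrite divr_gt0.
have ab : (a + b = 1)%R by rewrite /a /b -mulrDl mulfV// gt_eqF.
have part (c : R) : (0 < c)%R ->
    ((c / (A + B)) `^ (1 - p) * c `^ p = c * (A + B) `^ (p - 1))%R.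
  move=> c0; rewrite powRM ?invr_ge0 ?ltW// -powR_inv1 ?ltW// -powRrM mulN1r opprB.
  rewrite mulrAC -powRD; last by rewrite (gt_eqF c0) implybT.
  by rewrite subrK powRr1// ltW.
have mGp := measurable_weighted_power mG; have mHp := measurable_weighted_power mH.
apply: (@le_trans _ _ ((a `^ (1 - p))%:E * I G + (b `^ (1 - p))%:E * I H)); last first.
  apply: (@le_trans _ _ ((a `^ (1 - p))%:E * (A `^ p)%:E + (b `^ (1 - p))%:E * (B `^ p)%:E)).
    by apply: leeD; apply: lee_wpmul2l => //; rewrite lee_fin powR_ge0.
  rewrite -!EFinM -EFinD lee_fin !part// -mulrDl.
  by rewrite mulr_powRB1// ltW.
rewrite -!ge0_integralZl_EFin ?powR_ge0//; try (by move=> t /=; rewrite in_itv/= andbT; exact: weighted_power_ge0).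
rewrite -ge0_integralD//; last 4 first.
- by move=> t /=; rewrite in_itv/= andbT => t0; rewrite mule_ge0 ?weighted_power_ge0// lee_fin powR_ge0.
- exact: measurable_funeM.
- by move=> t /=; rewrite in_itv/= andbT => t0; rewrite mule_ge0 ?weighted_power_ge0// lee_fin powR_ge0.
- exact: measurable_funeM.
apply: ge0_le_integral => //.
- by move=> t /=; rewrite in_itv/= andbT; exact: (@weighted_power_ge0 (G \+ H)).
- by apply: measurable_weighted_power; exact: emeasurable_funD.
- by apply: emeasurable_funD; exact: measurable_funeM.
move=> t; rewrite /= in_itv/= andbT => t0; rewrite !muleA.
rewrite -ge0_muleDl ?mule_ge0 ?poweR_ge0 ?lee_fin ?powR_ge0//.
rewrite lee_wpmul2r ?lee_fin ?v0//.
by apply: poweR_convex_split; [| | |exact: G0|exact: H0].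
Qed.

Lemma poweR_root_eq (x : \bar R) (n : R) : 0 <= x -> x `^ p^-1 = n%:E -> x = (n `^ p)%:E.
Proof.
move=> x0 xn; have -> : x = (x `^ p^-1) `^ p.
  by rewrite -poweRrM mulVf ?gt_eqF// poweRe1.
by rewrite xn poweR_EFin.
Qed.

Lemma poweR_root_le (x : \bar R) (n : R) : (0 <= n)%R -> 0 <= x -> x <= (n `^ p)%:E ->
  x `^ p^-1 <= n%:E.
Proof.
move=> n0 x0 xn; apply: (le_trans (ge0_le_poweR _ x0 xn)).
  by rewrite invr_ge0 ltW.
by rewrite poweR_EFin -powRrM mulfV ?gt_eqF// powRr1.
Qed.

Lemma weighted_minkowski (G H : R -> \bar R) :
  measurable_fun (`]0%R, +oo[%classic : set R) G ->
  measurable_fun (`]0%R, +oo[%classic : set R) H ->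
  (forall t, (0 < t)%R -> 0 <= G t) -> (forall t, (0 < t)%R -> 0 <= H t) ->
  I (G \+ H) `^ p^-1 <= I G `^ p^-1 + I H `^ p^-1.
Proof.
move=> mG mH G0 H0; have IG0 := weighted_power_integral_ge0 G.
have IH0 := weighted_power_integral_ge0 H.
case GE : (I G `^ p^-1) (poweR_ge0 (I G) p^-1) => [A| |]//; last first.
  by move=> _; rewrite addye ?leey// gt_eqF// (@lt_le_trans _ _ 0)// poweR_ge0.
case HE : (I H `^ p^-1) (poweR_ge0 (I H) p^-1) => [B| |]//; last first.
  by move=> _ _; rewrite addey ?leey.
rewrite !lee_fin => B0 A0; rewrite -EFinD; apply/lee_addgt0Pr => e e0.
(* the norms may vanish, so both bounds are enlarged by e / 2 *)
have e20 : (0 < e / 2)%R by rewrite divr_gt0.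
have Ae : (0 < A + e / 2)%R by rewrite ltr_pwDr.
have Be : (0 < B + e / 2)%R by rewrite ltr_pwDr.
rewrite -EFinD (_ : (A + B + e = (A + e / 2) + (B + e / 2))%R); last by field.
apply: poweR_root_le; [by rewrite addr_ge0 ?ltW|exact: weighted_power_integral_ge0|].
apply: weighted_power_integralD_le => //.
  rewrite (poweR_root_eq IG0 GE) lee_fin.
  apply: ge0_ler_powR; [exact: ltW|by rewrite nnegrE|by rewrite nnegrE ltW|].
  by rewrite lerDl ltW.
rewrite (poweR_root_eq IH0 HE) lee_fin.
apply: ge0_ler_powR; [exact: ltW|by rewrite nnegrE|by rewrite nnegrE ltW|].
by rewrite lerDl ltW.
Qed.

End weighted_minkowski.

Section maximal_rearrangement.
Context {R : realType}.
Local Notation leb := (@lebesgue_measure R).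
Local Open Scope ereal_scope.
Implicit Types (f g : R -> R) (t : R).

(** The average of the rearrangement over (0, t). *)
Definition maximal_rearrangement f t : \bar R :=
  (t^-1)%:E * rearrangement_integral f t.
Local Notation M := maximal_rearrangement.

Lemma measurable_maximal_rearrangement f : measurable_fun setT f ->
  measurable_fun (`]0%R, +oo[%classic : set R) (M f).
Proof.
move=> mf; apply: emeasurable_funM.
  apply: nonincreasing_emeasurable; first exact: interval_is_interval.
  move=> x y; rewrite !inE/= !in_itv/= !andbT => x0 y0 xy.
  by rewrite lee_fin lef_pV2.
apply: nondecreasing_emeasurable; first exact: interval_is_interval.
move=> x y; rewrite !inE/= !in_itv/= !andbT => x0 y0 xy.
apply: ge0_subset_integral => //.
- exact: measurable_rearrangement.
- by move=> s _; exact: rearrangement_ge0.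
- by move=> s /=; rewrite !in_itv/= => /andP[-> /lt_le_trans ->].
Qed.

Lemma maximal_rearrangement_ge0 f t : measurable_fun setT f -> (0 < t)%R -> 0 <= M f t.
Proof.
by move=> mf t0; rewrite mule_ge0 ?rearrangement_integral_ge0// lee_fin invr_ge0 ltW.
Qed.

Lemma rearrangement_le_maximal f t : measurable_fun setT f -> (0 < t)%R ->
  rearrangement f t <= M f t.
Proof.
move=> mf t0; rewrite /M -lee_pdivrMl ?invr_gt0// invrK muleC.
rewrite -(integral_cst_initial _ t0); apply: ge0_le_integral => //.
- by move=> s _; exact: rearrangement_ge0.
- exact: measurable_rearrangement.
- by move=> s /=; rewrite in_itv/= => /andP[_ /ltW]; exact: rearrangement_nonincreasing.
Qed.

Lemma maximal_rearrangementD f g t : measurable_fun setT f -> measurable_fun setT g ->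
  (0 < t)%R -> M (fun x => f x + g x)%R t <= M f t + M g t.
Proof.
move=> mf mg t0; rewrite /M -ge0_muleDr ?rearrangement_integral_ge0//.
apply: lee_wpmul2l; first by rewrite lee_fin invr_ge0 ltW.
exact: rearrangement_integralD.
Qed.

Lemma maximal_rearrangement_cst0 t : (0 < t)%R -> M (fun=> 0%R) t = 0.
Proof.
move=> t0; rewrite /M /rearrangement_integral integral0_eq ?mule0// => s /=.
rewrite in_itv/= => /andP[s0 _].
have := @rearrangementZ _ 0%R (fun=> 0%R) s (measurable_cst _) s0.
by rewrite normr0 mul0e; under eq_fun do rewrite mul0r.
Qed.

(** Bounds on the rearrangement at the points t / 2^(j+1), summed over the
    dyadic pieces of (0, t). *)
Lemma rearrangement_dyadic_integral_le f t (B b : R) J :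
  (0 < t)%R -> (0 <= b)%R -> (0 <= B)%R -> measurable_fun setT f ->
  (forall j, rearrangement f (t / 2 ^+ j.+1) <= ((2 * b) ^+ j * B)%:E) ->
  \int[leb]_(s in `](t / 2 ^+ J)%R, t]) rearrangement f s <=
  (t / 2 * B * \sum_(j < J) b ^+ j)%:E.
Proof.
move=> t0 b0 B0 mf fj; elim: J => [|J IHJ].
  by rewrite expr0 divr1 set_itvoc0 integral_set0 big_ord0 mulr0.
have pJ : (0 < 2 ^+ J :> R)%R by rewrite exprn_gt0.
have lJ : (t / 2 ^+ J.+1 <= t / 2 ^+ J)%R.
  rewrite ler_pM2l// lef_pV2 ?posrE ?exprn_gt0//.
  by rewrite exprS ler_peMl ?ler1n// ltW.
have Jt : (t / 2 ^+ J <= t)%R by rewrite ler_pdivrMr// ler_peMr ?(ltW t0)// exprn_ege1// ler1n.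
rewrite (_ : `](t / 2 ^+ J.+1)%R, t]%classic =
  `](t / 2 ^+ J.+1)%R, (t / 2 ^+ J)%R]%classic `|` `](t / 2 ^+ J)%R, t]%classic); last first.
  by rewrite -itv_bndbnd_setU// bnd_simp.
rewrite ge0_integral_setU//; last 3 first.
- by apply: measurable_rearrangement; exact: measurableU.
- by move=> x _; exact: rearrangement_ge0.
- apply/disj_setPS => x [/=]; rewrite !in_itv/= => /andP[_ xN] /andP[Nx _].
  by have := lt_le_trans Nx xN; rewrite ltxx.
rewrite big_ord_recr/= mulrDr EFinD [leRHS]addeC; apply: leeD; last exact: IHJ.
apply: (@le_trans _ _ (\int[leb]_(s in `](t / 2 ^+ J.+1)%R, (t / 2 ^+ J)%R])
    (cst ((2 * b) ^+ J * B)%:E s))).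
  apply: ge0_le_integral => //.
  - by move=> s _; exact: rearrangement_ge0.
  - exact: measurable_rearrangement.
  - move=> s /=; rewrite in_itv/= => /andP[/ltW ts _].
    by apply: (le_trans _ (fj J)); exact: rearrangement_nonincreasing.
rewrite integral_cst//.
have lebE : leb `](t / 2 ^+ J.+1)%R, (t / 2 ^+ J)%R]%classic = (t / 2 ^+ J / 2)%:E.
  rewrite lebesgue_measure_itv/= lte_fin.
  rewrite ltr_pM2l// ltf_pV2 ?posrE ?exprn_gt0// exprS ltr_pMl// ltr1n.
  rewrite -EFinB; congr EFin; field.
  by rewrite gt_eqF.
rewrite [X in _ * X <= _]lebE.
rewrite -EFinM lee_fin exprMn le_eqVlt; apply/orP; left; apply/eqP; field.
by rewrite gt_eqF.
Qed.

End maximal_rearrangement.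

Lemma powR_expr {R : realType} (x : R) n (q : R) : 0 <= x -> (x ^+ n) `^ q = (x `^ q) ^+ n.
Proof. by move=> x0; rewrite -!powR_mulrn ?powR_ge0// powRAC. Qed.

Lemma geometric_sum_le {R : realFieldType} (x : R) n : 0 <= x -> x < 1 -> \sum_(j < n) x ^+ j <= (1 - x)^-1.
Proof.
move=> x0 x1; have d : 0 < 1 - x by rewrite subr_gt0.
have -> : \sum_(j < n) x ^+ j = (1 - x ^+ n) / (1 - x).
  elim: n => [|n IHn]; first by rewrite big_ord0 expr0 subrr mul0r.
  by rewrite big_ord_recr/= IHn exprS; field; rewrite gt_eqF.
by rewrite ler_pdivrMr// mulVf ?gt_eqF// gerBl exprn_ge0.
Qed.

Section hardy.
Context {R : realType}.
Local Notation leb := (@lebesgue_measure R).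
Variables (v : R -> R) (wv : weight v) (p : R) (p1 : 1 <= p).
Variables (K gam : R) (K0 : 0 < K) (gam0 : 0 < gam) (gam1 : gam < 1).
Hypothesis growth : forall r j, 0 < r ->
  primitive v (2 ^+ j * r) <= K * (gam ^+ 2) ^+ j * (2 ^+ j) `^ p * primitive v r.
Implicit Types (f : R -> R) (t : R).

Let p0 : 0 < p. Proof. exact: lt_le_trans p1. Qed.
Let dv : nonneg_density v. Proof. exact: weight_density. Qed.
Let v0 x : 0 < x -> 0 <= v x. Proof. by case: wv => + _; exact. Qed.

Let b := gam `^ p^-1.

Let b0 : 0 < b. Proof. exact: powR_gt0. Qed.

Let bp : b `^ p = gam.
Proof. by rewrite -powRrM mulVf ?gt_eqF// powRr1// ltW. Qed.

Let b1 : b < 1.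
Proof.
have := @gt0_ltr_powR R p^-1; rewrite invr_gt0 => /(_ p0 gam 1).
by rewrite !nnegrE (ltW gam0) ler01 powR1 => /(_ isT isT gam1).
Qed.

Let w j : R := (((2 * b) ^+ j) `^ p)^-1.

Let w0 j : 0 < w j.
Proof. by rewrite invr_gt0 powR_gt0// exprn_gt0// mulr_gt0. Qed.

(** A weighted series of p-th powers of the dilates of the rearrangement. The
    weights (2 b)^(-j p) leave a factor b^j on the j-th dyadic piece of (0, t), so
    the average over (0, t) is controlled. *)
Definition dilation_series f t : \bar R :=
  (\sum_(0 <= j <oo) (w j)%:E * rearrangement f (t / 2 ^+ j.+1) `^ p)%E.
Local Notation S := dilation_series.

Lemma dilation_series_ge0 f t : (0 <= S f t)%E.
Proof. by apply: nneseries_ge0 => j _ _; rewrite mule_ge0 ?poweR_ge0// lee_fin ltW. Qed.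

Let c : R := (2 * (1 - b))^-1.

Let c0 : 0 < c. Proof. by rewrite invr_gt0 mulr_gt0// subr_gt0. Qed.

(** Every term of the series is at most its sum s, so the rearrangement at
    t / 2^(j+1) is at most (2 b)^j s^(1/p); the integral over (0, t) is then a
    geometric series of ratio b. *)
Lemma maximal_rearrangement_le_series f t : measurable_fun setT f -> 0 < t ->
  (maximal_rearrangement f t `^ p <= (c `^ p)%:E * S f t)%E.
Proof.
move=> mf t0.
have term_le j : ((w j)%:E * rearrangement f (t / 2 ^+ j.+1) `^ p <= S f t)%E.
  have t_ge0 i : (0 <= (w i)%:E * rearrangement f (t / 2 ^+ i.+1) `^ p)%E.
    by rewrite mule_ge0 ?poweR_ge0// lee_fin ltW.
  apply: (@le_trans _ _ (\sum_(0 <= i < j.+1) (w i)%:E * rearrangement f (t / 2 ^+ i.+1) `^ p)%E).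
    by rewrite big_nat_recr//= leeDr// sume_ge0.
  by apply: nneseries_lim_ge.
case SE : (S f t) (dilation_series_ge0 f t) => [s| |]//; last first.
  by move=> _; rewrite gt0_muley ?leey// lte_fin powR_gt0.
rewrite lee_fin => s0; pose B := s `^ p^-1.
have B0 : 0 <= B by exact: powR_ge0.
have BpE : B `^ p = s by rewrite -powRrM mulVf ?gt_eqF// powRr1.
have fj j : (rearrangement f (t / 2 ^+ j.+1) <= ((2 * b) ^+ j * B)%:E)%E.
  have y0 : 0 <= (2 * b) ^+ j * B by rewrite mulr_ge0// exprn_ge0// mulr_ge0// ltW.
  rewrite leNgt; apply/negP => yf.
  have : ((((2 * b) ^+ j * B) `^ p)%:E < rearrangement f (t / 2 ^+ j.+1) `^ p)%E.
    rewrite lt_poweR_root ?powR_ge0 ?rearrangement_ge0//.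
    by rewrite -powRrM mulfV ?gt_eqF// powRr1.
  rewrite powRM// ?exprn_ge0 ?mulr_ge0 ?(ltW b0)// BpE.
  have pos : 0 < ((2 * b) ^+ j) `^ p by rewrite powR_gt0// exprn_gt0// mulr_gt0.
  by have := term_le j; rewrite SE lee_pdivrMl// -EFinM leNgt => /negbTE ->.
have bsum J : \sum_(j < J) b ^+ j <= (1 - b)^-1 by apply: geometric_sum_le => //; exact: ltW.
have db : 0 < 1 - b by rewrite subr_gt0.
have cover : \bigcup_J `](t / 2 ^+ J)%R, t]%classic = `]0, t]%classic :> set R.
  apply/seteqP; split => [x [J _]|x]; rewrite /= !in_itv/=.
    move=> /andP[tx ->]; rewrite andbT (lt_trans _ tx)// divr_gt0// exprn_gt0//.
  move=> /andP[x0 xt]; exists (Num.truncn (t / x)).+1 => //=; rewrite in_itv/= xt andbT.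
  rewrite ltr_pdivrMr ?exprn_gt0// mulrC -ltr_pdivrMr//.
  rewrite (lt_le_trans (truncnS_gt _))// -natrX ler_nat.
  by rewrite ltnW// ltn_expl.
have Ft : (rearrangement_integral f t <= (t / 2 * B * (1 - b)^-1)%:E)%E.
  apply: (@le_trans _ _ (\int[leb]_(s in `]0%R, t]) rearrangement f s)%E).
    apply: ge0_subset_integral => //.
    - exact: measurable_rearrangement.
    - by move=> x _; exact: rearrangement_ge0.
    - by move=> x /=; rewrite !in_itv/= => /andP[-> /ltW ->].
  rewrite -cover; apply: le_integral_exhaustion => //.
  - apply/nondecreasing_seqP => J; apply/subsetPset => x; rewrite /= !in_itv/=.
    move=> /andP[tx ->]; rewrite andbT; apply: le_lt_trans tx.
    rewrite ler_pM2l// lef_pV2 ?posrE ?exprn_gt0// exprS ler_peMl ?exprn_ge0//.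
    by rewrite ler1n.
  - by rewrite cover; exact: measurable_rearrangement.
  - by move=> x _; exact: rearrangement_ge0.
  move=> J; apply: (le_trans (rearrangement_dyadic_integral_le J t0 (ltW b0) B0 mf fj)).
  by rewrite lee_fin ler_wpM2l// mulr_ge0// divr_ge0// ltW.
have Mt : (maximal_rearrangement f t <= (c * B)%:E)%E.
  rewrite lee_pdivrMl// (le_trans Ft)// -EFinM lee_fin le_eqVlt; apply/orP; left.
  by apply/eqP; rewrite /c; field; rewrite gt_eqF.
apply: (le_trans (ge0_le_poweR (ltW p0) (maximal_rearrangement_ge0 mf t0) Mt)).
by rewrite poweR_EFin powRM ?(ltW c0)// BpE -EFinM.
Qed.

Let C : R := c `^ p * (K * gam ^+ 2 * 2 `^ p / (1 - gam)).

(** Integrating the series term by term, the j-th dilate costs the growth of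
    the primitive, K gam^(2 (j+1)) 2^((j+1) p), against the weight
    2^(-j p) gam^(-j): a geometric series of ratio gam. *)
Lemma hardy_inequality f : measurable_fun setT f ->
  (weighted_power_integral p v (maximal_rearrangement f) <=
     C%:E * lorentz_integral p v f)%E.
Proof.
move=> mf; have I0 := lorentz_integral_ge0 p f dv.
have mterm j : measurable_fun (`]0, +oo[%classic : set R)
    (fun t => (w j)%:E * (rearrangement f (t / 2 ^+ j.+1) `^ p * (v t)%:E))%E.
  apply: measurable_funeM; apply: measurable_weighted_power => //.
  apply: nonincreasing_emeasurable; first exact: interval_is_interval.
  move=> x y _ _ xy; apply: rearrangement_nonincreasing.
  by rewrite ler_pM2r// invr_gt0 exprn_gt0.
have term0 j t : 0 < t ->
    (0 <= (w j)%:E * (rearrangement f (t / 2 ^+ j.+1) `^ p * (v t)%:E))%E.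
  by move=> t0; rewrite !mule_ge0 ?poweR_ge0// lee_fin ?v0// ltW.
have cp0 : 0 <= c `^ p by exact: powR_ge0.
pose G t : \bar R := (\sum_(0 <= j <oo)
  (w j)%:E * (rearrangement f (t / 2 ^+ j.+1) `^ p * (v t)%:E))%E.
have mG : measurable_fun (`]0, +oo[%classic : set R) G.
  apply: ge0_emeasurable_sum => [j t|j _]; last exact: mterm.
  by rewrite /= in_itv/= andbT => t0 _; exact: term0.
have G0 t : 0 < t -> (0 <= G t)%E.
  by move=> t0; apply: nneseries_ge0 => j _ _; exact: term0.
apply: (@le_trans _ _ (\int[leb]_(t in `]0%R, +oo[) ((c `^ p)%:E * G t))%E).
  apply: ge0_le_integral => //.
  - move=> t /=; rewrite in_itv/= andbT => t0; exact: weighted_power_ge0.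
  - by apply: measurable_weighted_power => //; exact: measurable_maximal_rearrangement.
  - exact: measurable_funeM.
  move=> t /=; rewrite in_itv/= andbT => t0.
  apply: (@le_trans _ _ ((c `^ p)%:E * S f t * (v t)%:E)%E).
    by apply: lee_wpmul2r; rewrite ?lee_fin ?v0//; exact: maximal_rearrangement_le_series.
  rewrite -muleA; apply: lee_wpmul2l; first by rewrite lee_fin.
  rewrite muleC /S /dilation_series -nneseriesZl; last first.
    by move=> j _; rewrite mule_ge0 ?poweR_ge0// lee_fin ltW.
  by apply: lee_nneseries => [j _ _|j _]; rewrite muleCA [X in (_ * X)%E]muleC// term0.
rewrite ge0_integralZl_EFin//; last by move=> t /=; rewrite in_itv/= andbT; exact: G0.
rewrite /C EFinM -muleA; apply: lee_wpmul2l; first by rewrite lee_fin.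
rewrite integral_nneseries//; last first.
  by move=> j t /=; rewrite in_itv/= andbT; exact: term0.
have piece j : (\int[leb]_(t in `]0%R, +oo[)
    ((w j)%:E * (rearrangement f (t / 2 ^+ j.+1) `^ p * (v t)%:E)) <=
    (K * gam ^+ 2 * 2 `^ p * gam ^+ j)%:E * lorentz_integral p v f)%E.
  have D0 : 0 <= K * (gam ^+ 2) ^+ j.+1 * (2 ^+ j.+1) `^ p.
    by rewrite mulr_ge0 ?powR_ge0// mulr_ge0 ?exprn_ge0// ltW.
  rewrite ge0_integralZl_EFin ?(ltW (w0 j))//; last 2 first.
  - by move=> t /=; rewrite in_itv/= andbT => t0; rewrite mule_ge0 ?poweR_ge0// lee_fin v0.
  - apply: measurable_weighted_power => //.
    apply: nonincreasing_emeasurable; first exact: interval_is_interval.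
    move=> x y _ _ xy; apply: rearrangement_nonincreasing.
    by rewrite ler_pM2r// invr_gt0 exprn_gt0.
  apply: (@le_trans _ _ ((w j)%:E * ((K * (gam ^+ 2) ^+ j.+1 * (2 ^+ j.+1) `^ p)%:E * lorentz_integral p v f))%E).
    apply: lee_wpmul2l; first by rewrite lee_fin ltW.
    apply: le_dilated_lorentz_integral => //.
    by move=> r r0; rewrite !primitiveE ?mulr_gt0 ?exprn_gt0// -EFinM lee_fin growth.
  rewrite muleA -EFinM; apply: lee_wpmul2r => //; rewrite lee_fin.
  have E2 : ((2 * b) ^+ j) `^ p = (2 `^ p) ^+ j * gam ^+ j.
    rewrite exprMn powRM ?exprn_ge0// ?(ltW b0)// !powR_expr// ?(ltW b0)//.
    by rewrite bp.
  rewrite le_eqVlt; apply/orP; left; apply/eqP; rewrite /w E2 powR_expr// 2!(exprS _ j) (exprAC gam 2 j); field.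
  by rewrite !expf_neq0// gt_eqF// powR_gt0.
apply: (@le_trans _ _ (\sum_(0 <= j <oo) ((K * gam ^+ 2 * 2 `^ p * gam ^+ j)%:E * lorentz_integral p v f))%E).
  apply: lee_nneseries => [j _ _|j _]; last exact: piece.
  by apply: integral_ge0 => t /=; rewrite in_itv/= andbT; exact: term0.
have a0 j : 0 <= K * gam ^+ 2 * 2 `^ p * gam ^+ j.
  by rewrite !mulr_ge0 ?powR_ge0 ?exprn_ge0// ltW.
apply: lime_le.
  by apply: is_cvg_nneseries => j _ _; rewrite mule_ge0// lee_fin.
apply: nearW => n; rewrite big_mkord -ge0_sume_distrl; last by move=> j _; rewrite lee_fin.
apply: lee_wpmul2r => //; rewrite sumEFin lee_fin -mulr_sumr.
apply: ler_wpM2l; first by rewrite !mulr_ge0 ?powR_ge0 ?exprn_ge0// ltW.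
by apply: geometric_sum_le => //; exact: ltW.
Qed.

(** The Lorentz functional is equivalent to the L^p(v) norm of the averaged
    rearrangement, which is subadditive. *)
Lemma hardy_lorentz_subadditive : exists2 C : R, 0 < C &
  forall n (f_ : nat -> R -> R), (forall i, measurable_fun setT (f_ i)) ->
  (lorentz_norm p v (fun x => \sum_(i < n) f_ i x)%R <=
    C%:E * \sum_(i < n) lorentz_norm p v (f_ i))%E.
Proof.
have C0 : 0 < C.
  by rewrite !mulr_gt0 ?powR_gt0 ?exprn_gt0// invr_gt0 subr_gt0.
pose N f := (weighted_power_integral p v (maximal_rearrangement f) `^ p^-1)%E.
exists (C `^ p^-1); first exact: powR_gt0.
have pV0 : 0 <= p^-1 by rewrite invr_ge0 ltW.
have NC f : measurable_fun setT f -> (N f <= (C `^ p^-1)%:E * lorentz_norm p v f)%E.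
  move=> mf; apply: (le_trans (ge0_le_poweR pV0 _ (hardy_inequality mf))).
    exact: weighted_power_integral_ge0.
  by rewrite poweRM ?lorentz_integral_ge0// ?lee_fin ?(ltW C0)// poweR_EFin lorentz_normE.
have fN f : measurable_fun setT f -> (lorentz_norm p v f <= N f)%E.
  move=> mf; apply: ge0_le_poweR => //; first exact: lorentz_integral_ge0.
  apply: le_weighted_power_integral => //.
  - exact: measurable_rearrangement.
  - exact: measurable_maximal_rearrangement.
  - by move=> t t0; rewrite rearrangement_ge0// rearrangement_le_maximal.
have ND f g : measurable_fun setT f -> measurable_fun setT g ->
    (N (fun x => f x + g x)%R <= N f + N g)%E.
  move=> mf mg; have mfg : measurable_fun setT (fun x => f x + g x) by exact: measurable_funD.
  have mM h : measurable_fun setT h -> measurable_fun (`]0, +oo[%classic : set R) (maximal_rearrangement h).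
    exact: measurable_maximal_rearrangement.
  apply: (le_trans _ (weighted_minkowski p1 dv (mM _ mf) (mM _ mg) _ _)).
  - apply: ge0_le_poweR => //; first exact: weighted_power_integral_ge0.
    apply: le_weighted_power_integral => //.
    + exact: mM.
    + by apply: emeasurable_funD; exact: mM.
    + by move=> t t0; rewrite maximal_rearrangement_ge0//= maximal_rearrangementD.
  - by move=> t t0; exact: maximal_rearrangement_ge0.
  - by move=> t t0; exact: maximal_rearrangement_ge0.
have msum n (f_ : nat -> R -> R) : (forall i, measurable_fun setT (f_ i)) ->
    measurable_fun setT (fun x => \sum_(i < n) f_ i x).
  by move=> mf; apply: measurable_sum.
have Nsum n (f_ : nat -> R -> R) : (forall i, measurable_fun setT (f_ i)) ->
    (N (fun x => \sum_(i < n) f_ i x)%R <= \sum_(i < n) N (f_ i))%E.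
  move=> mf; elim: n => [|n IHn].
    rewrite big_ord0 (_ : (fun x => _) = fun=> 0); last first.
      by apply/funext => x; rewrite big_ord0.
    rewrite /N /weighted_power_integral integral0_eq ?poweR0r ?invr_eq0 ?gt_eqF//.
    move=> t /=; rewrite in_itv/= andbT => t0.
    by rewrite maximal_rearrangement_cst0// poweR0r ?gt_eqF// mul0e.
  rewrite (_ : (fun x => _) = fun x => (\sum_(i < n) f_ i x) + f_ n x); last first.
    by apply/funext => x; rewrite big_ord_recr.
  rewrite big_ord_recr/=; apply: (le_trans (ND _ _ _ _)) => //; first exact: msum.
  exact: leeD2r.
move=> n f_ mf; apply: (le_trans (fN _ (msum n f_ mf))).
apply: (le_trans (Nsum n f_ mf)); rewrite ge0_sume_distrr; last first.
  by move=> i _; rewrite lorentz_normE poweR_ge0.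
by apply: lee_sum => i _; exact: NC.
Qed.

End hardy.

Lemma Bp_lattice {R : realType} (v : R -> R) (p : R) : weight v -> 1 < p ->
  ~ {ae @lebesgue_measure R, forall x, 0 < x -> v x = 0} -> Bp p v ->
  quasi_normed_function_lattice (@lebesgue_measure R) (Lambda p v) /\
  finitely_subadditive (Lambda p v).
Proof.
move=> wv p1 nv Bv; have p0 : 0 < p by exact: lt_trans p1.
apply: Lambda_lattice => //; first exact: (Bp_primitive_gt0 wv p0 Bv nv).
have [K [th [K0 th0 th1 growth]]] := Bp_doubling_growth wv p0 Bv.
(* the rate is split into two equal factors: one pays for the weights of the
   series, the other one makes it converge *)
apply: (@hardy_lorentz_subadditive _ v wv p (ltW p1) K (Num.sqrt th)) => //.
- by rewrite sqrtr_gt0.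
- by rewrite -[ltRHS]sqrtr1 ltr_sqrt.
- by move=> r j r0; rewrite sqr_sqrtr ?(ltW th0)// growth.
Qed.

(** * Sufficiency of the condition B_{1,oo} *)

Section concave_step_weight.
Context {R : realType}.
Local Notation leb := (@lebesgue_measure R).
Variables (dl : R) (dl0 : 0 < dl) (u : nat -> R) (m : nat).
Hypotheses (u0 : forall j, 0 <= u j) (und : forall j, u j <= u j.+1)
  (u_two : u 1%N <= 2 * u 0%N) (u_concave : forall j, u j.+2 + 2 * u j <= 3 * u j.+1).

(** The interpolation points 2^j dl. *)
Definition dyadic_point j : R := 2 ^+ j * dl.
Local Notation tau := dyadic_point.

Lemma dyadic_point_gt0 j : 0 < tau j.
Proof. by rewrite mulr_gt0// exprn_gt0. Qed.

Lemma dyadic_pointS j : tau j.+1 = 2 * tau j.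
Proof. by rewrite /tau exprS mulrA. Qed.

Lemma dyadic_point_nondecreasing : {homo tau : i j / (i <= j)%N >-> i <= j}.
Proof.
move=> i j ij; rewrite /tau ler_pM2r//; apply: ler_weXn2l => //.
by rewrite ler1n.
Qed.

(** The slope, on the j-th of the intervals (0, tau 0), (tau 0, tau 1), ..., of
    the piecewise linear function with value 0 at 0 and [u j] at [tau j]. *)
Definition dyadic_slope j : R :=
  if j is i.+1 then (u i.+1 - u i) / tau i else u 0%N / tau 0.

Lemma dyadic_slope_ge0 j : 0 <= dyadic_slope j.
Proof.
by case: j => [|j] /=; rewrite divr_ge0 ?subr_ge0// ltW// dyadic_point_gt0.
Qed.

Lemma dyadic_slope_nonincreasing j : dyadic_slope j.+1 <= dyadic_slope j.
Proof.
have t0 := dyadic_point_gt0; case: j => [|j].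
  rewrite /= ler_pM2r ?invr_gt0// lerBlDr (le_trans u_two)// mulr2n mulrDl mul1r//.
rewrite /= dyadic_pointS invfM mulrA ler_pM2r ?invr_gt0// ler_pdivrMr//.
have := u_concave j; lra.
Qed.

(** The slopes up to the point [tau m], and 0 beyond it. *)
Definition truncated_slope j : R := if (j <= m)%N then dyadic_slope j else 0.

(** The decrease of the slope at [tau j]; nonnegative by concavity. *)
Definition step_coef j : R := truncated_slope j - truncated_slope j.+1.

Lemma step_coef_ge0 j : 0 <= step_coef j.
Proof.
rewrite subr_ge0 /truncated_slope; case: ifPn => [jm|_].
  by rewrite (ltnW jm) dyadic_slope_nonincreasing.
by case: ifPn => // _; exact: dyadic_slope_ge0.
Qed.

(** The piecewise linear interpolant, constant beyond [tau m], written as a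
    positive combination of the functions min(r, tau j). *)
Definition step_primitive r : R := \sum_(0 <= j < m.+1) step_coef j * Num.min r (tau j).

Lemma step_coef_sum i : (i <= m.+1)%N ->
  \sum_(i <= j < m.+1) step_coef j = truncated_slope i.
Proof.
move=> im; rewrite (eq_bigr (fun j => - (truncated_slope j.+1 - truncated_slope j))); last first.
  by move=> j _; rewrite opprB.
by rewrite sumrN telescope_sumr// opprB {2}/truncated_slope ltnn subr0.
Qed.

Lemma step_primitive_nondecreasing r s : r <= s -> step_primitive r <= step_primitive s.
Proof.
move=> rs; apply: ler_sum => j _; apply: ler_wpM2l; first exact: step_coef_ge0.
by rewrite le_min !ge_min rs lexx orbT.
Qed.

Lemma step_primitive_le_linear r : 0 <= r -> step_primitive r <= r / dl * u 0%N.
Proof.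
move=> r0; apply: (@le_trans _ _ (\sum_(0 <= j < m.+1) step_coef j * r)).
  apply: ler_sum => j _; apply: ler_wpM2l; first exact: step_coef_ge0.
  by rewrite ge_min lexx.
rewrite -mulr_suml step_coef_sum// /truncated_slope/= /tau expr0 mul1r.
by rewrite le_eqVlt; apply/orP; left; apply/eqP; ring.
Qed.

(** The interpolant takes the prescribed values: the terms with j > i add up to
    tau i times a slope, and the other ones are summed by parts. *)
Lemma step_primitive_point i : (i <= m)%N -> step_primitive (tau i) = u i.
Proof.
move=> im; rewrite /step_primitive (big_cat_nat _ (n := i.+1))//=.
rewrite (@eq_big_nat _ _ _ i.+1 m.+1 _ (fun j => step_coef j * tau i)); last first.
  move=> j /andP[ij _]; congr (_ * _); apply/min_idPl.
  by apply: dyadic_point_nondecreasing; exact: ltnW.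
rewrite -mulr_suml step_coef_sum// (@eq_big_nat _ _ _ 0 i.+1 _ (fun j => step_coef j * tau j)); last first.
  move=> j /andP[_ ji]; congr (_ * _); apply/min_idPr.
  exact: dyadic_point_nondecreasing.
have tn0 j : tau j != 0 by rewrite gt_eqF// dyadic_point_gt0.
elim: i im => [|i IHi] im.
  rewrite big_nat1 /step_coef [in X in X * _ + _]/truncated_slope/= -mulrDl subrK.
  by rewrite mulrVK// unitfE tn0.
rewrite big_nat_recr//= [step_coef i.+1]/step_coef mulrBl -addrA subrK.
have IH := IHi (ltnW im); have tsE : truncated_slope i.+1 = (u i.+1 - u i) / tau i.
  by rewrite /truncated_slope im.
have sE : \sum_(0 <= j < i.+1) step_coef j * tau j = u i - (u i.+1 - u i).
  apply/eqP; rewrite eq_sym subr_eq -[X in X == _]IH tsE.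
  by rewrite mulfVK.
by rewrite sE tsE dyadic_pointS; field.
Qed.

(** The derivative of [step_primitive]: a decreasing step function, written as
    a positive combination of indicators of the intervals (0, tau j). *)
Definition step_weight (t : R) : R :=
  \sum_(0 <= j < m.+1) step_coef j * \1_(`]0, tau j[%classic) t.

Lemma step_weight_density : nonneg_density step_weight.
Proof.
split=> [x _|].
  by apply: sumr_ge0 => j _; rewrite mulr_ge0 ?step_coef_ge0// indicE ler0n.
by apply: measurable_sum => j; apply: measurable_funM => //;
  apply: measurable_indic; exact: measurable_itv.
Qed.

Lemma step_weight_integral (g : R -> \bar R) :
  measurable_fun (`]0%R, +oo[%classic : set R) g -> (forall t, 0 < t -> (0 <= g t)%E) ->
  (\int[leb]_(t in `]0%R, +oo[) (g t * (step_weight t)%:E) =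
   \sum_(0 <= j < m.+1) (step_coef j)%:E * \int[leb]_(t in `]0%R, (tau j)[) g t)%E.
Proof.
move=> mg g0.
have m1 j : measurable_fun (`]0%R, +oo[%classic : set R)
    (fun t => g t * (\1_(`]0%R, (tau j)[%classic) t)%:E)%E.
  apply: emeasurable_funM => //; apply/measurable_EFinP.
  by apply: measurable_indic; exact: measurable_itv.
have ge0 j t : 0 < t -> (0 <= g t * (\1_(`]0%R, (tau j)[%classic) t)%:E)%E.
  by move=> t0; rewrite mule_ge0 ?g0// lee_fin indicE ler0n.
transitivity (\int[leb]_(t in `]0%R, +oo[) \sum_(0 <= j < m.+1)
    (step_coef j)%:E * (g t * (\1_(`]0%R, (tau j)[%classic) t)%:E))%E.
  apply: eq_integral => t; rewrite inE/= in_itv/= andbT => t0.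
  rewrite /step_weight -sumEFin ge0_sume_distrr; last first.
    by move=> j _; rewrite lee_fin mulr_ge0 ?step_coef_ge0// indicE ler0n.
  by apply: eq_bigr => j _; rewrite EFinM muleCA.
rewrite ge0_integral_sum//; last 2 first.
- by move=> j; apply: measurable_funeM; exact: m1.
- move=> j t /=; rewrite in_itv/= andbT => t0.
  by apply: mule_ge0; [rewrite lee_fin step_coef_ge0|exact: ge0].
apply: eq_bigr => j _.
rewrite ge0_integralZl_EFin; [|by []| |exact: m1|exact: step_coef_ge0]; last first.
  by move=> t /=; rewrite in_itv/= andbT; exact: ge0.
by rewrite integral_half_line_indic.
Qed.

Lemma step_weight_primitive (r : R) : 0 < r ->
  (\int[leb]_(t in `]0%R, r[) (step_weight t)%:E = (step_primitive r)%:E)%E.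
Proof.
move=> r0; rewrite -integral_half_line_indic.
under eq_integral do rewrite muleC.
rewrite step_weight_integral; last 2 first.
- apply/measurable_EFinP; apply: measurable_indic; exact: measurable_itv.
- by move=> t _; rewrite lee_fin indicE ler0n.
rewrite /step_primitive -sumEFin; apply: eq_bigr => j _; rewrite EFinM; congr (_ * _)%E.
rewrite integral_indic//; have t0 := dyadic_point_gt0 j.
rewrite (_ : _ `&` _ = `]0%R, (Num.min r (tau j))[%classic); last first.
  apply/seteqP; split => x; rewrite /= !in_itv/= lt_min.
    by move=> [/andP[-> ->] /andP[_ ->]].
  by move=> /and3P[-> -> ->].
apply: (etrans (lebesgue_measure_itv _)) => /=.
by rewrite lte_fin lt_min r0 t0 sube0.
Qed.

Lemma step_lorentz_integralE f : measurable_fun setT f ->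
  lorentz_integral 1 step_weight f =
  (\sum_(0 <= j < m.+1) (step_coef j)%:E * rearrangement_integral f (tau j))%E.
Proof.
move=> mf; rewrite -step_weight_integral; last 2 first.
- exact: measurable_rearrangement.
- by move=> t _; exact: rearrangement_ge0.
by apply: eq_integral => t _; rewrite poweRe1// rearrangement_ge0.
Qed.

(** For p = 1 and this weight the Lorentz functional is a positive combination
    of the integrals of the rearrangement over (0, tau j), each of which is
    subadditive. *)
Lemma step_lorentz_integral_sum n (f_ : nat -> R -> R) :
  (forall i, measurable_fun setT (f_ i)) ->
  (lorentz_integral 1 step_weight (fun x => \sum_(i < n) f_ i x)%R <=
   \sum_(i < n) lorentz_integral 1 step_weight (f_ i))%E.
Proof.
move=> mf; have msum k : measurable_fun setT (fun x => \sum_(i < k) f_ i x).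
  exact: measurable_sum.
elim: n => [|n IHn].
  rewrite big_ord0 (_ : (fun x => _) = fun x => 0 * f_ 0%N x); last first.
    by apply/funext => x; rewrite big_ord0 mul0r.
  rewrite (lorentz_integralZ _ step_weight_density); last exact: mf.
  by rewrite normr0 powR0 ?oner_eq0// mul0e.
rewrite big_ord_recr/=; apply: (le_trans _ (leeD2r _ IHn)).
rewrite (_ : (fun x => _) = fun x => (\sum_(i < n) f_ i x) + f_ n x); last first.
  by apply/funext => x; rewrite big_ord_recr.
have msn : measurable_fun setT (fun x : R => \sum_(i < n) f_ i x) by exact: msum.
rewrite !step_lorentz_integralE//; last exact: measurable_funD.
rewrite -big_split/=; apply: lee_sum => j _.
rewrite -ge0_muleDr ?rearrangement_integral_ge0//.
apply: lee_wpmul2l; first by rewrite lee_fin step_coef_ge0.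
by apply: rearrangement_integralD; [exact: msum|exact: mf|exact: dyadic_point_gt0].
Qed.

End concave_step_weight.

Section B1oo_sufficiency.
Context {R : realType}.
Local Notation leb := (@lebesgue_measure R).
Variables (v : R -> R) (wv : weight v).
Variables (C : R) (C0 : 0 < C).
Local Notation V := (primitive v).
Hypothesis quasi_concave : forall s r, 0 < s -> s <= r -> r^-1 * V r <= C / s * V s.
Implicit Types (r s t : R).

Let V0 r : 0 <= V r. Proof. exact: primitive_ge0. Qed.

(** The values at [t] of the affine functions (1 + t / s) V(s). *)
Definition concave_set t : set R := [set (1 + t / s) * V s | s in [set s | 0 < s]].

(** The infimum of the affine functions (1 + t / s) V(s) of t: a concave
    function, equivalent to V when V(r) / r is decreasing up to a constant. *)
Definition concave_primitive t : R := inf (concave_set t).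
Local Notation W := concave_primitive.

Lemma concave_primitive_le t s : 0 <= t -> 0 < s -> W t <= (1 + t / s) * V s.
Proof.
move=> t0 s0; apply: ge_inf; last by exists s.
exists 0 => _ [r /= r0 <-].
by rewrite mulr_ge0// addr_ge0// divr_ge0// ltW.
Qed.

Lemma concave_primitive_ge t (x : R) :
  (forall s, 0 < s -> x <= (1 + t / s) * V s) -> x <= W t.
Proof.
move=> xV; apply: lb_le_inf; first by exists ((1 + t / 1) * V 1); exists 1 => //=; exact: ltr01.
by move=> _ [s /= s0 <-]; exact: xV.
Qed.

Lemma concave_primitive_ge0 t : 0 <= t -> 0 <= W t.
Proof.
move=> t0; apply: concave_primitive_ge => s s0.
by rewrite mulr_ge0// addr_ge0// divr_ge0// ltW.
Qed.

Lemma concave_primitive_nondecreasing t t' : 0 <= t -> t <= t' -> W t <= W t'.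
Proof.
move=> t0 tt'; apply: concave_primitive_ge => s s0.
apply: (le_trans (concave_primitive_le t0 s0)).
by rewrite ler_wpM2r// lerD2l ler_wpM2r// invr_ge0 ltW.
Qed.

Lemma concave_primitive_upper t : 0 < t -> W t <= 2 * V t.
Proof.
move=> t0; apply: (le_trans (concave_primitive_le (ltW t0) t0)).
by rewrite mulfV ?gt_eqF.
Qed.

Lemma concave_primitive_lower t : 0 < t -> V t <= (1 + C) * W t.
Proof.
move=> t0; have C1 : 0 < 1 + C by rewrite addr_gt0.
rewrite -ler_pdivrMl//; apply: concave_primitive_ge => s s0.
rewrite ler_pdivrMl//.
have ts0 : 0 <= t / s by rewrite divr_ge0// ltW.
(* the hypothesis gives V(t) <= C (t / s) V(s) for s <= t; for t <= s
   monotonicity suffices *)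
have [st|ts] := leP s t.
  have := quasi_concave s0 st; rewrite ler_pdivrMl// => /le_trans; apply.
  rewrite (_ : t * (C / s * V s) = C * (t / s) * V s); last by ring.
  rewrite [leRHS]mulrA ler_wpM2r//.
  rewrite (_ : (1 + C) * (1 + t / s) = C * (t / s) + (1 + C + t / s)); last by ring.
  by rewrite lerDl addr_ge0// ltW.
apply: (@le_trans _ _ (V s)); first by apply: primitive_nondecreasing => //; exact: ltW.
rewrite mulrA ler_peMl//; apply: (@le_trans _ _ (1 * 1)); first by rewrite mulr1.
by apply: ler_pM => //; rewrite lerDl ?ts0 ?ltW.
Qed.

Lemma concave_primitive_double t : 0 <= t -> W (2 * t) <= 2 * W t.
Proof.
move=> t0; rewrite -ler_pdivrMl//; apply: concave_primitive_ge => s s0.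
rewrite ler_pdivrMl//.
apply: (le_trans (concave_primitive_le _ s0)); first by rewrite mulr_ge0.
rewrite mulrA ler_wpM2r// mulrDr mulr1 mulrA lerD2r.
by rewrite ler1n.
Qed.

(** Concavity at 2 t = (1/3) (4 t) + (2/3) t, the form of concavity that dyadic
    interpolation needs. *)
Lemma concave_primitive_concave t : 0 <= t -> W (4 * t) + 2 * W t <= 3 * W (2 * t).
Proof.
move=> t0; rewrite -ler_pdivrMl//; apply: concave_primitive_ge => s s0.
rewrite ler_pdivrMl//.
have h4 : W (4 * t) <= (1 + 4 * t / s) * V s by apply: concave_primitive_le => //; rewrite mulr_ge0.
have h1 : 2 * W t <= 2 * ((1 + t / s) * V s) by rewrite ler_pM2l// concave_primitive_le.
apply: (le_trans (lerD h4 h1)).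
by rewrite le_eqVlt; apply/orP; left; apply/eqP; ring.
Qed.

End B1oo_sufficiency.

Section B1oo_step_weights.
Context {R : realType}.
Local Notation leb := (@lebesgue_measure R).
Variables (v : R -> R) (wv : weight v).
Variables (C : R) (C0 : 0 < C).
Local Notation V := (primitive v).
Hypothesis quasi_concave : forall s r, 0 < s -> s <= r -> r^-1 * V r <= C / s * V s.
Implicit Types (r s t : R).

Let dv : nonneg_density v. Proof. exact: weight_density. Qed.
Let v0 x : 0 < x -> 0 <= v x. Proof. by case: wv => + _; exact. Qed.
Let V0 r : 0 <= V r. Proof. exact: primitive_ge0. Qed.
Local Notation W := (concave_primitive v).

(** Since W(0) >= 0, concavity makes W(t) / t nonincreasing. *)
Lemma concave_primitive_ratio r t : 0 < r -> r <= t -> r / t * W t <= W r.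
Proof.
move=> r0 rt; have t0 := lt_le_trans r0 rt; apply: concave_primitive_ge => s s0.
have rt0 : 0 <= r / t by rewrite divr_ge0// ltW.
apply: (le_trans (ler_wpM2l rt0 (concave_primitive_le wv (ltW t0) s0))).
rewrite mulrA ler_wpM2r// (_ : r / t * (1 + t / s) = r / t + r / s); last first.
  by field; rewrite !gt_eqF.
by rewrite lerD2r ler_pdivrMr// mul1r.
Qed.

Variable n : nat.
Let dl : R := 2 ^- n.
Let m : nat := (n + n)%N.
Let dl0 : 0 < dl. Proof. by rewrite invr_gt0 exprn_gt0. Qed.
Local Notation tau := (dyadic_point dl).
Let u j := W (tau j).

Let tau0 j : 0 < tau j. Proof. exact: dyadic_point_gt0. Qed.
Let taum : tau m = 2 ^+ n.
Proof. by rewrite /dyadic_point /m exprD mulfK// expf_neq0. Qed.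
Let u0 j : 0 <= u j. Proof. by apply: concave_primitive_ge0 => //; exact: ltW. Qed.
Let und j : u j <= u j.+1.
Proof.
apply: concave_primitive_nondecreasing => //; first exact: ltW.
exact: dyadic_point_nondecreasing.
Qed.
Let udbl j : u j.+1 <= 2 * u j.
Proof. by rewrite /u dyadic_pointS; apply: concave_primitive_double => //; exact: ltW. Qed.
Let uconc j : u j.+2 + 2 * u j <= 3 * u j.+1.
Proof.
rewrite /u !dyadic_pointS mulrA -natrM; apply: concave_primitive_concave => //; exact: ltW.
Qed.

Local Notation Sp := (step_primitive dl u m).
Local Notation w := (step_weight dl u m).

Lemma dyadic_point_bracket r : dl <= r -> r < tau m ->
  exists i, [/\ (i < m)%N, tau i <= r & r < tau i.+1].
Proof.
move=> dr rm; have ex : exists k, r < tau k by exists m.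
case: (ex_minnP ex) => k rk kmin; case: k rk kmin => [|i] rk kmin.
  by move: rk; rewrite /dyadic_point expr0 mul1r ltNge dr.
exists i; split => //; first exact: kmin.
by rewrite leNgt; apply/negP => /kmin; rewrite ltnn.
Qed.

(** Since W(2 t) <= 2 W(t), interpolating W at dyadic points costs a factor 2
    between consecutive points, and W <= 2 V costs another one. *)
Lemma step_primitive_upper r : 0 < r -> Sp r <= 4 * V r.
Proof.
move=> r0; have W2 : W r <= 2 * V r by exact: concave_primitive_upper.
have W4 : W r <= 4 * V r.
  by apply: (le_trans W2); rewrite ler_wpM2r// ler_nat.
have [rd|dr] := ltP r dl.
  apply: le_trans W4; apply: (le_trans (step_primitive_le_linear dl0 m u0 und (udbl 0%N) uconc (ltW r0))).
  have -> : u 0%N = W dl by rewrite /u /dyadic_point expr0 mul1r.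
  exact: concave_primitive_ratio (ltW rd).
have [rm|mr] := ltP r (tau m).
  have [i [im ir ri]] := dyadic_point_bracket dr rm.
  apply: (@le_trans _ _ (Sp (tau i.+1))).
    exact/(step_primitive_nondecreasing dl0 m u0 und (udbl 0%N) uconc)/ltW.
  rewrite (step_primitive_point dl0 u im) (le_trans (udbl i))//.
  apply: (@le_trans _ _ (2 * W r)).
    by rewrite ler_pM2l// concave_primitive_nondecreasing// ltW.
  by apply: (@le_trans _ _ (2 * (2 * V r))); rewrite ?ler_pM2l// mulrA -natrM.
apply: le_trans W4; apply: (@le_trans _ _ (Sp (tau m))).
  apply: ler_sum_nat => j /andP[_ jm]; apply: ler_wpM2l.
    exact: (step_coef_ge0 dl0 m u0 und (udbl 0%N) uconc).
  rewrite le_min !ge_min lexx orbT andbT.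
  by rewrite (dyadic_point_nondecreasing dl0) ?orbT// -ltnS.
rewrite (step_primitive_point dl0 u (leqnn m)).
by apply: concave_primitive_nondecreasing => //; exact: ltW.
Qed.

(** The converse comparison, on the range of the interpolation points only: the
    step weight vanishes beyond the last one, and is constant before the first
    one. *)
Lemma step_primitive_lower r : dl <= r -> V (Num.min r (tau m)) <= 2 * (1 + C) * Sp r.
Proof.
move=> dr; have r0 : 0 < r by exact: lt_le_trans dr.
have mono := step_primitive_nondecreasing dl0 m u0 und (udbl 0%N) uconc.
have C1 : 0 < 1 + C by rewrite addr_gt0.
have [rm|mr] := ltP r (tau m).
  have [i [im ir ri]] := dyadic_point_bracket dr rm.
  apply: (le_trans (concave_primitive_lower wv C0 quasi_concave r0)).
  rewrite [2 * (1 + C)]mulrC -mulrA ler_pM2l//.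
  apply: (@le_trans _ _ (u i.+1)).
    by apply: concave_primitive_nondecreasing => //; exact: ltW.
  apply: (le_trans (udbl i)); rewrite ler_pM2l// -(step_primitive_point dl0 u (ltnW im)).
  exact: mono.
apply: (le_trans (concave_primitive_lower wv C0 quasi_concave (tau0 m))).
rewrite [2 * (1 + C)]mulrC -mulrA ler_pM2l//.
have Sr : W (tau m) <= Sp r by rewrite -[leLHS](step_primitive_point dl0 u (leqnn m)); exact: mono.
by rewrite (le_trans Sr)// ler_peMl ?ler1n// (le_trans _ Sr)// u0.
Qed.

(** The weight [v] restricted to [2^-n, 2^n), the range of the interpolation
    points. *)
Definition truncated_weight t : R := v t * \1_(`[2 ^- n, 2 ^+ n[%classic) t.

Lemma truncated_weight_density : nonneg_density truncated_weight.
Proof.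
split=> [x x0|]; first by rewrite mulr_ge0 ?v0// indicE ler0n.
apply: measurable_funM; first by case: dv.
by apply: measurable_indic; exact: measurable_itv.
Qed.

Lemma truncated_weight_primitive_le r : 0 < r ->
  (\int[leb]_(x in `]0%R, (1 * r)%R[) (truncated_weight x)%:E <=
   (2 * (1 + C))%:E * \int[leb]_(x in `]0%R, r[) (w x)%:E)%E.
Proof.
move=> r0; rewrite mul1r.
rewrite (step_weight_primitive dl0 m u0 und (udbl 0%N) uconc r0) -EFinM.
have [rd|dr] := leP r dl.
  rewrite integral0_eq => [|x]; last first.
    rewrite /= in_itv/= => /andP[x0 xr]; rewrite /truncated_weight indicE memNset ?mulr0//=.
    by rewrite in_itv/= leNgt (lt_le_trans xr rd).
  rewrite lee_fin mulr_ge0//; first by rewrite mulr_ge0// addr_ge0// ltW.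
  rewrite sumr_ge0// => j _; rewrite mulr_ge0//.
    exact: (step_coef_ge0 dl0 m u0 und (udbl 0%N) uconc).
  by rewrite le_min !ltW.
apply: (@le_trans _ _ (V (Num.min r (tau m)))%:E); last by rewrite lee_fin step_primitive_lower// ltW.
rewrite -primitiveE// ?lt_min ?r0 ?tau0//.
rewrite integral_mkcond [leRHS]integral_mkcond; apply: ge0_le_integral => //.
- move=> x _; rewrite patchE; case: ifPn => //; rewrite inE/= in_itv/= lee_fin => /andP[x0 _].
  by case: truncated_weight_density => + _; apply.
- apply/(measurable_restrictT _ (measurable_itv _)).
  by apply: (measurable_density truncated_weight_density) => //; exact: itv0_subset.
- apply/(measurable_restrictT _ (measurable_itv _)).
  by apply: measurable_density => //; exact: itv0_subset.
move=> x _; rewrite !patchE; case: ifPn => [|_]; last first.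
  case: ifPn => //; rewrite inE/= in_itv/= => /andP[x0 _].
  by rewrite lee_fin v0.
rewrite inE/= in_itv/= => /andP[x0 xr].
rewrite /truncated_weight indicE; case: (boolP (x \in `[2 ^- n, 2 ^+ n[%classic)) => xn.
  rewrite mulr1 ifT// inE/= in_itv/= x0 lt_min xr taum.
  by move: xn; rewrite inE/= in_itv/= => /andP[].
rewrite mulr0; case: ifPn => //; rewrite inE/= in_itv/= => /andP[_ _].
by rewrite lee_fin v0.
Qed.

(** The truncated weight is bounded by the step weight, and the step weight by
    [v], in the sense of primitives; the constants 2 (1 + C) and 4 do not depend on
    the truncation. *)
Lemma truncated_lorentz_integral_sum k (f_ : nat -> R -> R) :
  (forall i, measurable_fun setT (f_ i)) ->
  (lorentz_integral 1 truncated_weight (fun x => \sum_(i < k) f_ i x)%R <=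
   (8 * (1 + C))%:E * \sum_(i < k) lorentz_integral 1 v (f_ i))%E.
Proof.
move=> mf; have msum : measurable_fun setT (fun x => \sum_(i < k) f_ i x).
  exact: measurable_sum.
have dw : nonneg_density w := step_weight_density dl0 m u0 und (udbl 0%N) uconc.
have C1 : 0 <= 2 * (1 + C) by rewrite mulr_ge0// addr_ge0// ltW.
have := le_dilated_lorentz_integral ltr01 truncated_weight_density dw msum ltr01 C1 truncated_weight_primitive_le.
under eq_integral do rewrite divr1; move=> h; apply: (le_trans h).
rewrite (_ : 8 * (1 + C) = 2 * (1 + C) * 4); last by ring.
rewrite [in leRHS]EFinM -muleA; apply: lee_wpmul2l; first by rewrite lee_fin.
apply: (le_trans (step_lorentz_integral_sum dl0 m u0 und (udbl 0%N) uconc k mf)).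
rewrite ge0_sume_distrr; last by move=> i _; exact: lorentz_integral_ge0.
apply: lee_sum => i _.
have := @le_dilated_lorentz_integral R 1 ltr01 w v 1 4 (f_ i) dw dv (mf i) ltr01.
under eq_integral do rewrite divr1; apply => // r r0.
rewrite mul1r (step_weight_primitive dl0 m u0 und (udbl 0%N) uconc r0) primitiveE//.
by rewrite -EFinM lee_fin step_primitive_upper.
Qed.

End B1oo_step_weights.

Lemma bigcup_dyadic_itv {R : realType} :
  \bigcup_n `[2 ^- n, 2 ^+ n[%classic = `]0, +oo[%classic :> set R.
Proof.
apply/seteqP; split => [x [n _]|x]; rewrite /= !in_itv/= andbT.
  by move=> /andP[+ _]; apply: lt_le_trans; rewrite invr_gt0 exprn_gt0.
move=> x0; pose N := (Num.truncn x + Num.truncn x^-1).+1.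
have nN k : (k <= N)%N -> k%:R <= 2 ^+ N :> R.
  move=> kN; rewrite -natrX ler_nat (leq_trans kN)// ltnW// ltn_expl//.
exists N => //=; rewrite in_itv/=; apply/andP; split; last first.
  by rewrite (lt_le_trans (truncnS_gt x))// nN// ltnS leq_addr.
rewrite -[leRHS]invrK lef_pV2 ?posrE ?exprn_gt0 ?invr_gt0//.
by rewrite (le_trans (ltW (truncnS_gt _)))// nN// ltnS leq_addl.
Qed.

Lemma B1oo_lattice {R : realType} (v : R -> R) : weight v ->
  ~ {ae @lebesgue_measure R, forall x, 0 < x -> v x = 0} -> B1oo v ->
  quasi_normed_function_lattice (@lebesgue_measure R) (Lambda 1 v) /\
  finitely_subadditive (Lambda 1 v).
Proof.
move=> wv nv [C C0 BC]; have dv := weight_density wv.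
have qc s r : 0 < s -> s <= r -> r^-1 * primitive v r <= C / s * primitive v s.
  move=> s0 sr; have := BC s r s0 sr.
  by rewrite !primitiveE// -?EFinM ?lee_fin// (lt_le_trans s0).
have Vpos : forall r, 0 < r -> 0 < primitive v r.
  apply: (primitive_gt0_doubling wv) => // r r0 Vr j.
  have rj : r <= 2 ^+ j * r by rewrite ler_peMl ?(ltW r0)// exprn_ege1// ler1n.
  have := qc r _ r0 rj; rewrite Vr mulr0 pmulr_rle0 ?invr_gt0 ?mulr_gt0 ?exprn_gt0// => h.
  by apply/eqP; rewrite eq_le h (primitive_ge0 wv).
apply: Lambda_lattice => //.
have C8 : 0 < 8 * (1 + C) by rewrite mulr_gt0// addr_gt0.
exists (8 * (1 + C)) => // n f_ mf.
have I0 g : (0 <= lorentz_integral 1 v g)%E by exact: lorentz_integral_ge0.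
have normE g : lorentz_norm 1 v g = lorentz_integral 1 v g.
  by rewrite lorentz_normE invr1 poweRe1.
rewrite normE; under eq_bigr do rewrite normE.
have msum : measurable_fun setT (fun x => \sum_(i < n) f_ i x) by exact: measurable_sum.
rewrite {1}/lorentz_integral -bigcup_dyadic_itv; apply: le_integral_exhaustion.
- apply/nondecreasing_seqP => k; apply/subsetPset => x; rewrite /= !in_itv/= => /andP[kx xk].
  have two : 2 ^+ k <= 2 ^+ k.+1 :> R by rewrite exprS ler_peMl ?exprn_ge0 ?ler1n.
  by rewrite (lt_le_trans xk two) andbT (le_trans _ kx)// lef_pV2 ?posrE ?exprn_gt0.
- by [].
- by rewrite bigcup_dyadic_itv; exact: measurable_lorentz_integrand.
- rewrite bigcup_dyadic_itv => x; rewrite /= in_itv/= andbT => x0.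
  by rewrite mule_ge0 ?poweR_ge0// lee_fin; case: dv => + _; apply.
move=> k; apply: le_trans (truncated_lorentz_integral_sum wv C0 qc k n mf).
rewrite /lorentz_integral integral_mkcond [leRHS]integral_mkcond.
rewrite le_eqVlt; apply/orP; left; apply/eqP; apply: eq_integral => x _.
rewrite !patchE /truncated_weight indicE.
case: (boolP (x \in `[2 ^- k, 2 ^+ k[%classic)) => xk.
  rewrite mulr1 ifT//; move: xk; rewrite !inE/= !in_itv/= andbT => /andP[+ _].
  by apply: lt_le_trans; rewrite invr_gt0 exprn_gt0.
by rewrite mulr0 mule0 if_same.
Qed.

(** * Mixed Lorentz spaces *)

(** Both cases of the statement on Lorentz spaces, for a condition [B] on
    weights that is necessary for finite subadditivity and sufficient for the
    lattice structure. The factors are treated through [homogeneous_lattice] in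
    one direction, since they are not known to be linear spaces there. *)
Lemma lorentz_mixed_normable {R : realType} (u v : R -> R) (p : R) (B : (R -> R) -> Prop) :
  0 < p ->
  (forall w, weight w -> linear_subspace (carrier (Lambda p w)) ->
     finitely_subadditive (Lambda p w) -> B w) ->
  (forall w, weight w -> ~ {ae @lebesgue_measure R, forall x, 0 < x -> w x = 0} -> B w ->
     quasi_normed_function_lattice (@lebesgue_measure R) (Lambda p w) /\
     finitely_subadditive (Lambda p w)) ->
  weight u -> weight v ->
  ~ {ae @lebesgue_measure R, forall x, 0 < x -> u x = 0} ->
  ~ {ae @lebesgue_measure R, forall x, 0 < x -> v x = 0} ->
  normable (@lebesgue_measure R \x @lebesgue_measure R)%E
    (mixed (T1 := measurableTypeR R) (T2 := measurableTypeR R)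
       (@lebesgue_measure R) (Lambda p u) (Lambda p v)) <->
  B u /\ B v.
Proof.
move=> p0 necB sufB wu wv nu nv; split.
  have hu := Lambda_homogeneous p0 (weight_density wu).
  have hv := Lambda_homogeneous p0 (weight_density wv).
  have [f Lf f0] := Lambda_nontrivial wu p0 nu.
  have [g Lg g0] := Lambda_nontrivial wv p0 nv.
  move=> /(mixed_factors hu hv Lf f0 Lg g0)[[linu subu] [linv subv]].
  by split; apply: necB; [exact: wu|exact: linu|exact: subu|exact: wv|exact: linv|exact: subv].
move=> [/(sufB u wu nu)[lu su] /(sufB v wv nv)[lv sv]].
have nmu : normable (@lebesgue_measure R) (Lambda p u).
  by have [linu _ qu _] := lu; exact: finitely_subadditive_normable linu qu su.
have nmv : normable (@lebesgue_measure R) (Lambda p v).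
  by have [linv _ qv _] := lv; exact: finitely_subadditive_normable linv qv sv.
exact: (mixed_normable lu lv nmu nmv).
Qed.

Theorem proposition2p2 (R : realType) :
  (forall (d1 d2 : measure_display)
      (T1 : measurableType d1) (T2 : measurableType d2)
      (mu1 : {sigma_finite_measure set T1 -> \bar R})
      (mu2 : {sigma_finite_measure set T2 -> \bar R})
      (E : fspace R T1) (F : fspace R T2),
    quasi_banach_function_lattice mu1 E ->
    quasi_banach_function_lattice mu2 F ->
    nontrivial_fspace mu1 E ->
    nontrivial_fspace mu2 F ->
    normable (mu1 \x mu2)%E (mixed mu1 E F) <->
    normable mu1 E /\ normable mu2 F)
  /\
  (forall u v : R -> R,
    weight u -> weight v ->
    ~ {ae @lebesgue_measure R, forall x, 0 < x -> u x = 0} ->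
    ~ {ae @lebesgue_measure R, forall x, 0 < x -> v x = 0} ->
    (forall p : R, 1 < p ->
       normable (@lebesgue_measure R \x @lebesgue_measure R)%E
         (mixed (T1 := measurableTypeR R) (T2 := measurableTypeR R)
            (@lebesgue_measure R) (Lambda p u) (Lambda p v)) <->
       Bp p u /\ Bp p v)
    /\
    (normable (@lebesgue_measure R \x @lebesgue_measure R)%E
       (mixed (T1 := measurableTypeR R) (T2 := measurableTypeR R)
            (@lebesgue_measure R) (Lambda 1 u) (Lambda 1 v)) <->
     B1oo u /\ B1oo v)).
Proof.
split=> [d1 d2 T1 T2 mu1 mu2 E F [lE _] [lF _] nE nF|u v wu wv nu nv].
  split; first exact: mixed_normable_factors.
  by move=> [nmE nmF]; exact: mixed_normable.
split=> [p p1|].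
  apply: (lorentz_mixed_normable _ _ _ wu wv nu nv); first exact: lt_trans p1.
    by move=> w ww; exact: Lambda_Bp.
  by move=> w ww nw; exact: Bp_lattice.
apply: (lorentz_mixed_normable _ _ _ wu wv nu nv); first exact: ltr01.
  by move=> w ww; exact: Lambda_B1oo.
by move=> w ww nw; exact: B1oo_lattice.
Qed.
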